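(* Let $N\ge2$ and let $(A_1,\dots,A_N)$ be nonnegative random variables satisfying $P\{\sum_{i}\mathbf{1}\{A_i>0\}\in\{0,1\}\}<1$, $\mathbb{E}[\sum_i\mathbf{1}\{A_i>0\}]>1$, $P\{A_i\in\{0,1\}\ \forall i\}<1$. Let $F_0$ be a distribution function satisfying $(\mathbf{H}_\gamma)$ (see context) for some $\gamma\in(0,2)$, and let $X_0$ have distribution function $F_0$. Assume $\mu(\delta)<\mu(\gamma)$ for some $\delta>\gamma$ with either $1\le\gamma<\delta\le2$ or $\gamma<\delta\le1$. Let $V_t$ be a random variable whose characteristic function is $\phi(t,\cdot)$, the solution of the Cauchy problem in the context with initial datum the characteristic function of $F_0$, and let $V_\infty$ be a random variable with characteristic function $\xi\mapsto\int_{[0,\infty)}\hat g_\gamma(\xi z^{1/\gamma})\zeta_{\infty,\gamma}(dz)$. Then for every $t\ge0$ $$\mathcal{W}_\delta(e^{-\mu(\gamma)t}V_t,V_\infty)^{\max(\delta,1)}\le c\,\mathcal{W}_\delta(X_0,V_\infty)^{\max(\delta,1)}e^{-t\delta[\mu(\gamma)-\mu(\delta)]},$$ with $c=1$ if $\delta\le1$ and $c=2$ otherwise.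
   Context: $\mathcal{Q}(s)=\mathbb{E}[\sum_{j=1}^N A_j^s]-1$ ($0^0=0$), $\mu(s)=\mathcal{Q}(s)/s$. Cauchy problem: $\phi(t,\cdot)$ characteristic functions with $\partial_t\phi(t,\xi)+\phi(t,\xi)=\mathbb{E}[\prod_{i=1}^N\phi(t,A_i\xi)]$, $\phi(0,\cdot)=\phi_0$ (unique solution). $(\mathbf{H}_\gamma)$: if $\gamma=1$: either (a) $\int|v|dF_0<\infty$, $m_0=\int v\,dF_0$, or (b) $F_0$ symmetric, $\lim_{x\to+\infty}x(1-F_0(x))=c_0^+=\lim_{x\to-\infty}|x|F_0(x)$, $0<c_0^+<\infty$. If $\gamma\in(0,1)\cup(1,2)$: $\lim_{x\to+\infty}x^\gamma(1-F_0(x))=c_0^+<\infty$, $\lim_{x\to-\infty}|x|^\gamma F_0(x)=c_0^-<\infty$, $c_0^++c_0^->0$, and $\int v\,dF_0=0$ if $\gamma>1$. $\hat g_\gamma(\xi)$: $e^{im_0\xi}$ if $\gamma=1$, (a); $e^{-\pi c_0^+|\xi|}$ if $\gamma=1$, (b); $\exp\{-k_0|\xi|^\gamma(1-i\eta_0\tan(\pi\gamma/2)\mathrm{sign}\,\xi)\}$ otherwise, with $k_0=(c_0^++c_0^-)\frac{\pi}{2\Gamma(\gamma)\sin(\pi\gamma/2)}$, $\eta_0=\frac{c_0^+-c_0^-}{c_0^++c_0^-}$. $\zeta_{\infty,\gamma}$: the unique probability on $[0,\infty)$ with mean $1$ whose Fourier–Stieltjes transform $v$ solves $v(\xi)=\int_0^1\mathbb{E}[\prod_{i=1}^N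 v(\xi A_i^\gamma\tau^{\mathcal{Q}(\gamma)})]d\tau$. Wasserstein distance of order $\delta>0$: $\mathcal{W}_\delta(X,Y)=\inf(\mathbb{E}|X'-Y'|^\delta)^{1/\max(\delta,1)}$, infimum over all pairs $(X',Y')$ with $X'\overset{d}{=}X$, $Y'\overset{d}{=}Y$ (possibly $+\infty$). *)

(* Defs.v *)
From HB Require Import structures.
From mathcomp Require Import all_boot all_order all_algebra.
From mathcomp Require Import all_classical all_reals all_analysis.
From mathcomp Require Import complex.
Set Implicit Arguments. Unset Strict Implicit. Unset Printing Implicit Defensive.
Import Order.TTheory GRing.Theory Num.Theory.
Import numFieldNormedType.Exports.
Local Open Scope classical_set_scope.
Local Open Scope ring_scope.
Local Open Scope complex_scope.

Section Defs.
Context {R : realType}.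

Definition cexpRI (a b : R) : R[i] := (expR a * cos b) +i* (expR a * sin b).

Definition cint d (T : measurableType d) (m : {measure set T -> \bar R}) (D : set T)
  (f : T -> R[i]) : R[i] :=
  (Rintegral m D (fun x => complex.Re (f x))) +i*
  (Rintegral m D (fun x => complex.Im (f x))).

Definition charfun (m : probability R R) (xi : R) : R[i] :=
  cint m setT (fun x => cos (xi * x) +i* sin (xi * x)).

Definition distrF (m : probability R R) (x : R) : R := fine (m `]-oo, x]%classic).

(** power with the convention 0^s = 0 (used for Q, including 0^0 = 0) *)
Definition pow0 (a s : R) : R := if a == 0 then 0 else a `^ s.

Definition Qfun d (Om : measurableType d) (P : probability Om R) (N : nat)
  (A : 'I_N -> Om -> R) (s : R) : \bar R :=
  (\int[P]_w (\sum_(i < N) pow0 (A i w) s)%:E - 1)%E.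

Definition mufun d (Om : measurableType d) (P : probability Om R) (N : nat)
  (A : 'I_N -> Om -> R) (s : R) : \bar R :=
  (Qfun P A s * (s^-1)%:E)%E.

Definition Gamma (x : R) : R :=
  Rintegral lebesgue_measure `]0, +oo[ (fun u => u `^ (x - 1) * expR (- u)).

Definition H_gamma_ghat (mu0 : probability R R) (gam : R) (g : R -> R[i]) : Prop :=
  let F0 := distrF mu0 in
  (gam = 1 /\
    (
     (mu0.-integrable setT (fun x => x%:E) /\
      g = (fun xi => cexpRI 0 (fine (\int[mu0]_x x%:E) * xi)))
     \/
     (exists c0p : R,
       (forall x, mu0 `]-oo, (- x)]%classic = mu0 `[x, +oo[%classic) /\
       (x * (1 - F0 x)) @[x --> +oo] --> c0p /\
       (`|x| * F0 x) @[x --> -oo] --> c0p /\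
       0 < c0p /\
       g = (fun xi => cexpRI (- (pi * c0p * `|xi|)) 0))))
  \/
  ((0 < gam < 1 \/ 1 < gam < 2) /\
   exists c0p c0m : R,
     (x `^ gam * (1 - F0 x)) @[x --> +oo] --> c0p /\
     (`|x| `^ gam * F0 x) @[x --> -oo] --> c0m /\
     0 < c0p + c0m /\
     (1 < gam -> (\int[mu0]_x x%:E = 0)%E) /\
     let k0 := (c0p + c0m) * (pi / (2 * Gamma gam * sin (pi * gam / 2))) in
     let eta0 := (c0p - c0m) / (c0p + c0m) in
     g = (fun xi => cexpRI (- (k0 * `|xi| `^ gam))
                           (k0 * `|xi| `^ gam * (eta0 * tan (pi * gam / 2) * Num.sg xi)))).

Definition solves_cauchy d (Om : measurableType d) (P : probability Om R)
  (N : nat) (A : 'I_N -> Om -> R) (mu0 : probability R R)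
  (nu : R -> probability R R) : Prop :=
  let phi := fun t xi => charfun (nu t) xi in
  (forall xi, phi 0 xi = charfun mu0 xi) /\
  forall xi,
    (complex.Re (phi s xi) @[s --> 0^'+] --> complex.Re (phi 0 xi)) /\
    (complex.Im (phi s xi) @[s --> 0^'+] --> complex.Im (phi 0 xi)) /\
    forall t, 0 < t ->
      derivable (fun s => complex.Re (phi s xi)) t 1 /\
      derivable (fun s => complex.Im (phi s xi)) t 1 /\
      (derive1 (fun s => complex.Re (phi s xi)) t +i*
       derive1 (fun s => complex.Im (phi s xi)) t) + phi t xi =
      cint P setT (fun w => \prod_(i < N) phi t (A i w * xi)).

Definition is_zeta_infty d (Om : measurableType d) (P : probability Om R)
  (N : nat) (A : 'I_N -> Om -> R) (gam : R) (zeta : probability R R) : Prop :=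
  zeta `[0, +oo[%classic = 1%E /\
  (\int[zeta]_x x%:E = 1)%E /\
  forall xi, charfun zeta xi =
    cint lebesgue_measure `[0, 1]
      (fun tau => cint P setT (fun w =>
         \prod_(i < N) charfun zeta
            (xi * (A i w `^ gam) * (tau `^ fine (Qfun P A gam))))).

Definition has_law d (T : measurableType d) (Q : probability T R) (X : T -> R)
  (m : set R -> \bar R) : Prop :=
  measurable_fun setT X /\ forall B, measurable B -> Q (X @^-1` B) = m B.

Definition scale_law (c : R) (m : set R -> \bar R) : set R -> \bar R :=
  fun B => m ((fun x => c * x) @^-1` B).

Definition Wcost (m1 m2 : set R -> \bar R) (delta : R) : \bar R :=
  ereal_inf [set r | exists (d : measure_display) (T : measurableType d)
     (Q : probability T R) (X Y : T -> R),
     has_law Q X m1 /\ has_law Q Y m2 /\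
     r = (\int[Q]_w (`|X w - Y w| `^ delta)%:E)%E].

Definition Wdist (m1 m2 : set R -> \bar R) (delta : R) : \bar R :=
  poweR (Wcost m1 m2 delta) (Num.max delta 1)^-1.

End Defs.

(* Main.v *)
(** Let [(X, Y)] be a coupling of [F_0] with the law of [V_oo]. Expanding the Cauchy
    problem as a Wild sum, [V_t] is a mixture, with weights [e^-t u^n],
    [u = 1 - e^-(N-1)t], of linear combinations of i.i.d. copies of [X] indexed by random
    [N]-ary trees with [n] nodes; attaching [(X, Y)] to the leaves couples [V_t] with the
    solution started from [V_oo], which is [e^(mu(gamma) t) V_oo] because [zeta] is a
    fixed point. A solution has these coefficients by a Gronwall comparison with the
    truncated sums, and laws are recovered from characteristic functions. The
    [delta]-th absolute moment of the difference obeys, by subadditivity of [x^delta] if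
    [delta <= 1] and by the von Bahr-Esseen inequality if [1 < delta <= 2], a recursion
    along the trees whose solution sums to [e^(Q(delta) t)]. The second case needs
    [E (X - Y) = 0], read off the characteristic functions of [X] and [Y] near [0]. *)
Require Import Defs.
From HB Require Import structures.
From mathcomp Require Import all_boot all_order all_algebra.
From mathcomp Require Import all_classical all_reals all_analysis.
From mathcomp Require Import measurable_realfun complex ring lra.
Set Implicit Arguments. Unset Strict Implicit. Unset Printing Implicit Defensive.
Import Order.TTheory GRing.Theory Num.Theory.
Import numFieldNormedType.Exports.
Local Open Scope classical_set_scope.
Local Open Scope ring_scope.

(** * Rising binomials *)

(** The exponents come from one generating function: with [1 - u = e^-(N-1)t], the series of
    [(1 - u)^-a] sums to [e^(a(N-1)t)]. Tree laws are therefore kept as unnormalised measures, whose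
    masses are the coefficients of [(1 - u)^(-1/(N-1))], and masses, costs and truncation errors
    reduce to convolutions of such coefficients.

    The constant 2 must not compound along a tree. What is propagated is a bound of
    [E|y + b D|^delta - |y|^delta] by [b^delta] times a constant, for all real [y] and all [b >= 0]:
    a leaf pays the factor 2 once, and the bound composes without further loss.

    In the comparison of a solution with the truncated sums, the equation relates [xi] to the points
    [A_i xi], so the estimates must be uniform in [xi]; no regularity in time of a supremum over
    [xi] is at hand, and the bound is improved iteratively instead.

    The equation of [zeta] is one between characteristic functions, whereas [ghat] calls for its
    transform at complex arguments: it has to be turned into an equality of laws. Nor need [X] and
    [Y] be integrable separately, so the mean of [X - Y] is reached through [n E sin(X/n)]. *)

Section rising_binomials.
Context {R : realType}.
Implicit Types a b : R.

(** Rising factorial over factorial, the coefficient of [u^n] in [(1 - u)^-a]. *)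
Definition rbin (a : R) (n : nat) : R := \prod_(j < n) ((a + j%:R) / j.+1%:R).

Lemma rbin0 a : rbin a 0 = 1.
Proof. by rewrite /rbin big_ord0. Qed.

Lemma rbinS a n : n.+1%:R * rbin a n.+1 = (a + n%:R) * rbin a n.
Proof.
have n0 : n.+1%:R != 0 :> R by rewrite pnatr_eq0.
by rewrite /rbin big_ord_recr /=; field; rewrite addrC natr1.
Qed.

(** Coefficient form of [d/du (1 - u)^-a = a (1 - u)^-(a + 1)]. It is what absorbs the prefactor
    [al / n.+1] of the recursion over trees. *)
Lemma rbinSS a n : n.+1%:R * rbin a n.+1 = a * rbin (a + 1) n.
Proof.
elim: n => [|n IH]; first by rewrite rbinS !rbin0; ring.
have n0 : n.+1%:R != 0 :> R by rewrite pnatr_eq0.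
rewrite rbinS; apply: (mulfI n0).
by rewrite mulrCA IH [in RHS]mulrCA rbinS -natr1; ring.
Qed.

Lemma rbin_ge0 a n : 0 <= a -> 0 <= rbin a n.
Proof. by move=> a0; apply: prodr_ge0 => i _; rewrite divr_ge0// addr_ge0. Qed.

Lemma rbin_base0 n : rbin 0 n = (n == 0%N)%:R.
Proof.
case: n => [|n]; first by rewrite rbin0.
have n0 : n.+1%:R != 0 :> R by rewrite pnatr_eq0.
by apply: (mulfI n0); rewrite rbinSS mul0r/= mulr0.
Qed.

(* Vandermonde convolution, from [(1 - u)^-a * (1 - u)^-b = (1 - u)^-(a + b)] *)
Lemma rbin_conv a b n :
  \sum_(m < n.+1) rbin a m * rbin b (n - m) = rbin (a + b) n.
Proof.
elim: n => [|n IH]; first by rewrite big_ord1 !rbin0 mulr1.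
have n0 : n.+1%:R != 0 :> R by rewrite pnatr_eq0.
apply: (mulfI n0); rewrite rbinS -IH.
transitivity (\sum_(m < n.+2) (m%:R * rbin a m * rbin b (n.+1 - m)
   + rbin a m * ((n.+1 - m)%:R * rbin b (n.+1 - m)))).
  rewrite mulr_sumr; apply: eq_bigr => -[m /=]; rewrite ltnS => mn _.
  have -> : n.+1%:R = m%:R + (n.+1 - m)%:R :> R by rewrite -natrD subnKC.
  ring.
rewrite big_split /= big_ord_recl /= !mul0r add0r.
rewrite [X in _ + X]big_ord_recr /= subnn mul0r mulr0 addr0.
rewrite -big_split mulr_sumr; apply: eq_bigr => -[m /=]; rewrite ltnS => mn _.
rewrite /bump /= add1n subSS rbinS subSn// rbinS.
have -> : n%:R = m%:R + (n - m)%:R :> R by rewrite -natrD subnKC.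
ring.
Qed.

End rising_binomials.

(** * Comparison of functions through their derivatives *)

Section comparison.
Context {R : realType}.

(** Mean value theorem; at [0] only right continuity is assumed, as in the Cauchy problem. *)
Lemma ge0_derive_le (f df : R -> R) (t : R) : 0 <= t ->
  f s @[s --> (0 : R)^'+] --> f 0 ->
  (forall s : R, 0 < s -> is_derive s 1 f (df s)) ->
  (forall s, 0 < s <= t -> 0 <= df s) -> f 0 <= f t.
Proof.
rewrite le_eqVlt => /predU1P[<-//|t0] f0 fd df0.
have dif s : 0 < s -> {for s, continuous f}.
  move=> s0; apply/differentiable_continuous/derivable1_diffP.
  by have [] := fd _ s0.
have cf : {within `[0, t], continuous f}.
  apply/continuous_within_itvP => //; split => //.
    by move=> x; rewrite in_itv/= => /andP[x0 _]; exact: dif.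
  exact/cvg_at_left_filter/dif.
have fd' x : x \in `]0, t[ -> is_derive x 1 f (df x).
  by rewrite in_itv/= => /andP[x0 _]; exact: fd.
have [c] := MVT t0 fd' cf.
rewrite in_itv/= => /andP[c0 ct] /eqP; rewrite subr0 -subr_ge0 => /eqP ->.
by rewrite mulr_ge0 ?(ltW t0)// df0// c0 ltW.
Qed.

(** Both [g - f] and [g + f] are nondecreasing. *)
Lemma derive_norm_le (f df g dg : R -> R) (t : R) : 0 <= t ->
  f s @[s --> (0 : R)^'+] --> f 0 -> g s @[s --> (0 : R)^'+] --> g 0 ->
  (forall s : R, 0 < s -> is_derive s 1 f (df s)) ->
  (forall s : R, 0 < s -> is_derive s 1 g (dg s)) ->
  (forall s, 0 < s <= t -> `|df s| <= dg s) -> `|f t - f 0| <= g t - g 0.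
Proof.
move=> t0 f0 g0 fd gd fg.
have h1 : (g \- f) 0 <= (g \- f) t.
  apply: (@ge0_derive_le _ (dg \- df)) => //; first exact: cvgB.
    by move=> s s0; apply: is_deriveB; [exact: gd|exact: fd].
  by move=> s /fg; rewrite ler_norml subr_ge0 => /andP[].
have h2 : (g \+ f) 0 <= (g \+ f) t.
  apply: (@ge0_derive_le _ (dg \+ df)) => //; first exact: cvgD.
    by move=> s s0; apply: is_deriveD; [exact: gd|exact: fd].
  by move=> s /fg; rewrite ler_norml /= => /andP[? _]; lra.
move: h1 h2 => /= h1 h2; rewrite ler_norml; apply/andP; split; lra.
Qed.

End comparison.

(** * The binomial series in the time variable [u] *)

Section binomial_series.
Context {R : realType}.
Variable b : R.
Hypothesis b0 : 0 < b.

(** Chosen so that [1 - u = exp (- b t)]: then [(1 - u)^-a] is [exp (a b t)], and the derivative of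
    [u] is [b (1 - u)]. *)
Definition utime (t : R) : R := 1 - expR (- (b * t)).

Lemma utime_ge0 t : 0 <= t -> 0 <= utime t.
Proof.
by move=> t0; rewrite /utime subr_ge0 expR_le1 oppr_le0 mulr_ge0// ltW.
Qed.

Lemma utime_le s t : s <= t -> utime s <= utime t.
Proof. by move=> st; rewrite lerB// ler_expR lerN2 ler_pM2l. Qed.

Lemma utime0 : utime 0 = 0.
Proof. by rewrite /utime mulr0 oppr0 expR0 subrr. Qed.

Lemma is_derive_utime (t : R) : is_derive t 1 utime (b * (1 - utime t)).
Proof.
rewrite /utime subKr; apply: is_derive_eq.
by rewrite /GRing.scale/=; ring.
Qed.

Lemma is_derive_pow_utime n (t : R) :
  is_derive t 1 (fun s => utime s ^+ n)
    (n%:R * utime t ^+ n.-1 * (b * (1 - utime t))).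
Proof.
have := @is_deriveX R _ utime n t 1 _ (is_derive_utime t).
rewrite (_ : utime ^+ n = fun s => utime s ^+ n)//.
by apply/funext => s; elim: n => // n IH; rewrite !exprS -IH.
Qed.

Definition psum (c : nat -> R) (M : nat) (t : R) : R :=
  \sum_(n < M) c n * utime t ^+ n.

Lemma is_derive_psum c M (t : R) : is_derive t 1 (psum c M)
  (b * (1 - utime t) * psum (fun n => n.+1%:R * c n.+1) M.-1 t).
Proof.
have -> : psum c M = \sum_(n < M) (fun s => c n * utime s ^+ n).
  by apply/funext => s; rewrite /psum fct_sumE.
have : is_derive t 1 (\sum_(n < M) (fun s => c n * utime s ^+ n))
    (\sum_(n < M) c n *: (n%:R * utime t ^+ n.-1 * (b * (1 - utime t)))).
  apply: is_derive_sum => i.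
  by apply: is_deriveZ; exact: is_derive_pow_utime.
move=> /is_derive_eq; apply.
rewrite /psum mulr_sumr; case: M => [|M]; first by rewrite !big_ord0.
rewrite big_ord_recl/= mul0r mul0r scaler0 add0r.
by apply: eq_bigr => i _; rewrite /bump/= add1n /GRing.scale/=; ring.
Qed.

Lemma is_derive_cvg0 (f : R -> R) df : is_derive (0 : R) 1 f df ->
  f s @[s --> (0 : R)^'+] --> f 0.
Proof.
move=> fd; apply: cvg_at_right_filter.
by apply/differentiable_continuous/derivable1_diffP; case: fd.
Qed.

Lemma is_derive_expM (a t : R) :
  is_derive t 1 (fun s => expR (a * s)) (a * expR (a * t)).
Proof. by apply: is_derive_eq; rewrite /GRing.scale/=; ring. Qed.

Lemma psum_ge0 c M t : (forall n, 0 <= c n) -> 0 <= t -> 0 <= psum c M t.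
Proof.
by move=> c0 t0; apply: sumr_ge0 => i _; rewrite mulr_ge0// exprn_ge0// utime_ge0.
Qed.

Lemma psum_S c M t : psum c M.+1 t = psum c M t + c M * utime t ^+ M.
Proof. by rewrite /psum big_ord_recr. Qed.

Lemma psum_le c t : (forall n, 0 <= c n) -> 0 <= t ->
  {homo (psum c ^~ t) : m n / (m <= n)%N >-> m <= n}.
Proof.
move=> c0 t0; apply: homo_leq => //; first exact: le_trans.
by move=> n; rewrite psum_S lerDl mulr_ge0// exprn_ge0// utime_ge0.
Qed.

Lemma psum_at0 c M : psum c M.+1 0 = c 0%N.
Proof.
rewrite /psum big_ord_recl/= expr0 mulr1 utime0 big1 ?addr0// => i _.
by rewrite exprS mul0r mulr0.
Qed.

(* Termwise, [(1 - u) d/du] of [sum_n rbin a n u^n] is [a] times the same sum,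
   up to the last term. *)
Lemma rbin_psum_ode a M t :
  (1 - utime t) * psum (fun n => n.+1%:R * rbin a n.+1) M t =
  a * psum (rbin a) M t + M%:R * (- rbin a M * utime t ^+ M).
Proof.
elim: M => [|M IH]; first by rewrite /psum !big_ord0; ring.
rewrite !psum_S mulrDr IH.
have e := rbinS a M.
have -> : M.+1%:R * (- rbin a M.+1 * utime t ^+ M.+1) =
    - (M.+1%:R * rbin a M.+1 * utime t ^+ M.+1) by ring.
by rewrite !e exprS; ring.
Qed.

(** The integrating factor cancels the truncated equation up to its last power, of coefficient
    [(a + M) rbin a M], which equals [a rbin (a + 1) M] by comparing the two recursions. *)
Lemma is_derive_rbin_psum a M (t : R) :
  is_derive t 1 (fun s => expR (- (a * b) * s) * psum (rbin a) M.+1 s)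
    (- b * expR (- (a * b) * t) * (a * rbin (a + 1) M * utime t ^+ M)).
Proof.
have := is_deriveM (is_derive_expM (- (a * b)) t) (is_derive_psum (rbin a) M.+1 t).
move=> /is_derive_eq; apply; rewrite /GRing.scale/=.
rewrite -mulrA rbin_psum_ode psum_S.
have e := rbinSS a M; rewrite rbinS in e.
rewrite -e; ring.
Qed.

(** [exp (- a b t)] times the sum has a nonpositive derivative and starts from 1. One term is added
    beforehand so that the sum is not empty. *)
Lemma rbin_psum_le a M t : 0 <= a -> 0 <= t -> psum (rbin a) M t <= expR (a * b * t).
Proof.
move=> a0 t0.
apply: (@le_trans _ _ (psum (rbin a) M.+1 t)).
  by apply: psum_le => // n; exact: rbin_ge0.
pose f s := expR (- (a * b) * s) * psum (rbin a) M.+1 s.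
pose df s := b * expR (- (a * b) * s) * (a * rbin (a + 1) M * utime s ^+ M).
have fd (s : R) : is_derive s 1 (fun s => - f s) (df s).
  rewrite /df -[b]opprK [- - b * _]mulNr [- _ * (a * _ * _)]mulNr opprK.
  by apply: is_deriveN; exact: is_derive_rbin_psum.
have : - f 0 <= - f t.
  apply: (@ge0_derive_le _ (fun s => - f s) df) => //.
    exact: is_derive_cvg0 (fd 0).
  move=> s /andP[s0 _]; rewrite /df.
  by rewrite !mulr_ge0 ?expR_ge0 ?(ltW b0) ?rbin_ge0 ?addr_ge0 ?exprn_ge0 ?utime_ge0// ltW.
rewrite lerN2 /f mulr0 expR0 mul1r psum_at0 rbin0.
by rewrite mulNr expRN mulrC ler_pdivrMr ?expR_gt0// mul1r.
Qed.

Lemma cvg_rbin_term a t : 0 <= a -> 0 <= t ->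
  rbin a n * utime t ^+ n @[n --> \oo] --> (0 : R).
Proof.
move=> a0 t0.
have : cvgn (series (fun n => rbin a n * utime t ^+ n)).
  apply: (@nondecreasing_is_cvgn _ _).
    move=> m n mn; rewrite !seriesEord; apply: psum_le => // k; exact: rbin_ge0.
  exists (expR (a * b * t)) => _ [n _ <-]; rewrite seriesEord.
  exact: rbin_psum_le.
exact: cvg_series_cvg_0.
Qed.

(** The derivative just computed is at most a multiple of [rbin (a + 1) M * u^M], the general term
    of a convergent series. Integrated up to [t], this is a lower bound that meets the upper bound
    [rbin_psum_le] in the limit. *)
Lemma cvg_rbin_psum a t : 0 <= a -> 0 <= t ->
  psum (rbin a) M t @[M --> \oo] --> expR (a * b * t).
Proof.
move=> a0 t0; rewrite -cvg_shiftS /=.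
have lb M : expR (a * b * t) * (1 - b * a * (rbin (a + 1) M * utime t ^+ M) * t)
    <= psum (rbin a) M.+1 t.
  rewrite -ler_pdivlMl ?expR_gt0// -expRN -mulNr.
  pose f s := expR (- (a * b) * s) * psum (rbin a) M.+1 s.
  pose K := b * a * (rbin (a + 1) M * utime t ^+ M).
  have gd (s : R) : is_derive s 1 (fun s => K * s) K.
    by apply: is_derive_eq; rewrite /GRing.scale/= mulr1.
  have fd (s : R) := is_derive_rbin_psum a M s.
  have : `|f t - f 0| <= K * t - K * 0.
    apply: (@derive_norm_le _ f (fun s => - b * expR (- (a * b) * s) *
      (a * rbin (a + 1) M * utime s ^+ M)) (fun s => K * s) (fun=> K)) => //.
    - exact: is_derive_cvg0 (fd 0).
    - exact: is_derive_cvg0 (gd 0).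
    - move=> s /andP[s0 st].
      have r0 : 0 <= rbin (a + 1) M by rewrite rbin_ge0// addr_ge0.
      have u0 := utime_ge0 (ltW s0).
      rewrite normrM mulNr normrN !ger0_norm; last first.
      - by rewrite !mulr_ge0// exprn_ge0.
      - by rewrite !mulr_ge0// ?expR_ge0// ltW.
      rewrite /K -!mulrA ler_pM2l// mulrCA ler_wpM2l//.
      rewrite -[leRHS]mul1r ler_pM ?expR_ge0 ?mulr_ge0 ?exprn_ge0//.
        by rewrite expR_le1 mulNr oppr_le0 !mulr_ge0// ltW.
      by rewrite ler_wpM2l// lerXn2r ?nnegrE ?utime_ge0 ?utime_le// ltW.
  rewrite mulr0 subr0 ler_norml => /andP[+ _].
  rewrite /f mulr0 expR0 mul1r psum_at0 rbin0 -/K.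
  have -> : - (a * b * t) = - (a * b) * t by ring.
  by move=> ?; lra.
apply: (@squeeze_cvgr _ _ _ _ (fun M => expR (a * b * t) *
  (1 - b * a * (rbin (a + 1) M * utime t ^+ M) * t)) (cst (expR (a * b * t)))).
- by apply: nearW => M; rewrite lb rbin_psum_le.
- rewrite -[X in _ --> X]mulr1; apply: cvgMr; rewrite -[X in _ --> X]subr0.
  apply: cvgB; first exact: cvg_cst.
  rewrite -[X in _ --> X](mul0r t); apply: cvgMl; rewrite -(mulr0 (b * a)).
  by apply: cvgMr; apply: cvg_rbin_term => //; rewrite addr_ge0.
- exact: cvg_cst.
Qed.

End binomial_series.

(** * Inequalities between powers *)

Section powR_inequalities.
Context {R : realType}.
Implicit Types (a p s x y : R).

(** Only [1 + x <= exp x] is used: with [e = a^p] and [x = ln a], the bounds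
    [e (1 + (1 - p) x) <= a] and [e (1 - p x) <= 1], averaged with weights [p] and [1 - p], give
    [e <= p a + 1 - p]. *)
Lemma powR_le_tangent a p : 0 <= a -> 0 <= p <= 1 -> a `^ p <= 1 + p * (a - 1).
Proof.
rewrite le_eqVlt => /predU1P[<-|a0] /andP[p0 p1].
  have [->|pn0] := eqVneq p 0; first by rewrite powRr0; lra.
  by rewrite powR0//; lra.
have -> : a `^ p = expR (p * ln a) by rewrite /powR gt_eqF.
set x := ln a; set e := expR (p * x).
have e0 : 0 < e by exact: expR_gt0.
have h1 : e * (1 + (1 - p) * x) <= a.
  have -> : a = e * expR ((1 - p) * x).
    by rewrite -expRD -mulrDl subrKC mul1r lnK// posrE.
  by rewrite ler_pM2l// expR_ge1Dx.
have h2 : e * (1 + - p * x) <= 1.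
  have e1 : e * expR (- p * x) = 1 by rewrite -expRD -mulrDl subrr mul0r expR0.
  by rewrite -[leRHS]e1 ler_pM2l// expR_ge1Dx.
have : p * (e * (1 + (1 - p) * x)) + (1 - p) * (e * (1 + - p * x)) <= p * a + (1 - p) * 1.
  by rewrite lerD// ler_wpM2l// subr_ge0.
lra.
Qed.

(** The previous bound at [a^p] with exponent [1/p]. *)
Lemma powR_ge_tangent a p : 0 <= a -> 1 <= p -> 1 + p * (a - 1) <= a `^ p.
Proof.
move=> a0 p1; have p0 : 0 < p by exact: lt_le_trans p1.
have := @powR_le_tangent (a `^ p) p^-1 (powR_ge0 _ _).
rewrite invr_ge0 ltW// invf_le1// p1 -powRrM divff ?gt_eqF// powRr1// => /(_ isT).
by rewrite -lerBlDl [leRHS]mulrC ler_pdivlMr// => ?; lra.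
Qed.

(** For [0 <= z <= s = x + y] the ratio satisfies [z/s <= (z/s)^p]; the instances [z = x] and
    [z = y] add up to the claim. *)
Lemma powR_subadditive x y p : 0 <= x -> 0 <= y -> 0 < p <= 1 ->
  (x + y) `^ p <= x `^ p + y `^ p.
Proof.
move=> x0 y0 /andP[p0 p1].
have [s0|] := ltP 0 (x + y); last first.
  move=> h; have xe : x = 0 by apply/eqP; rewrite eq_le x0 andbT (le_trans _ h)// lerDl.
  have ye : y = 0 by apply/eqP; rewrite eq_le y0 andbT (le_trans _ h)// lerDr.
  by rewrite xe ye addr0 powR0 ?gt_eqF// addr0.
suff h z : 0 <= z -> z <= x + y -> (x + y) `^ p * (z / (x + y)) <= z `^ p.
  have := lerD (h x x0 _) (h y y0 _); rewrite -mulrDr -mulrDl divff ?gt_eqF// mulr1.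
  by apply; rewrite ?lerDl ?lerDr.
move=> z0 zs; set s := x + y in s0 zs *.
have zs0 : 0 <= z / s by rewrite divr_ge0// ltW.
have zs1 : z / s <= 1 by rewrite ler_pdivrMr// mul1r.
have -> : z `^ p = s `^ p * (z / s) `^ p.
  by rewrite -powRM ?(ltW s0)// mulrC divfK// gt_eqF.
rewrite ler_wpM2l ?powR_ge0//.
move: zs0; rewrite le_eqVlt => /predU1P[<-|zs0]; first exact: powR_ge0.
by rewrite ger1_powR// zs0.
Qed.

(** Three ranges. For [s >= 1], write the power as [(1 + s) (1 + s)^(p - 1)] and use subadditivity
    of the power [p - 1]. For [-1 <= s < 1], use its tangent bound and [s^2 <= |s|^p]. For [s < -1],
    use the tangent of the power [p] at 1, with [1 - p >= -1]. *)
Lemma von_bahr_esseen1 p s : 1 <= p <= 2 ->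
  `|1 + s| `^ p <= 1 + p * s + 2 * `|s| `^ p.
Proof.
move=> /andP[p1 p2]; have p0 : 0 < p by exact: lt_le_trans p1.
have [s1|s1] := leP 1 s.
  have s0 : 0 <= s by exact: le_trans s1.
  rewrite !ger0_norm ?addr_ge0// -(mulr_powRB1 _ p0) ?addr_ge0//.
  have [->|pn1] := eqVneq p 1; first by rewrite subrr !powRr0 powRr1//; lra.
  have h : (1 + s) `^ (p - 1) <= 1 + s `^ (p - 1).
    have := @powR_subadditive 1 s (p - 1) ler01 s0; rewrite powR1; apply.
    apply/andP; split; last by lra.
    by rewrite subr_gt0 lt_neqAle eq_sym pn1.
  have h2 : s `^ (p - 1) <= s `^ p by rewrite ler_powR// lerBlDr lerDl.
  have h3 := mulr_powRB1 s0 p0.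
  have : (1 + s) * (1 + s) `^ (p - 1) <= (1 + s) * (1 + s `^ (p - 1)).
    by rewrite ler_wpM2l// addr_ge0.
  rewrite [X in _ <= X -> _](_ : _ = 1 + s + s `^ (p - 1) + s * s `^ (p - 1)); last by ring.
  rewrite h3; nra.
have [s2|s2] := leP (- 1) s.
  have s0 : 0 <= 1 + s by lra.
  rewrite (ger0_norm s0) -(mulr_powRB1 s0 p0).
  have h : (1 + s) `^ (p - 1) <= 1 + (p - 1) * s.
    have := @powR_le_tangent (1 + s) (p - 1) s0; rewrite addrAC subrr add0r.
    by apply; apply/andP; split; lra.
  have ns : `|s| <= 1 by rewrite ler_norml s2 ltW.
  have hs : s ^+ 2 <= `|s| `^ p.
    rewrite -real_normK ?num_real// -powR_mulrn//.
    have [->|sn0] := eqVneq s 0; first by rewrite normr0 !powR0// gt_eqF.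
    by rewrite ger_powR// normr_gt0 sn0.
  have : (1 + s) * (1 + s) `^ (p - 1) <= (1 + s) * (1 + (p - 1) * s).
    by rewrite ler_wpM2l.
  have : (p - 1) * s ^+ 2 <= 1 * s ^+ 2 by rewrite ler_wpM2r ?sqr_ge0//; lra.
  have := sqr_ge0 s; rewrite !expr2; nra.
rewrite ltr0_norm; last by lra.
rewrite ltr0_norm; last by lra.
have h1 := @powR_ge_tangent (- s) p.
have h2 : (- (1 + s)) `^ p <= (- s) `^ p.
  by rewrite ge0_ler_powR ?nnegrE ?(ltW p0)//; lra.
have := h1 _ p1; nra.
Qed.

(** For [x != 0] the scalar case is applied to [y / x], and [k = p |x|^p / x] is the derivative of
    the power at [x]. What counts is that [k] is independent of [y]: the linear term integrates to
    zero for a centred [y]. *)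
Lemma von_bahr_esseen p x : 1 <= p <= 2 ->
  exists k, forall y, `|x + y| `^ p <= `|x| `^ p + k * y + 2 * `|y| `^ p.
Proof.
move=> p12; have p0 : 0 < p by case/andP: p12 => + _; exact: lt_le_trans.
have [->|x0] := eqVneq x 0.
  exists 0 => y; rewrite add0r normr0 powR0 ?gt_eqF// mul0r !add0r.
  by have := powR_ge0 `|y| p; lra.
exists (`|x| `^ p * p / x) => y.
have -> : x + y = x * (1 + y / x) by rewrite mulrDr mulr1 mulrC divfK.
rewrite normrM powRM//.
have {3}-> : y = x * (y / x) by rewrite mulrC divfK.
rewrite [`|x * _|]normrM powRM//.
apply: le_trans (ler_wpM2l (powR_ge0 _ _) (von_bahr_esseen1 _ p12)) _.
by rewrite le_eqVlt; apply/orP; left; apply/eqP; field.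
Qed.

End powR_inequalities.

(** * Complex-valued integrals *)

Local Notation normc := ComplexField.Normc.normc.
#[local] Arguments ComplexField.Normc.normc : simpl never.

Section complex_norm.
Context {R : realType}.
Implicit Types z w : R[i].
Local Notation re := (@complex.Re R).
Local Notation im := (@complex.Im R).

Lemma normc_ge0 z : 0 <= normc z.
Proof. by case: z => a b; rewrite /normc sqrtr_ge0. Qed.

Lemma normc_sqr z : normc z ^+ 2 = re z ^+ 2 + im z ^+ 2.
Proof. by case: z => a b; rewrite /normc sqr_sqrtr// addr_ge0 ?sqr_ge0. Qed.

Lemma Re_le_normc z : `|re z| <= normc z.
Proof.
rewrite -(@ler_pXn2r _ 2)// ?nnegrE ?normc_ge0// real_normK ?num_real//.
by rewrite normc_sqr lerDl sqr_ge0.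
Qed.

Lemma Im_le_normc z : `|im z| <= normc z.
Proof.
rewrite -(@ler_pXn2r _ 2)// ?nnegrE ?normc_ge0// real_normK ?num_real//.
by rewrite normc_sqr lerDr sqr_ge0.
Qed.

Lemma normc_le_ReIm z : normc z <= `|re z| + `|im z|.
Proof.
rewrite -(@ler_pXn2r _ 2)// ?nnegrE ?normc_ge0 ?addr_ge0// normc_sqr.
rewrite sqrrD !real_normK ?num_real// addrAC lerDl mulrn_wge0// mulr_ge0//.
Qed.

Lemma re_mul z w : re (z * w) = re z * re w - im z * im w.
Proof. by case: z => a b; case: w. Qed.

Lemma im_mul z w : im (z * w) = re z * im w + im z * re w.
Proof. by case: z => a b; case: w. Qed.

Lemma Re_dot_le z w : re z * re w + im z * im w <= normc z * normc w.
Proof.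
have := Re_le_normc (z * ((re w) -i* (im w))%C).
rewrite ComplexField.Normc.normcM re_mul /= mulrN opprK.
have -> : normc ((re w) -i* (im w))%C = normc w.
  by case: w => a b /=; rewrite /normc sqrrN.
exact/le_trans/ler_norm.
Qed.

Lemma normc_cos_sin (x : R) : normc (cos x +i* sin x)%C = 1.
Proof. by rewrite /normc cos2Dsin2 sqrtr1. Qed.

Lemma normc_prod (I : Type) (r : seq I) (P : pred I) (F : I -> R[i]) :
  normc (\prod_(i <- r | P i) F i) = \prod_(i <- r | P i) normc (F i).
Proof.
elim/big_rec2 : _ => [|i x y _ <-]; first exact: ComplexField.Normc.normc1.
exact: ComplexField.Normc.normcM.
Qed.

Lemma normc_sum (I : Type) (r : seq I) (P : pred I) (F : I -> R[i]) :
  normc (\sum_(i <- r | P i) F i) <= \sum_(i <- r | P i) normc (F i).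
Proof.
elim/big_ind2 : _ => //; first by rewrite ComplexField.Normc.normc0.
move=> x1 x2 y1 y2 h1 h2; apply: le_trans (lerD h1 h2); exact: le_normcD.
Qed.

Lemma normc_real (x : R) : normc x%:C%C = `|x|.
Proof. by rewrite /normc /= expr0n/= addr0 sqrtr_sqr. Qed.

Lemma re_sum (I : Type) (r : seq I) (P : pred I) (F : I -> R[i]) :
  re (\sum_(i <- r | P i) F i) = \sum_(i <- r | P i) re (F i).
Proof. by elim/big_rec2 : _ => // i x y _ <-; case: (F i); case: y. Qed.

Lemma im_sum (I : Type) (r : seq I) (P : pred I) (F : I -> R[i]) :
  im (\sum_(i <- r | P i) F i) = \sum_(i <- r | P i) im (F i).
Proof. by elim/big_rec2 : _ => // i x y _ <-; case: (F i); case: y. Qed.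

Lemma complex_eq z w : re z = re w -> im z = im w -> z = w.
Proof. by case: z => a b; case: w => c e /= -> ->. Qed.

End complex_norm.

Section complex_integral.
Context d (T : measurableType d) (R : realType).
Local Notation re := (@complex.Re R).
Local Notation im := (@complex.Im R).

Definition cmeasurable (f : T -> R[i]) :=
  measurable_fun setT (fun x => re (f x)) /\ measurable_fun setT (fun x => im (f x)).

Definition cbounded (f : T -> R[i]) M := forall x, normc (f x) <= M.

Lemma cmeasurableM f g : cmeasurable f -> cmeasurable g ->
  cmeasurable (fun x => f x * g x).
Proof.
move=> [f1 f2] [g1 g2]; split.
- under eq_fun do rewrite re_mul.
  by apply: measurable_funB; exact: measurable_funM.
- under eq_fun do rewrite im_mul.
  by apply: measurable_funD; exact: measurable_funM.
Qed.

Lemma cmeasurable_cst (c : R[i]) : cmeasurable (fun=> c).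
Proof. by split; exact: measurable_cst. Qed.

Lemma cmeasurable_sum n (f : 'I_n -> T -> R[i]) : (forall i, cmeasurable (f i)) ->
  cmeasurable (fun x => \sum_(i < n) f i x).
Proof.
move=> mf; split.
- under eq_fun do rewrite re_sum.
  by apply: measurable_sum => i; exact: (mf i).1.
- under eq_fun do rewrite im_sum.
  by apply: measurable_sum => i; exact: (mf i).2.
Qed.

Lemma cmeasurable_prod n (f : 'I_n -> T -> R[i]) : (forall i, cmeasurable (f i)) ->
  cmeasurable (fun x => \prod_(i < n) f i x).
Proof.
elim: n f => [|n IH] f mf.
  by under eq_fun do rewrite big_ord0; exact: cmeasurable_cst.
under eq_fun do rewrite big_ord_recl.
by apply: cmeasurableM => //; exact: IH.
Qed.

Lemma cmeasurable_comp d' (T' : measurableType d') (phi : T' -> T) f :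
  measurable_fun setT phi -> cmeasurable f ->
  measurable_fun setT (fun x => complex.Re (f (phi x))) /\
  measurable_fun setT (fun x => complex.Im (f (phi x))).
Proof.
by move=> mphi [f1 f2]; split; [exact: (measurableT_comp f1 mphi)|exact: (measurableT_comp f2 mphi)].
Qed.

Section finite.
Variable m : {finite_measure set T -> \bar R}.

Lemma bounded_integrable (f : T -> R) M : measurable_fun setT f ->
  (forall x, `|f x| <= M) -> m.-integrable setT (EFin \o f).
Proof.
move=> mf fM; apply: measurable_bounded_integrable => //.
  exact: fin_num_fun_lty.
exists M; split; first exact: num_real.
by move=> x Mx y _ /=; rewrite (le_trans (fM y))// ltW.
Qed.

Lemma Re_integrable f M : cmeasurable f -> cbounded f M ->
  m.-integrable setT (EFin \o (fun x => re (f x))).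
Proof.
move=> [f1 _] fM; apply: bounded_integrable f1 _ => x.
exact: le_trans (Re_le_normc _) (fM x).
Qed.

Lemma Im_integrable f M : cmeasurable f -> cbounded f M ->
  m.-integrable setT (EFin \o (fun x => im (f x))).
Proof.
move=> [_ f1] fM; apply: bounded_integrable f1 _ => x.
exact: le_trans (Im_le_normc _) (fM x).
Qed.

Lemma cintZl f M c : cmeasurable f -> cbounded f M ->
  cint m setT (fun x => c * f x) = c * cint m setT f.
Proof.
move=> mf fM; have if1 := Re_integrable mf fM; have if2 := Im_integrable mf fM.
have iZ1 (k : R) : m.-integrable setT (EFin \o (fun x => k * re (f x))).
  by under [X in m.-integrable _ X]eq_fun do rewrite /= EFinM; exact: integrableZl.
have iZ2 (k : R) : m.-integrable setT (EFin \o (fun x => k * im (f x))).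
  by under [X in m.-integrable _ X]eq_fun do rewrite /= EFinM; exact: integrableZl.
apply: complex_eq; rewrite ?re_mul ?im_mul /=.
- under eq_Rintegral do rewrite re_mul.
  by rewrite RintegralB// !RintegralZl.
- under eq_Rintegral do rewrite im_mul.
  by rewrite RintegralD// !RintegralZl.
Qed.

Lemma cintD f g M M' : cmeasurable f -> cmeasurable g ->
  cbounded f M -> cbounded g M' ->
  cint m setT (fun x => f x + g x) = cint m setT f + cint m setT g.
Proof.
move=> mf mg fM gM.
have if1 := Re_integrable mf fM; have if2 := Im_integrable mf fM.
have ig1 := Re_integrable mg gM; have ig2 := Im_integrable mg gM.
by apply: complex_eq; rewrite !raddfD /= -RintegralD//; apply: eq_Rintegral => x _;
  rewrite raddfD.
Qed.

Lemma cint_sum n (f : 'I_n -> T -> R[i]) : (forall i, cmeasurable (f i)) ->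
  (forall i, exists M, cbounded (f i) M) ->
  cint m setT (fun x => \sum_(i < n) f i x) = \sum_(i < n) cint m setT (f i).
Proof.
elim: n f => [|n IH] f mf bf.
  under eq_fun do rewrite big_ord0.
  by rewrite big_ord0; apply: complex_eq; rewrite /= Rintegral_cst//= mul0r.
have : forall k (h : 'I_k -> T -> R[i]), (forall i, exists M, cbounded (h i) M) ->
    exists M, cbounded (fun x => \sum_(i < k) h i x) M.
  move=> k h /choice[F HF]; exists (\sum_(i < k) F i) => x.
  by apply: le_trans (normc_sum _ _ _) _; apply: ler_sum => i _; exact: HF.
move=> /(_ n (fun i => f (lift ord0 i)) (fun i => bf (lift ord0 i)))[M' bM'].
have [M bM] := bf ord0.
under eq_fun do rewrite big_ord_recl.
rewrite (cintD (mf ord0) _ bM bM'); last by apply: cmeasurable_sum => i; exact: mf.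
by rewrite big_ord_recl IH.
Qed.

(** Pairing with the phase: the squared modulus of [z = cint m setT f] is the integral of the real
    scalar product of [z] and [f], at most that of [|z| |f|]; then divide by [|z|]. *)
Lemma normc_cint_le f M (g : T -> R) : cmeasurable f -> cbounded f M ->
  (forall x, normc (f x) <= g x) -> m.-integrable setT (EFin \o g) ->
  normc (cint m setT f) <= Rintegral m setT g.
Proof.
move=> mf fM fg ig; set z := cint m setT f.
have if1 := Re_integrable mf fM; have if2 := Im_integrable mf fM.
have [z0|z0] := eqVneq (normc z) 0.
  rewrite z0 Rintegral_ge0// => x _; exact/le_trans/fg/normc_ge0.
have zp : 0 < normc z by rewrite lt_neqAle eq_sym z0 normc_ge0.
rewrite -(ler_pM2l zp) -expr2 normc_sqr !expr2 {2 4}/z /=.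
have iZ1 (k : R) : m.-integrable setT (EFin \o (fun x => k * re (f x))).
  by under [X in m.-integrable _ X]eq_fun do rewrite /= EFinM; exact: integrableZl.
have iZ2 (k : R) : m.-integrable setT (EFin \o (fun x => k * im (f x))).
  by under [X in m.-integrable _ X]eq_fun do rewrite /= EFinM; exact: integrableZl.
have iZ3 (k : R) : m.-integrable setT (EFin \o (fun x => k * g x)).
  by under [X in m.-integrable _ X]eq_fun do rewrite /= EFinM; exact: integrableZl.
rewrite -!RintegralZl// -RintegralD//; apply: le_Rintegral => //.
  under [X in m.-integrable _ X]eq_fun do rewrite /= EFinD.
  by apply: integrableD => //; [exact: iZ1|exact: iZ2].
move=> x _; apply: (@le_trans _ _ (normc z * normc (f x))).
  exact: (Re_dot_le z (f x)).
by rewrite ler_wpM2l// normc_ge0.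
Qed.

Lemma normc_cint_bound f M : cmeasurable f -> cbounded f M ->
  normc (cint m setT f) <= M * fine (m setT).
Proof.
move=> mf fM; rewrite -[leRHS](Rintegral_cst m)//.
apply: (@normc_cint_le f M (cst M)) => //.
exact: (@bounded_integrable (cst M) `|M|).
Qed.

End finite.
End complex_integral.

(** * Finite measures: images, products, sums and multiples *)

Section finite_packing.
Context d (T : measurableType d) (R : realType).
Variables (m : {measure set T -> \bar R}) (h : fin_num_fun m).
(** A fresh name for the measure, to which the finiteness instance is attached. *)
Definition finite_copy : set T -> \bar R := m.
HB.instance Definition _ := Measure.on finite_copy.
HB.instance Definition _ := Measure_isFinite.Build _ _ _ finite_copy h.
Definition mkfin : {finite_measure set T -> \bar R} := finite_copy.
End finite_packing.

Section shift_integral.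
Context d (T : measurableType d) (R : realType) (m : {finite_measure set T -> \bar R}).

(* Transfers identities between integrals from nonnegative to bounded integrands. *)
Lemma Rintegral_shift (f : T -> R) M : measurable_fun setT f ->
  (forall x, `|f x| <= M) ->
  Rintegral m setT f =
  fine (\int[m]_x (f x + M)%:E)%E - M * fine (m setT).
Proof.
move=> mf fM; have if_ := bounded_integrable m mf fM.
have iM : m.-integrable setT (EFin \o cst M).
  exact: (@bounded_integrable _ _ _ m (cst M) `|M|).
rewrite -[M * _](Rintegral_cst m)// -[fine _]/(Rintegral m setT (fun x => f x + M)).
by rewrite RintegralD// addrK.
Qed.

End shift_integral.

Section finite_push.
Context d1 d2 (T1 : measurableType d1) (T2 : measurableType d2) (R : realType).
Variables (phi : T1 -> T2) (mphi : measurable_fun setT phi).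
Variable m : {finite_measure set T1 -> \bar R}.

Let pm : {measure set T2 -> \bar R} :=
  measure_function_pushforward__canonical__measure_function_Measure m mphi.

Let pm_fin : fin_num_fun pm.
Proof.
move=> U mU; apply: fin_num_measure.
by rewrite -[X in measurable X]setTI; exact: mphi.
Qed.

Definition fpush : {finite_measure set T2 -> \bar R} := mkfin pm_fin.

Lemma fpushE B : fpush B = m (phi @^-1` B). Proof. by []. Qed.

Lemma ge0_integral_fpush (f : T2 -> \bar R) : measurable_fun setT f ->
  (forall y, 0 <= f y)%E -> (\int[fpush]_y f y = \int[m]_x f (phi x))%E.
Proof. by move=> mf f0; rewrite (ge0_integral_pushforward mphi). Qed.

Lemma Rintegral_fpush (f : T2 -> R) M : measurable_fun setT f ->
  (forall x, `|f x| <= M) ->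
  Rintegral fpush setT f = Rintegral m setT (fun x => f (phi x)).
Proof.
move=> mf fM; rewrite (Rintegral_shift _ mf fM).
rewrite (Rintegral_shift _ (measurableT_comp mf mphi) (fun x => fM (phi x))).
rewrite ge0_integral_fpush//.
  apply/measurable_EFinP; exact: measurable_funD.
move=> y; rewrite lee_fin -lerBlDr sub0r.
by have := fM y; rewrite ler_norml => /andP[].
Qed.

Lemma cint_fpush (f : T2 -> R[i]) M : cmeasurable f -> cbounded f M ->
  cint fpush setT f = cint m setT (fun x => f (phi x)).
Proof.
move=> [f1 f2] fM; congr (_ +i* _)%C; apply: (@Rintegral_fpush _ M) => // x.
- exact: le_trans (Re_le_normc _) (fM x).
- exact: le_trans (Im_le_normc _) (fM x).
Qed.

End finite_push.

Section finite_prod.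
Context d1 d2 (T1 : measurableType d1) (T2 : measurableType d2) (R : realType).
Variables (m1 : {finite_measure set T1 -> \bar R}).
Variables (m2 : {finite_measure set T2 -> \bar R}).

Let fprod_fin : fin_num_fun (m1 \x m2)%E.
Proof.
apply: lty_fin_num_fun.
suff : ((m1 \x m2) (setT `*` setT) < +oo)%E by rewrite setXTT.
rewrite product_measure1E//.
by rewrite lte_mul_pinfty//; [exact: fin_num_measure|exact: fin_num_fun_lty].
Qed.

Definition fprodm : {finite_measure set (T1 * T2)%type -> \bar R} := mkfin fprod_fin.

Lemma ge0_integral_fprod (f : T1 * T2 -> \bar R) : measurable_fun setT f ->
  (forall y, 0 <= f y)%E ->
  (\int[fprodm]_z f z = \int[m1]_x \int[m2]_y f (x, y))%E.
Proof. by move=> mf f0; exact: (@fubini_tonelli1 _ _ _ _ _ m1 m2 f mf f0). Qed.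

Lemma measurable_section1 (d3 : measure_display) (T3 : measurableType d3)
    (f : T1 * T2 -> T3) (x : T1) :
  measurable_fun setT f -> measurable_fun setT (fun y => f (x, y)).
Proof. by move=> mf; exact: (measurableT_comp mf (pair1_measurable x)). Qed.

Section bounded.
Variables (f : T1 * T2 -> R) (M : R).
Hypotheses (mf : measurable_fun setT f) (fM : forall z, `|f z| <= M).

Let intf : (m1 \x m2)%E.-integrable setT (EFin \o f).
Proof. exact: (bounded_integrable fprodm mf fM). Qed.

Let fin x : (\int[m2]_y (f (x, y))%:E)%E \is a fin_num.
Proof.
apply: integrable_fin_num => //.
by apply: (@bounded_integrable _ _ _ m2 (fun y => f (x, y)) M) => //;
  exact: measurable_section1.
Qed.

Lemma measurable_Rintegral2 :
  measurable_fun setT (fun x => Rintegral m2 setT (fun y => f (x, y))).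
Proof.
apply/measurable_EFinP; have := measurable_fubini_F intf.
by apply: eq_measurable_fun => x _; rewrite /= /Rintegral fineK.
Qed.

Lemma Rintegral_fprod :
  Rintegral fprodm setT f =
  Rintegral m1 setT (fun x => Rintegral m2 setT (fun y => f (x, y))).
Proof.
congr fine; have -> : (\int[fprodm]_z (f z)%:E = \int[(m1 \x m2)%E]_z (f z)%:E)%E by [].
rewrite -(integral12_prod_meas1 intf); apply: eq_integral => x _.
by rewrite /Rintegral fineK.
Qed.

End bounded.

Variables (f : T1 * T2 -> R[i]) (M : R).
Hypotheses (mf : cmeasurable f) (fM : cbounded f M).

Lemma cmeasurable_cint : cmeasurable (fun x => cint m2 setT (fun y => f (x, y))).
Proof.
split.
  apply: (@measurable_Rintegral2 (fun z => complex.Re (f z)) M).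
  - exact: mf.1.
  - by move=> z; exact: le_trans (Re_le_normc _) (fM z).
apply: (@measurable_Rintegral2 (fun z => complex.Im (f z)) M).
- exact: mf.2.
- by move=> z; exact: le_trans (Im_le_normc _) (fM z).
Qed.

Lemma cint_fprod : cint fprodm setT f =
  cint m1 setT (fun x => cint m2 setT (fun y => f (x, y))).
Proof.
congr (_ +i* _)%C; apply: (@Rintegral_fprod _ M).
- exact: mf.1.
- by move=> z; exact: le_trans (Re_le_normc _) (fM z).
- exact: mf.2.
- by move=> z; exact: le_trans (Im_le_normc _) (fM z).
Qed.

End finite_prod.

Section finite_sum.
Context d (T : measurableType d) (R : realType).
Variables (n : nat) (m : nat -> {finite_measure set T -> \bar R}).

Let fsum_fin : fin_num_fun (msum (fun k => m k : {measure set T -> \bar R}) n).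
Proof. by move=> U mU; apply/sum_fin_numP => i _ _; exact: fin_num_measure. Qed.

Definition fsum : {finite_measure set T -> \bar R} := mkfin fsum_fin.

Lemma fsumE B : fsum B = (\sum_(k < n) m k B)%E. Proof. by []. Qed.

Lemma ge0_integral_fsum' (f : T -> \bar R) : measurable_fun setT f ->
  (forall y, 0 <= f y)%E -> (\int[fsum]_y f y = \sum_(k < n) \int[m k]_x f x)%E.
Proof.
move=> mf f0; rewrite [LHS](ge0_integral_measure_sum
  (fun k => m k : {measure set T -> \bar R}) measurableT _ mf n)//.
Qed.

Lemma Rintegral_fsum (f : T -> R) M : measurable_fun setT f ->
  (forall x, `|f x| <= M) ->
  Rintegral fsum setT f = \sum_(k < n) Rintegral (m k) setT f.
Proof.
move=> mf fM; rewrite (Rintegral_shift _ mf fM).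
have mfM : measurable_fun setT (fun x => (f x + M)%:E).
  apply/measurable_EFinP; exact: measurable_funD.
rewrite ge0_integral_fsum'//; last first.
  move=> y; rewrite lee_fin -lerBlDr sub0r.
  by have := fM y; rewrite ler_norml => /andP[].
rewrite fsumE -!sum_fine; last 2 first.
- by move=> k _; exact: fin_num_measure.
- move=> k _; apply: integrable_fin_num => //.
  apply: (@bounded_integrable _ _ _ (m k) (fun x => f x + M) (M + `|M|)).
    exact: measurable_funD.
  by move=> x; rewrite (le_trans (ler_normD _ _))// lerD.
rewrite mulr_sumr -sumrB; apply: eq_bigr => k _.
by rewrite (Rintegral_shift _ mf fM).
Qed.

Lemma cint_fsum (f : T -> R[i]) M : cmeasurable f -> cbounded f M ->
  cint fsum setT f = \sum_(k < n) cint (m k) setT f.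
Proof.
move=> [f1 f2] fM; apply: complex_eq; rewrite ?re_sum ?im_sum;
  apply: (@Rintegral_fsum _ M) => // x.
- exact: le_trans (Re_le_normc _) (fM x).
- exact: le_trans (Im_le_normc _) (fM x).
Qed.

End finite_sum.

Section finite_scale.
Context d (T : measurableType d) (R : realType).
Variables (k : {nonneg R}) (m : {finite_measure set T -> \bar R}).

Definition fscale : {finite_measure set T -> \bar R} := mscale k m.

Lemma fscaleE B : fscale B = (k%:num%:E * m B)%E. Proof. by []. Qed.

Lemma Rintegral_fscale (f : T -> R) M : measurable_fun setT f ->
  (forall x, `|f x| <= M) ->
  Rintegral fscale setT f = k%:num * Rintegral m setT f.
Proof.
move=> mf fM; rewrite !(Rintegral_shift _ mf fM).
have mfM : measurable_fun setT (fun x => (f x + M)%:E).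
  apply/measurable_EFinP; exact: measurable_funD.
rewrite [in LHS]ge0_integral_mscale//; last first.
  move=> y _; rewrite lee_fin -lerBlDr sub0r.
  by have := fM y; rewrite ler_norml => /andP[].
rewrite fscaleE !fineM//=; [ring| |].
  exact: fin_num_measure.
apply: integrable_fin_num => //.
apply: (@bounded_integrable _ _ _ m (fun x => f x + M) (M + `|M|)).
  exact: measurable_funD.
by move=> x; rewrite (le_trans (ler_normD _ _))// lerD.
Qed.

Lemma cint_fscale (f : T -> R[i]) M : cmeasurable f -> cbounded f M ->
  cint fscale setT f = (k%:num)%:C%C * cint m setT f.
Proof.
move=> [f1 f2] fM; apply: complex_eq; rewrite ?re_mul ?im_mul/= mul0r ?subr0 ?addr0;
  apply: (@Rintegral_fscale _ M) => // x.
- exact: le_trans (Re_le_normc _) (fM x).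
- exact: le_trans (Im_le_normc _) (fM x).
Qed.

End finite_scale.

(** * Random trees *)

Section branching.
Context d dE (Om : measurableType d) (E : measurableType dE) (R : realType).
Variables (P : probability Om R) (A : nat -> Om -> R).
Hypothesis mA : forall i, measurable_fun setT (A i).
Variables (op : E -> R -> E -> E) (z0 : E).
Hypothesis mop : measurable_fun setT (fun p : E * R * E => op p.1.1 p.1.2 p.2).

Implicit Types s : nat -> {finite_measure set E -> \bar R}.

(** [op z a z'] stands for [z + a z']; it is kept abstract to serve both sums on the half-line, for
    [zeta], and pairs of reals, for the coupling. The sample point stays in the state because the
    weights of the children of one node may be dependent. *)
Definition attach_map i (p : (Om * E) * E) : Om * E :=
  (p.1.1, op p.1.2 (A i p.1.1) p.2).

Lemma measurable_attach_map i : measurable_fun setT (attach_map i).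
Proof.
have m11 : measurable_fun setT (fun p : (Om * E) * E => p.1.1).
  exact: measurableT_comp measurable_fst measurable_fst.
apply: measurable_fun_pair => //.
apply: (measurableT_comp (f := fun p : E * R * E => op p.1.1 p.1.2 p.2)
  (g := fun p : (Om * E) * E => (p.1.2, A i p.1.1, p.2))) => //.
apply: measurable_fun_pair => //; apply: measurable_fun_pair.
  exact: measurableT_comp measurable_snd measurable_fst.
exact: measurableT_comp (mA i) m11.
Qed.

Definition attach i (M : {finite_measure set (Om * E)%type -> \bar R})
    (s : {finite_measure set E -> \bar R}) :=
  fpush (measurable_attach_map i) (fprodm M s).

Lemma measurable_root : measurable_fun setT (fun w : Om => (w, z0)).
Proof. by apply: measurable_fun_pair => //; exact: measurable_cst. Qed.

(* [forest s i n]: joint law of the weights and of the combination of [i]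
   independent copies, restricted to total size [n], when [s m] is the law of
   a single copy restricted to size [m]. *)
Fixpoint forest (s : nat -> {finite_measure set E -> \bar R}) (i n : nat) :
    {finite_measure set (Om * E)%type -> \bar R} :=
  match i with
  | 0 => fsum (n == 0)%N (fun=> fpush measurable_root P)
  | i'.+1 => fsum n.+1 (fun m => attach i' (forest s i' m) (s (n - m)%N))
  end.

Lemma forestSE s i n B :
  forest s i.+1 n B = (\sum_(m < n.+1) attach i (forest s i m) (s (n - m)%N) B)%E.
Proof. by []. Qed.

(** Total size [n] involves only the laws of sizes at most [n], which lets the tree laws be defined
    size by size. *)
Lemma eq_forest s s' i n : (forall m, (m <= n)%N -> s m = s' m :> (set E -> \bar R)) ->
  forest s i n = forest s' i n :> (set _ -> \bar R).
Proof.
have eq_fprodm (M M' : {finite_measure set (Om * E)%type -> \bar R})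
    (t t' : {finite_measure set E -> \bar R}) B :
    M = M' :> (set _ -> \bar R) -> t = t' :> (set _ -> \bar R) ->
    fprodm M t B = fprodm M' t' B.
  move=> MM' tt'; change ((M \x t)%E B = (M' \x t')%E B).
  by rewrite /product_measure1 MM' tt'.
elim: i n => [//|i IH] n ss'; apply/funext => B.
rewrite !forestSE; apply: eq_bigr => -[m /=]; rewrite ltnS => mn _.
apply: eq_fprodm; last by apply: ss'; exact: leq_subr.
by apply: IH => k km; apply: ss'; exact: leq_trans mn.
Qed.

Lemma measurable_op_section i (f : Om * E -> \bar R) : measurable_fun setT f ->
  measurable_fun setT (fun p : (Om * E) * E => f (p.1.1, op p.1.2 (A i p.1.1) p.2)).
Proof. by move=> mf; exact: measurableT_comp mf (measurable_attach_map i). Qed.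

Lemma ge0_integral_forestS s i n (f : Om * E -> \bar R) : measurable_fun setT f ->
  (forall p, 0 <= f p)%E ->
  (\int[forest s i.+1 n]_p f p = \sum_(m < n.+1)
    \int[forest s i m]_p \int[s (n - m)%N]_z f (p.1, op p.2 (A i p.1) z))%E.
Proof.
move=> mf f0; rewrite /= ge0_integral_fsum'//; apply: eq_bigr => m _.
rewrite /attach ge0_integral_fpush// ge0_integral_fprod//.
exact: measurable_op_section.
Qed.

Lemma ge0_integral_forest0 s n (f : Om * E -> \bar R) : measurable_fun setT f ->
  (forall p, 0 <= f p)%E ->
  (\int[forest s 0 n]_p f p = if n == 0%N then \int[P]_w f (w, z0) else 0)%E.
Proof.
move=> mf f0; rewrite /= ge0_integral_fsum'//; case: n => [|n]; last by rewrite big_ord0.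
by rewrite big_ord1 ge0_integral_fpush.
Qed.

Lemma cint_forestS s i n (f : Om * E -> R[i]) M : cmeasurable f -> cbounded f M ->
  cint (forest s i.+1 n) setT f = \sum_(m < n.+1)
    cint (forest s i m) setT (fun p =>
      cint (s (n - m)%N) setT (fun z => f (p.1, op p.2 (A i p.1) z))).
Proof.
move=> mf fM; rewrite /= (cint_fsum _ _ mf fM); apply: eq_bigr => m _.
rewrite /attach (cint_fpush (measurable_attach_map i) _ mf fM).
rewrite (@cint_fprod _ _ _ _ _ _ _ (fun p => f (attach_map i p)) M)//.
exact: cmeasurable_comp (measurable_attach_map i) mf.
Qed.

Lemma cint_forest0 s n (f : Om * E -> R[i]) M : cmeasurable f -> cbounded f M ->
  cint (forest s 0 n) setT f = (n == 0%N)%:R * cint P setT (fun w => f (w, z0)).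
Proof.
move=> mf fM; rewrite /= (cint_fsum _ _ mf fM); case: n => [|n].
  by rewrite big_ord1 (cint_fpush measurable_root _ mf fM) mul1r.
by rewrite big_ord0 mul0r.
Qed.

(** Coefficient of [u^n] in the product over [j < i] of the power series with coefficients [c j]. *)
Fixpoint fcoef (c : nat -> nat -> R[i]) (i n : nat) : R[i] :=
  match i with
  | 0 => (n == 0%N)%:R
  | i'.+1 => \sum_(m < n.+1) fcoef c i' m * c i' (n - m)%N
  end.

Section factor.
Variables (e : E -> R[i]) (e' : R -> E -> R[i]).
Hypotheses (me : cmeasurable e) (me' : cmeasurable (fun p : R * E => e' p.1 p.2)).
Hypotheses (e1 : cbounded e 1) (e'1 : forall a, cbounded (e' a) 1).
Hypotheses (ez0 : e z0 = 1) (eop : forall z a z', e (op z a z') = e z * e' a z').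

Let cM s k i : cmeasurable (fun w => cint (s k) setT (e' (A i w))).
Proof.
have mc : cmeasurable (fun a : R => cint (s k) setT (e' a)).
  (* The outer measure, here the law of [A i], only serves to express measurability in [a]. *)
  apply: (@cmeasurable_cint _ _ _ _ _ (fpush (mA i) P) (s k) (fun p => e' p.1 p.2) 1) => //.
  by move=> [a b]; exact: e'1.
exact: (cmeasurable_comp (mA i) mc).
Qed.

Lemma cmeasurable_fcoef s i n :
  cmeasurable (fun w => fcoef (fun j m => cint (s m) setT (e' (A j w))) i n).
Proof.
elim: i n => [n|i IH n] /=; first exact: cmeasurable_cst.
by apply: cmeasurable_sum => m; apply: cmeasurableM; [exact: IH|exact: cM].
Qed.

Lemma cbounded_fcoef (s : nat -> {finite_measure set E -> \bar R}) i n :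
  exists M, forall w,
    normc (fcoef (fun j m => cint (s m) setT (e' (A j w))) i n) <= M.
Proof.
elim: i n => [n|i IH n] /=.
  exists 1 => w; case: n => [|n]; first by rewrite ComplexField.Normc.normc1.
  by rewrite ComplexField.Normc.normc0.
have [F HF] := choice IH.
exists (\sum_(m < n.+1) F m * fine (s (n - m)%N setT)) => w.
apply: le_trans (normc_sum _ _ _) _; apply: ler_sum => m _.
rewrite ComplexField.Normc.normcM ler_pM ?normc_ge0//.
have mc : cmeasurable (e' (A i w)).
  exact: cmeasurable_comp (pair1_measurable _) me'.
by rewrite -[leRHS]mul1r; exact: normc_cint_bound.
Qed.

(** Since [e] is multiplicative along [op], integrating out the last child multiplies the integrand
    by a function of the weights alone. The factor [h] is there to receive it, so that the induction
    on [i] applies again; summing over the sizes gives a Cauchy product. *)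
Lemma cint_forest_factor s i n (h : Om -> R[i]) M : cmeasurable h -> cbounded h M ->
  cint (forest s i n) setT (fun p => h p.1 * e p.2) =
  cint P setT (fun w => h w * fcoef (fun j m => cint (s m) setT (e' (A j w))) i n).
Proof.
have mhe (g : Om -> R[i]) : cmeasurable g -> cmeasurable (fun p : Om * E => g p.1 * e p.2).
  move=> mg; apply: cmeasurableM.
    exact: cmeasurable_comp measurable_fst mg.
  exact: cmeasurable_comp measurable_snd me.
have bhe (g : Om -> R[i]) K : cbounded g K -> cbounded (fun p : Om * E => g p.1 * e p.2) K.
  move=> gK p; rewrite ComplexField.Normc.normcM -[K]mulr1.
  by rewrite ler_pM ?normc_ge0.
elim: i n h M => [|i IH] n h M mh hM.
  rewrite (cint_forest0 _ _ (mhe _ mh) (bhe _ _ hM)) /= ez0.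
  under [in RHS]eq_fun do rewrite mulrC.
  rewrite (cintZl _ _ mh hM); congr (_ * _).
  by under eq_fun do rewrite mulr1.
rewrite (cint_forestS _ _ _ (mhe _ mh) (bhe _ _ hM)).
have ms a : cmeasurable (e' a).
  exact: cmeasurable_comp (pair1_measurable _) me'.
transitivity (\sum_(m < n.+1) cint (forest s i m) setT (fun p =>
    (h p.1 * cint (s (n - m)%N) setT (e' (A i p.1))) * e p.2)).
  apply: eq_bigr => m _; congr (cint _ _ _); apply/funext => p /=.
  under [in LHS]eq_fun do rewrite eop mulrA.
  by rewrite (cintZl _ _ (ms _) (@e'1 _)) mulrAC.
have bc k : cbounded (fun w => h w * cint (s k) setT (e' (A i w))) (M * fine (s k setT)).
  move=> w; rewrite ComplexField.Normc.normcM ler_pM ?normc_ge0//.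
  by rewrite -[leRHS]mul1r; exact: normc_cint_bound.
under eq_bigr => m _ do rewrite (IH _ _ _ (cmeasurableM mh (cM _ _ _)) (bc _)).
rewrite /= -[RHS]/(cint P setT (fun w => h w * \sum_(m < n.+1) _)).
under [in RHS]eq_fun do rewrite mulr_sumr.
have : forall m : 'I_n.+1, exists K, cbounded (fun w => h w *
    (fcoef (fun j m => cint (s m) setT (e' (A j w))) i m *
     cint (s (n - m)%N) setT (e' (A i w)))) K.
  move=> m; have [K HK] := cbounded_fcoef s i m.
  exists (M * (K * fine (s (n - m)%N setT))) => w.
  rewrite !ComplexField.Normc.normcM ler_pM ?mulr_ge0 ?normc_ge0//.
  by rewrite ler_pM ?normc_ge0// -[leRHS]mul1r; exact: normc_cint_bound.
move=> bF.
rewrite cint_sum//.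
  apply: eq_bigr => m _; congr (cint _ _ _); apply/funext => w; ring.
by move=> m; apply: cmeasurableM => //; apply: cmeasurableM; [exact: cmeasurable_fcoef|exact: cM].
Qed.

End factor.

(** Vandermonde convolution, one child at a time. The function [g] of the weights is carried along
    for the moments of [A_i] in the cost estimate. *)
Lemma forest_mass s (a : R) i n (g : Om -> \bar R) : 0 <= a ->
  (forall m, (m <= n)%N -> s m setT = (rbin a m)%:E) ->
  measurable_fun setT g -> (forall w, 0 <= g w)%E ->
  (\int[forest s i n]_p g p.1 = (rbin (i%:R * a) n)%:E * \int[P]_w g w)%E.
Proof.
move=> a0 + mg g0.
have mg1 : measurable_fun setT (fun p : Om * E => g p.1).
  exact: measurableT_comp mg measurable_fst.
elim: i n => [|i IH] n sm.
  rewrite ge0_integral_forest0// mul0r rbin_base0.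
  by case: n {sm} => [|n]; rewrite ?mul1e ?mul0e.
rewrite ge0_integral_forestS//.
transitivity (\sum_(m < n.+1) (rbin (i%:R * a) m * rbin a (n - m))%:E *
    \int[P]_w g w)%E.
  apply: eq_bigr => -[m /=]; rewrite ltnS => mn _.
  have e p : (\int[s (n - m)%N]__ g p = g p * (rbin a (n - m))%:E)%E.
    by rewrite (integral_cst (s (n - m)%N) measurableT (g p)); congr (_ * _)%E; exact/sm/leq_subr.
  under eq_integral do rewrite e.
  rewrite ge0_integralZr//; last by rewrite lee_fin rbin_ge0.
  rewrite IH => [|k km]; last by apply: sm; exact: leq_trans mn.
  by rewrite muleAC -EFinM.
rewrite -ge0_sume_distrl; last first.
  by move=> m _; rewrite lee_fin mulr_ge0// rbin_ge0// mulr_ge0.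
by rewrite sumEFin rbin_conv -natr1 mulrDl mul1r.
Qed.


Lemma measurable_powR_norm dT (T : measurableType dT) (f : T -> R) (p : R) :
  measurable_fun setT f -> measurable_fun setT (fun x => (`|f x| `^ p)%:E).
Proof.
move=> mf; apply/measurable_EFinP.
by apply: (measurableT_comp (measurable_powR p)); exact: measurableT_comp.
Qed.

(** The last child is integrated first, with shift [y = x + a D p.2] and scale [b = a A_i]: its
    bound splits into the cost of the remaining children and a moment of [A_i]. On summing over the
    sizes, the first contribution has parameter [(q + i al - al) + al] and the second [i al + q];
    they agree, so one binomial carries the whole sum. *)
Lemma forest_cost s (al q K del : R) (D : E -> R) (SA : nat -> R) i n (x a : R) :
  0 <= al -> 0 <= q -> 0 <= K -> 0 < del ->
  (forall j w, 0 <= A j w) ->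
  measurable_fun setT D -> D z0 = 0 ->
  (forall z b z', D (op z b z') = D z + b * D z') ->
  (forall m, (m <= n)%N -> s m setT = (rbin al m)%:E) ->
  (forall j, (j < i)%N -> (\int[P]_w (A j w `^ del)%:E = (SA j)%:E)%E) ->
  (forall m (y b : R), (m <= n)%N -> 0 <= b ->
    (\int[s m]_z (`|y + b * D z| `^ del)%:E <=
     (rbin al m * `|y| `^ del + b `^ del * K * rbin q m)%:E)%E) ->
  0 <= a ->
  (\int[forest s i n]_p (`|x + a * D p.2| `^ del)%:E <=
    (rbin (i%:R * al) n * `|x| `^ del +
     a `^ del * K * (\sum_(j < i) SA j) * rbin (q + i%:R * al - al) n)%:E)%E.
Proof.
move=> al0 q0 K0 del0 A0 mD Dz0 Dop + + + a0.
have mDs : measurable_fun setT (fun p : Om * E => D p.2).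
  exact: measurableT_comp mD measurable_snd.
have mf (y b : R) : measurable_fun setT (fun p : Om * E => (`|y + b * D p.2| `^ del)%:E).
  by apply: measurable_powR_norm; apply: measurable_funD => //; exact: measurable_funM.
elim: i n => [|i IH] n sm SAE sc.
  rewrite ge0_integral_forest0// mul0r rbin_base0 big_ord0 mulr0 mul0r addr0.
  case: n {sm sc} => [|n] /=; last by rewrite mul0r.
  rewrite Dz0 mulr0 addr0 mul1r (integral_cst P measurableT (`|x| `^ del)%:E).
  by rewrite -[leRHS]mule1 le_eqVlt; apply/orP; left; apply/eqP; congr (_ * _)%E;
    exact: probability_setT.
have SA0 j : (j < i.+1)%N -> 0 <= SA j.
  move=> ji; rewrite -lee_fin -SAE//.
  by apply: integral_ge0 => w _; rewrite lee_fin powR_ge0.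
rewrite ge0_integral_forestS//.
have step (m : 'I_n.+1) : (\int[forest s i m]_p \int[s (n - m)%N]_z
      (`|x + a * D (op p.2 (A i p.1) z)| `^ del)%:E <=
    (rbin al (n - m) * (rbin (i%:R * al) m * `|x| `^ del +
       a `^ del * K * (\sum_(j < i) SA j) * rbin (q + i%:R * al - al) m) +
     a `^ del * K * rbin q (n - m) * (rbin (i%:R * al) m * SA i))%:E)%E.
  case: m => m /=; rewrite ltnS => mn.
  have mn' k : (k <= m)%N -> (k <= n)%N by move=> km; exact: leq_trans mn.
  have mA' : measurable_fun setT (fun w => (A i w `^ del)%:E).
    by apply/measurable_EFinP; exact: (measurableT_comp (measurable_powR del)).
  apply: (@le_trans _ _ (\int[forest s i m]_p
     ((rbin al (n - m))%:E * (`|x + a * D p.2| `^ del)%:E +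
      (a `^ del * K * rbin q (n - m))%:E * (A i p.1 `^ del)%:E))%E).
    apply: ge0_le_integral => //.
    - by move=> p _; apply: integral_ge0 => z _; rewrite lee_fin powR_ge0.
    - pose g (r : (Om * E) * E) := (`|x + a * D (op r.1.2 (A i r.1.1) r.2)| `^ del)%:E.
      apply: (@measurable_fun_fubini_tonelli_F _ _ _ _ _ (s (n - m)%N) g).
        exact: (measurable_op_section i (mf x a)).
      by move=> r; rewrite lee_fin powR_ge0.
    - apply: emeasurable_funD.
        by apply: measurable_funeM; exact: mf.
      apply: measurable_funeM.
      exact: (measurableT_comp mA' measurable_fst).
    - move=> p _; apply: (@le_trans _ _ (\int[s (n - m)%N]_z
        (`|(x + a * D p.2) + (a * A i p.1) * D z| `^ del)%:E)%E).
        apply: ge0_le_integral => //.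
        + apply: measurable_powR_norm; apply: measurable_funD => //.
          apply: measurable_funM => //; apply: (measurableT_comp mD).
          exact: (measurableT_comp mop (pair1_measurable (p.2, A i p.1))).
        + apply: measurable_powR_norm; apply: measurable_funD => //.
          exact: measurable_funM.
        + by move=> z _; rewrite Dop mulrDr addrA mulrA.
      apply: (le_trans (sc _ _ _ (leq_subr _ _) (mulr_ge0 a0 (A0 _ _)))).
      by rewrite -!EFinM -EFinD lee_fin powRM// -!mulrA lerD// ler_wpM2l ?powR_ge0// mulrC -!mulrA.
  rewrite ge0_integralD//; last 4 first.
  - by move=> p _; rewrite -EFinM lee_fin mulr_ge0 ?powR_ge0 ?rbin_ge0.
  - by apply: measurable_funeM; exact: mf.
  - by move=> p _; rewrite -EFinM lee_fin !mulr_ge0 ?powR_ge0 ?rbin_ge0.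
  - apply: measurable_funeM.
    exact: (measurableT_comp mA' measurable_fst).
  rewrite ge0_integralZl_EFin ?rbin_ge0//.
  rewrite ge0_integralZl_EFin ?mulr_ge0 ?powR_ge0 ?rbin_ge0//; last 2 first.
  - by move=> p _; rewrite lee_fin powR_ge0.
  - exact: (measurableT_comp mA' measurable_fst).
  rewrite (@forest_mass s al i m (fun w => (A i w `^ del)%:E))//; last 2 first.
  - by move=> k km; exact/sm/mn'.
  - by move=> w; rewrite lee_fin powR_ge0.
  rewrite SAE// EFinD; apply: leeD; last by rewrite -!EFinM.
  rewrite EFinM; apply: lee_wpmul2l; first by rewrite lee_fin rbin_ge0.
  apply: IH.
  - by move=> k km; exact/sm/mn'.
  - by move=> j ji; apply: SAE; exact: ltnW.
  - by move=> k y b km b0; apply: sc => //; exact: mn'.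
apply: (le_trans (lee_sum _ (fun m _ => step m))).
rewrite sumEFin lee_fin le_eqVlt; apply/orP; left; apply/eqP.
have -> : i.+1%:R * al = i%:R * al + al by rewrite -natr1 mulrDl mul1r.
rewrite addrA addrK -[rbin (i%:R * al + al) n]rbin_conv.
set c := a `^ del * K; set S1 := \sum_(j < i) SA j.
have -> : \sum_(j < i.+1) SA j = S1 + SA i by rewrite big_ord_recr.
have e1 : rbin (q + i%:R * al) n =
    \sum_(m < n.+1) rbin (q + i%:R * al - al) m * rbin al (n - m).
  by rewrite rbin_conv subrK.
have e2 : rbin (q + i%:R * al) n = \sum_(m < n.+1) rbin (i%:R * al) m * rbin q (n - m).
  by rewrite rbin_conv addrC.
have -> : c * (S1 + SA i) * rbin (q + i%:R * al) n =
  c * S1 * rbin (q + i%:R * al) n + c * SA i * rbin (q + i%:R * al) n by ring.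
rewrite {1}e1 e2 mulr_suml !mulr_sumr addrA -!big_split/=.
by apply: eq_bigr => m _; ring.
Qed.

End branching.

Section tree_measures.
Context d dE (Om : measurableType d) (E : measurableType dE) (R : realType).
Variables (P : probability Om R) (A : nat -> Om -> R).
Hypothesis mA : forall i, measurable_fun setT (A i).
Variables (op : E -> R -> E -> E) (z0 : E).
Hypothesis mop : measurable_fun setT (fun p : E * R * E => op p.1.1 p.1.2 p.2).
Variables (N : nat) (al : R).
Hypotheses (al0 : 0 < al) (Nal : N%:R * al = al + 1).
Variable s0 : probability E R.

Local Notation forest := (forest P mA z0 mop).

(** Put [e^-t sum_n c_n u^n] into the Cauchy equation: as [u' = (N - 1) (1 - u)], comparing powers
    of [u] gives [(n + 1) c_(n+1)] as [al] times the coefficient of [u^n] in the expected product,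
    where [al (N - 1) = 1], that is [N al = al + 1]. *)
Definition tree_coef n : {nonneg R} := NngNum (divr_ge0 (ltW al0) (ler0n R n.+1)).

Definition grow (s : nat -> {finite_measure set E -> \bar R}) n :=
  fscale (tree_coef n) (fpush measurable_snd (forest s N n)).

Lemma growE s n B :
  grow s n B = ((al / n.+1%:R)%:E * forest s N n (snd @^-1` B))%E.
Proof. by rewrite /grow fscaleE fpushE. Qed.

(** Course-of-values recursion through a table: stage [k] is right for sizes up to [k], and the
    entries beyond are fillers. *)
Fixpoint tree_upto k : nat -> {finite_measure set E -> \bar R} :=
  match k with
  | 0 => fun=> s0
  | k'.+1 => fun m => if (m <= k')%N then tree_upto k' m else grow (tree_upto k') k'
  end.

Definition tree n := tree_upto n n.

Lemma tree_uptoE k m : (m <= k)%N -> tree_upto k m = tree m.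
Proof.
elim: k m => [|k IH] m; first by rewrite leqn0 => /eqP ->.
rewrite leq_eqVlt => /predU1P[->//|]; rewrite ltnS => mk /=.
by rewrite mk IH.
Qed.

Lemma treeS n : tree n.+1 = grow tree n :> (set E -> \bar R).
Proof.
have -> : tree n.+1 = grow (tree_upto n) n by rewrite /tree /= ltnn.
apply/funext => B; rewrite !growE.
have /(congr1 (fun f => f (snd @^-1` B))) -> // :
    forest (tree_upto n) N n = forest tree N n :> (set _ -> \bar R).
by apply: eq_forest => m mn; rewrite tree_uptoE.
Qed.

Lemma ge0_integral_treeS n (f : E -> \bar R) : measurable_fun setT f ->
  (forall z, 0 <= f z)%E ->
  (\int[tree n.+1]_z f z = (al / n.+1%:R)%:E * \int[forest tree N n]_p f p.2)%E.
Proof.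
move=> mf f0; rewrite treeS /grow [LHS]ge0_integral_mscale//.
by rewrite ge0_integral_fpush.
Qed.

Lemma eq_cint dT (T : measurableType dT) (m m' : {measure set T -> \bar R}) D (f : T -> R[i]) :
  m = m' :> (set T -> \bar R) -> cint m D f = cint m' D f.
Proof. by move=> mm'; rewrite /cint /Rintegral mm'. Qed.

Lemma cint_treeS n (f : E -> R[i]) M : cmeasurable f -> cbounded f M ->
  cint (tree n.+1) setT f =
  (al / n.+1%:R)%:C%C * cint (forest tree N n) setT (fun p => f p.2).
Proof.
move=> mf fM; rewrite (eq_cint _ _ (treeS n)) /grow (cint_fscale _ _ mf fM).
by rewrite (cint_fpush _ _ mf fM).
Qed.

(** By the choice of [al] the forest has mass [rbin (N al) n = rbin (al + 1) n], and [rbinSS]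
    absorbs the prefactor. *)
Lemma tree_mass n : tree n setT = (rbin al n)%:E.
Proof.
elim/ltn_ind: n => -[_|n IH]; first by rewrite rbin0 -(probability_setT s0).
rewrite -[LHS]mul1e -(integral_cst (tree n.+1) measurableT 1%E).
rewrite ge0_integral_treeS//.
have h := @forest_mass _ _ _ _ _ P _ mA _ z0 mop tree al N n (fun=> 1%E) (ltW al0)
  (fun m mn => IH m mn) (measurable_cst _) (fun=> lee01).
transitivity ((al / n.+1%:R)%:E * (\int[forest tree N n]_p (fun=> 1%E) p.1))%E => //.
rewrite h (integral_cst P measurableT 1%E) mul1e Nal.
have -> : ((rbin (al + 1) n)%:E * P setT = (rbin (al + 1) n)%:E)%E.
  by rewrite -[RHS]mule1; congr (_ * _)%E; exact: probability_setT.
rewrite -EFinM; congr EFin.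
have n0 : n.+1%:R != 0 :> R by rewrite pnatr_eq0.
by apply: (mulfI n0); rewrite rbinSS; field; rewrite addrC natr1.
Qed.

(** The bound assumed on leaves, for every shift [y] and scale [b], is returned in the same form for
    trees, with the same [K]. With [q = S al] the forest contributes [S rbin (S al + 1) n], which
    the prefactor [al / n.+1] turns into [rbin (S al) n.+1]. *)
Lemma tree_cost (K del : R) (D : E -> R) (SA : nat -> R) n (x a : R) :
  0 <= K -> 0 < del ->
  (forall j w, 0 <= A j w) ->
  measurable_fun setT D -> D z0 = 0 ->
  (forall z b z', D (op z b z') = D z + b * D z') ->
  (forall j, (j < N)%N -> (\int[P]_w (A j w `^ del)%:E = (SA j)%:E)%E) ->
  (forall y b : R, 0 <= b ->
    (\int[s0]_z (`|y + b * D z| `^ del)%:E <= (`|y| `^ del + b `^ del * K)%:E)%E) ->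
  0 <= a ->
  (\int[tree n]_z (`|x + a * D z| `^ del)%:E <=
    (rbin al n * `|x| `^ del +
     a `^ del * K * rbin ((\sum_(j < N) SA j) * al) n)%:E)%E.
Proof.
move=> K0 del0 A0 mD Dz0 Dop SAE sc; set S := \sum_(j < N) SA j.
have S0 : 0 <= S.
  apply: sumr_ge0 => -[j jN] _ /=; rewrite -lee_fin -SAE//.
  by apply: integral_ge0 => w _; rewrite lee_fin powR_ge0.
elim/ltn_ind: n x a => -[_|n IH] x a a0.
  by rewrite !rbin0 mul1r mulr1; exact: sc.
have mf (y b : R) : measurable_fun setT (fun z : E => (`|y + b * D z| `^ del)%:E).
  by apply: measurable_powR_norm; apply: measurable_funD => //; exact: measurable_funM.
rewrite ge0_integral_treeS//.
have q0 : 0 <= S * al by rewrite mulr_ge0// ltW.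
have h := @forest_cost _ _ _ _ _ P _ mA _ z0 mop tree al (S * al) K del D SA N n x a
  (ltW al0) q0 K0 del0 A0 mD Dz0 Dop (fun m _ => tree_mass m) SAE
  (fun m y b mn b0 => IH m mn y b b0) a0.
apply: (@le_trans _ _ ((al / n.+1%:R)%:E * _)%E).
  by apply: lee_wpmul2l h; rewrite lee_fin divr_ge0// ltW.
rewrite -EFinM lee_fin le_eqVlt; apply/orP; left; apply/eqP.
have n0 : n.+1%:R != 0 :> R by rewrite pnatr_eq0.
rewrite -/S Nal -addrA [al + 1 - al]addrAC subrr add0r.
apply: (mulfI n0).
transitivity ((n.+1%:R * rbin al n.+1) * `|x| `^ del +
  a `^ del * K * (n.+1%:R * rbin (S * al) n.+1)); last by ring.
by rewrite !rbinSS; field; rewrite addrC natr1.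
Qed.

End tree_measures.

(** * Products of truncated power series *)

Section truncated_product.
Context {R : realType}.

(** The antidiagonals become the part [k + l < M'] of a rectangle; the rest of the rectangle is the
    error made by truncation. *)
Lemma triangular_sum (V : zmodType) (g : nat -> nat -> V) (M' M : nat) : (M' <= M)%N ->
  \sum_(n < M') \sum_(k < n.+1) g k (n - k)%N =
  \sum_(k < M') \sum_(l < M | (k + l < M')%N) g k l.
Proof.
elim: M' => [|m IH] mM; first by rewrite !big_ord0.
rewrite big_ord_recr /= IH; last exact: ltnW.
transitivity (\sum_(k < m.+1) (\sum_(l < M | (k + l < m)%N) g k l + g k (m - k)%N)).
  rewrite [RHS]big_split /= [X in _ = X + _]big_ord_recr /=.
  rewrite [X in _ = _ + X + _]big_pred0 ?addr0// => l.
  by rewrite ltnNge leq_addr.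
apply: eq_bigr => -[k /=]; rewrite ltnS => km _.
have kM : (m - k < M)%N by apply: leq_ltn_trans mM; exact: leq_subr.
rewrite [RHS](bigD1 (Ordinal kM)) /= ?subnKC// addrC; congr (_ + _).
apply: eq_bigl => l; rewrite -val_eqE /= ltnS [(k + l < m)%N]ltn_neqAle andbC.
congr (_ && ~~ _); apply/eqP/eqP => [<-|->]; last by rewrite subnKC.
by rewrite addKn.
Qed.

Variables (al : R) (c : nat -> nat -> R[i]).
Hypotheses (al0 : 0 <= al) (cb : forall j n, normc (c j n) <= rbin al n).

Lemma normc_fcoef i n : normc (fcoef c i n) <= rbin (i%:R * al) n.
Proof.
elim: i n => [|i IH] n /=.
  rewrite mul0r rbin_base0; case: n => [|n] /=.
    by rewrite ComplexField.Normc.normc1.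
  by rewrite ComplexField.Normc.normc0.
rewrite -natr1 mulrDl mul1r -rbin_conv.
apply: le_trans (normc_sum _ _ _) _; apply: ler_sum => m _.
by rewrite ComplexField.Normc.normcM ler_pM ?normc_ge0.
Qed.

Definition csum (f : nat -> R[i]) (u : R) (M : nat) : R[i] :=
  \sum_(n < M) (u ^+ n)%:C%C * f n.

(** The error consists of the monomials that the product has and the truncated series lacks.
    Bounding each coefficient by its majorant gives the same error for the majorant series, which is
    the right-hand side. *)
Lemma csum_truncated_prod (u : R) (M' M i : nat) : 0 <= u -> (M' <= M)%N ->
  normc (\prod_(j < i) csum (c j) u M - csum (fcoef c i) u M') <=
  (\sum_(n < M) rbin al n * u ^+ n) ^+ i - \sum_(n < M') rbin (i%:R * al) n * u ^+ n.
Proof.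
move=> u0 MM'; set Q := \sum_(n < M) rbin al n * u ^+ n.
have un0 n : 0 <= u ^+ n by rewrite exprn_ge0.
have r0 (k n : nat) : 0 <= rbin (k%:R * al) n by rewrite rbin_ge0// mulr_ge0.
have Q0 : 0 <= Q by apply: sumr_ge0 => n _; rewrite mulr_ge0// rbin_ge0.
have qb j : normc (csum (c j) u M) <= Q.
  apply: le_trans (normc_sum _ _ _) _; apply: ler_sum => n _.
  by rewrite ComplexField.Normc.normcM normc_real ger0_norm// mulrC ler_wpM2r.
elim: i => [|i IH].
  rewrite big_ord0 expr0 mul0r /csum; case: M' MM' => [|m] mM.
    by rewrite !big_ord0 !subr0 ComplexField.Normc.normc1.
  rewrite !big_ord_recl /= expr0 rbin0 mulr1 big1 ?addr0; last first.
    by move=> n _; rewrite mulr0.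
  rewrite big1 ?addr0; last by move=> n _; rewrite rbin_base0 mul0r.
  by rewrite mul1r !subrr ComplexField.Normc.normc0.
rewrite big_ord_recr exprSr /=.
set p := \prod_(j < i) _ in IH *; set T := csum (fcoef c i) u M' in IH *.
set S := \sum_(n < M') rbin (i%:R * al) n * u ^+ n in IH *.
have eT : T * csum (c i) u M - csum (fcoef c i.+1) u M' =
   \sum_(k < M') \sum_(l < M | ~~ (k + l < M')%N)
      (u ^+ (k + l))%:C%C * (fcoef c i k * c i l).
  have -> : csum (fcoef c i.+1) u M' = \sum_(k < M') \sum_(l < M | (k + l < M')%N)
      (u ^+ (k + l))%:C%C * (fcoef c i k * c i l).
    rewrite -(triangular_sum (fun k l => (u ^+ (k + l))%:C%C * (fcoef c i k * c i l)) MM').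
    apply: eq_bigr => n _ /=; rewrite mulr_sumr; apply: eq_bigr => -[k /=].
    by rewrite ltnS => kn _; rewrite subnKC.
  rewrite /T /csum mulr_suml -sumrB; apply: eq_bigr => k _.
  rewrite mulr_sumr (bigID (fun l : 'I_M => (k + l < M')%N)) /= addrAC.
  rewrite -sumrB big1 ?add0r; last first.
    by move=> l _; rewrite exprD rmorphM; ring.
  by apply: eq_bigr => l _; rewrite exprD rmorphM; ring.
have eS : S * Q - \sum_(n < M') rbin (i.+1%:R * al) n * u ^+ n =
   \sum_(k < M') \sum_(l < M | ~~ (k + l < M')%N)
      u ^+ (k + l) * (rbin (i%:R * al) k * rbin al l).
  have -> : \sum_(n < M') rbin (i.+1%:R * al) n * u ^+ n =
      \sum_(k < M') \sum_(l < M | (k + l < M')%N)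
      u ^+ (k + l) * (rbin (i%:R * al) k * rbin al l).
    rewrite -(triangular_sum (fun k l => u ^+ (k + l) * (rbin (i%:R * al) k * rbin al l)) MM').
    apply: eq_bigr => n _; rewrite -natr1 mulrDl mul1r -rbin_conv mulr_suml.
    by apply: eq_bigr => -[k /=]; rewrite ltnS => kn _; rewrite subnKC// mulrC.
  rewrite /S /Q mulr_suml -sumrB; apply: eq_bigr => k _.
  rewrite mulr_sumr (bigID (fun l : 'I_M => (k + l < M')%N)) /= addrAC.
  rewrite -sumrB big1 ?add0r; last by move=> l _; rewrite exprD; ring.
  by apply: eq_bigr => l _; rewrite exprD; ring.
(* Error of the first [i] factors times the new factor, plus the error of the new multiplication;
   the majorants split in the same way. *)
have -> : p * csum (c i) u M - csum (fcoef c i.+1) u M' =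
  (p - T) * csum (c i) u M + (T * csum (c i) u M - csum (fcoef c i.+1) u M').
  by ring.
have -> : Q ^+ i * Q - \sum_(n < M') rbin (i.+1%:R * al) n * u ^+ n =
  (Q ^+ i - S) * Q + (S * Q - \sum_(n < M') rbin (i.+1%:R * al) n * u ^+ n).
  by ring.
apply: le_trans (le_normcD _ _) _; apply: lerD.
  by rewrite ComplexField.Normc.normcM ler_pM ?normc_ge0.
rewrite eT eS; apply: le_trans (normc_sum _ _ _) _; apply: ler_sum => k _.
apply: le_trans (normc_sum _ _ _) _; apply: ler_sum => l _.
rewrite !ComplexField.Normc.normcM normc_real ger0_norm//.
by rewrite ler_wpM2l// ler_pM ?normc_ge0// normc_fcoef.
Qed.

End truncated_product.

(** Telescoping: one factor is changed at a time, the others staying in the unit disc. *)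
Lemma normc_prodB_le {R : realType} n (z w : 'I_n -> R[i]) :
  (forall i, normc (z i) <= 1) -> (forall i, normc (w i) <= 1) ->
  normc (\prod_(i < n) z i - \prod_(i < n) w i) <= \sum_(i < n) normc (z i - w i).
Proof.
elim: n z w => [|n IH] z w z1 w1.
  by rewrite !big_ord0 subrr ComplexField.Normc.normc0.
rewrite !big_ord_recr /=.
set pz := \prod_(i < n) _; set pw := \prod_(i < n) w _.
have -> : pz * z ord_max - pw * w ord_max =
  (pz - pw) * z ord_max + pw * (z ord_max - w ord_max) by ring.
apply: le_trans (le_normcD _ _) _; rewrite !ComplexField.Normc.normcM; apply: lerD.
  rewrite -[leRHS]mulr1 ler_pM ?normc_ge0//; exact: IH.
rewrite -[leRHS]mul1r ler_wpM2r ?normc_ge0// normc_prod.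
by apply: prodr_ile1 => i _; rewrite normc_ge0 w1.
Qed.

(** * Uniqueness for the Cauchy problem *)

Lemma cmeasurableB d (T : measurableType d) (R : realType) (f g : T -> R[i]) :
  cmeasurable f -> cmeasurable g -> cmeasurable (fun x => f x - g x).
Proof.
move=> [f1 f2] [g1 g2]; split.
- by under eq_fun do rewrite raddfB; exact: measurable_funB.
- by under eq_fun do rewrite raddfB; exact: measurable_funB.
Qed.

Section cauchy_uniqueness.
Context d (Om : measurableType d) {R : realType} (P : probability Om R).
Variables (A : nat -> Om -> R) (N : nat).
Hypothesis mA : forall i, measurable_fun setT (A i).
Variables (al b : R).
Hypotheses (al0 : 0 < al) (b0 : 0 < b) (alb : al * b = 1) (Nb : N%:R = 1 + b).

(** Of characteristic functions, only measurability in [xi] and the bound by 1 are retained. *)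
Definition cauchy_solution (phi : R -> R -> R[i]) :=
  [/\ forall t, cmeasurable (phi t), forall t xi, normc (phi t xi) <= 1 &
   forall xi,
    (complex.Re (phi s xi) @[s --> (0 : R)^'+] --> complex.Re (phi 0 xi)) /\
    (complex.Im (phi s xi) @[s --> (0 : R)^'+] --> complex.Im (phi 0 xi)) /\
    forall t : R, 0 < t ->
      derivable (fun s => complex.Re (phi s xi)) t 1 /\
      derivable (fun s => complex.Im (phi s xi)) t 1 /\
      (derive1 (fun s => complex.Re (phi s xi)) t +i*
       derive1 (fun s => complex.Im (phi s xi)) t)%C + phi t xi =
      cint P setT (fun w => \prod_(i < N) phi t (A i w * xi))].

Variables (c : R -> nat -> R[i]).
Hypotheses (mc : forall n, cmeasurable (fun xi => c xi n)).
Hypothesis cb : forall xi n, normc (c xi n) <= rbin al n.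
Hypothesis crec : forall xi n, n.+1%:R * c xi n.+1 =
  al%:C%C * cint P setT (fun w => fcoef (fun j m => c (A j w * xi) m) N n).

Local Notation u := (utime b).

Definition partial (M : nat) (t xi : R) : R[i] :=
  (expR (- t))%:C%C * csum (c xi) (u t) M.

(* Tail of the binomial series of [(1 - u t)^-(N * al) = exp (N * t)] *)
Definition tail (M : nat) (t : R) : R :=
  expR (N%:R * t) - psum b (rbin (N%:R * al)) M t.

Let Nal0 : 0 <= N%:R * al. Proof. by rewrite mulr_ge0// ltW. Qed.
Let Nalb : N%:R * al * b = N%:R. Proof. by rewrite -mulrA alb mulr1. Qed.

Lemma tail_cvg t : 0 <= t -> tail M t @[M --> \oo] --> (0 : R).
Proof.
move=> t0; rewrite -[X in _ --> X](subrr (expR (N%:R * t))).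
apply: cvgB; first exact: cvg_cst.
by have := cvg_rbin_psum b0 Nal0 t0; rewrite Nalb.
Qed.

(** The tail is a limit of finite tails with nonnegative coefficients, each nondecreasing in
    time. *)
Lemma tail_le M s t : 0 <= s -> s <= t -> tail M s <= tail M t.
Proof.
move=> s0 st; have t0 : 0 <= t by exact: le_trans st.
have cs : psum b (rbin (N%:R * al)) K s - psum b (rbin (N%:R * al)) M s @[K --> \oo] --> tail M s.
  by apply: cvgB; [have := cvg_rbin_psum b0 Nal0 s0; rewrite Nalb|exact: cvg_cst].
have ct : psum b (rbin (N%:R * al)) K t - psum b (rbin (N%:R * al)) M t @[K --> \oo] --> tail M t.
  by apply: cvgB; [have := cvg_rbin_psum b0 Nal0 t0; rewrite Nalb|exact: cvg_cst].
apply: (ler_cvg_to cs ct); near=> K.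
have MK : (M <= K)%N by near: K; exact: nbhs_infty_ge.
rewrite /psum -!(big_mkord xpredT (fun n => rbin (N%:R * al) n * u _ ^+ n)).
rewrite !(big_cat_nat (leq0n M) MK)//= ![_ + _ - _]addrAC !subrr !add0r.
apply: ler_sum => n _; rewrite ler_wpM2l ?rbin_ge0//.
by rewrite lerXn2r ?nnegrE ?utime_ge0// utime_le.
Unshelve. all: by end_near. Qed.

Lemma normc_partial_le M t xi : 0 <= t -> normc (partial M t xi) <= 1.
Proof.
move=> t0; rewrite /partial ComplexField.Normc.normcM normc_real.
rewrite ger0_norm ?expR_ge0// expRN mulrC ler_pdivrMr ?expR_gt0// mul1r.
have := rbin_psum_le b0 M (ltW al0) t0; rewrite alb mul1r; apply: le_trans.
apply: le_trans (normc_sum _ _ _) _; apply: ler_sum => n _.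
have un0 : 0 <= u t ^+ n by rewrite exprn_ge0// utime_ge0.
by rewrite ComplexField.Normc.normcM normc_real ger0_norm// mulrC ler_wpM2r.
Qed.

Lemma cmeasurable_csum (f : Om -> nat -> R[i]) x M :
  (forall n, cmeasurable (fun w => f w n)) -> cmeasurable (fun w => csum (f w) x M).
Proof.
by move=> mf; apply: cmeasurable_sum => n; apply: cmeasurableM => //; exact: cmeasurable_cst.
Qed.

Lemma cmeasurable_fcoef_gen (f : Om -> nat -> nat -> R[i]) i n :
  (forall j n, cmeasurable (fun w => f w j n)) -> cmeasurable (fun w => fcoef (f w) i n).
Proof.
move=> mf; elim: i n => [|i IH] n /=; first exact: cmeasurable_cst.
by apply: cmeasurable_sum => m; apply: cmeasurableM; [exact: IH|exact: mf].
Qed.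

Lemma cintB (f g : Om -> R[i]) M M' : cmeasurable f -> cmeasurable g ->
  cbounded f M -> cbounded g M' ->
  cint P setT (fun x => f x - g x) = cint P setT f - cint P setT g.
Proof.
move=> mf mg fM gM.
have mg' : cmeasurable (fun x => - 1 * g x).
  by apply: cmeasurableM => //; exact: cmeasurable_cst.
have gM' : cbounded (fun x => - 1 * g x) M'.
  by move=> x; rewrite mulN1r normcN.
rewrite -[X in _ + X]mulN1r -(cintZl P (- 1) mg gM) -(cintD P mf mg' fM gM').
by congr (cint _ _ _); apply/funext => x; rewrite mulN1r.
Qed.

Lemma normc_cint_le1 (f : Om -> R[i]) M : cmeasurable f -> cbounded f M ->
  normc (cint P setT f) <= M.
Proof.
move=> mf fM; apply: le_trans (normc_cint_bound P mf fM) _.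
rewrite -[leRHS]mulr1 le_eqVlt; apply/orP; left; apply/eqP; congr (_ * _).
exact: (congr1 fine (probability_setT P)).
Qed.

Section step.
Variable phi : R -> R -> R[i].
Hypotheses (phis : cauchy_solution phi) (phi0 : forall xi, phi 0 xi = c xi 0%N).
Variables (M : nat) (s xi H : R).
Hypotheses (s0 : 0 <= s).
Hypothesis diffH : forall x, normc (phi s x - partial M.+1 s x) <= H.

Let mphi t : cmeasurable (phi t). Proof. by case: phis. Qed.
Let phi1 t x : normc (phi t x) <= 1. Proof. by case: phis => _ + _; exact. Qed.

Let mAxi j : measurable_fun setT (fun w => A j w * xi).
Proof. by apply: measurable_funM. Qed.

Let mcA j n : cmeasurable (fun w => c (A j w * xi) n).
Proof. exact: cmeasurable_comp (mAxi j) (mc n). Qed.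

(** The two terms are the derivatives of [exp s * phi] and of the truncated series. They are
    compared through the product of the truncated sums: the product is Lipschitz on the unit disc,
    whence [N H], and the powers cut off are dominated by the tail of the series of [exp (N s)]. *)
Lemma partial_rhs_le :
  normc ((expR s)%:C%C * cint P setT (fun w => \prod_(i < N) phi s (A i w * xi)) -
    (expR (- (b * s)))%:C%C * cint P setT (fun w =>
      csum (fcoef (fun j m => c (A j w * xi) m) N) (u s) M)) <=
  expR s * (N%:R * H) + tail M s.
Proof.
set I1 := cint _ _ _; set I2 := cint _ _ _.
pose I3 := cint P setT (fun w => \prod_(i < N) partial M.+1 s (A i w * xi)).
pose I4 := cint P setT (fun w => \prod_(i < N) csum (c (A i w * xi)) (u s) M.+1).
have mcs j : cmeasurable (fun w => csum (c (A j w * xi)) (u s) M.+1).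
  by apply: cmeasurable_csum => n; exact: mcA.
have mpa j : cmeasurable (fun w => partial M.+1 s (A j w * xi)).
  by apply: cmeasurableM => //; exact: cmeasurable_cst.
have mph j : cmeasurable (fun w => phi s (A j w * xi)).
  exact: cmeasurable_comp (mAxi j) (mphi s).
have prod1 (f : 'I_N -> Om -> R[i]) : (forall j w, normc (f j w) <= 1) ->
    cbounded (fun w => \prod_(i < N) f i w) 1.
  by move=> f1 w; rewrite normc_prod; apply: prodr_ile1 => i _; rewrite normc_ge0 f1.
have pa1 j w : normc (partial M.+1 s (A j w * xi)) <= 1 by exact: normc_partial_le.
have csE x : csum (c x) (u s) M.+1 = (expR s)%:C%C * partial M.+1 s x.
  by rewrite /partial mulrA -rmorphM -expRD subrr expR0 mul1r.
have e34 : I4 = (expR (N%:R * s))%:C%C * I3.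
  rewrite /I3 -(cintZl _ _ (cmeasurable_prod (fun j : 'I_N => mpa j)) (prod1 _ (fun j : 'I_N => pa1 j))).
  congr (cint _ _ _); apply/funext => w.
  under eq_bigr do rewrite csE; rewrite big_split /=; congr (_ * _).
  rewrite prodr_const card_ord -rmorphXn; congr (_%:C)%C.
  by rewrite -expRM_natl mulr_natl.
(* [N = 1 + b] makes the normalisations match: [exp (- b s) exp (N s) = exp s]. *)
have e43 : (expR (- (b * s)))%:C%C * I4 = (expR s)%:C%C * I3.
  rewrite e34 mulrA -rmorphM -expRD; congr ((expR _)%:C%C * _).
  by rewrite Nb; ring.
have -> : (expR s)%:C%C * I1 - (expR (- (b * s)))%:C%C * I2 =
  (expR s)%:C%C * (I1 - I3) + (expR (- (b * s)))%:C%C * (I4 - I2).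
  by rewrite !mulrBr e43; ring.
apply: le_trans (le_normcD _ _) _; rewrite !ComplexField.Normc.normcM !normc_real.
rewrite !ger0_norm ?expR_ge0//; apply: lerD.
  rewrite ler_wpM2l ?expR_ge0// /I1 /I3.
  rewrite -(cintB (cmeasurable_prod (fun j : 'I_N => mph j)) (cmeasurable_prod (fun j : 'I_N => mpa j))
    (prod1 _ (fun (j : 'I_N) w => phi1 s _)) (prod1 _ (fun j : 'I_N => pa1 j))).
  have mI : cmeasurable (fun w => \prod_(i < N) phi s (A i w * xi) -
      \prod_(i < N) partial M.+1 s (A i w * xi)).
    by apply: cmeasurableB; apply: cmeasurable_prod => j; [exact: mph|exact: mpa].
  apply: normc_cint_le1 mI _ => w.
  apply: le_trans (normc_prodB_le (fun i => phi1 s _) (fun i => pa1 i w)) _.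
  apply: (@le_trans _ _ (\sum_(i < N) H)); first exact: ler_sum.
  by rewrite sumr_const card_ord mulr_natl.
have ab j w n : normc (c (A j w * xi) n) <= rbin al n by exact: cb.
have tr w := csum_truncated_prod (ltW al0) (fun j n => ab j w n) N
  (utime_ge0 b0 s0) (leqnSn M).
have tl w : normc (\prod_(j < N) csum (c (A j w * xi)) (u s) M.+1 -
    csum (fcoef (fun j m => c (A j w * xi) m) N) (u s) M) <= tail M s.
  apply: le_trans (tr w) _; rewrite /tail lerB// expRM_natl lerXn2r ?nnegrE ?expR_ge0//.
    exact: (psum_ge0 b0 _ (fun n => rbin_ge0 n (ltW al0)) s0).
  by have := rbin_psum_le b0 M.+1 (ltW al0) s0; rewrite alb mul1r.
have mT : cmeasurable (fun w => csum (fcoef (fun j m => c (A j w * xi) m) N) (u s) M).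
  by apply: cmeasurable_csum => n; exact: cmeasurable_fcoef_gen.
have bT : exists K, cbounded (fun w => csum (fcoef (fun j m => c (A j w * xi) m) N) (u s) M) K.
  exists (\sum_(n < M) u s ^+ n * rbin (N%:R * al) n) => w.
  apply: le_trans (normc_sum _ _ _) _; apply: ler_sum => n _.
  have un0 : 0 <= u s ^+ n by rewrite exprn_ge0// utime_ge0.
  rewrite ComplexField.Normc.normcM normc_real ger0_norm// ler_wpM2l//.
  by apply: normc_fcoef => j k; exact: cb.
have [K bTK] := bT.
have bI4 : cbounded (fun w => \prod_(i < N) csum (c (A i w * xi)) (u s) M.+1) (expR (N%:R * s)).
  move=> w; under eq_bigr do rewrite csE; rewrite normc_prod expRM_natl.
  rewrite -[X in _ <= _ ^+ X]card_ord -prodr_const; apply: ler_prod => i _.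
  rewrite normc_ge0 ComplexField.Normc.normcM normc_real ger0_norm ?expR_ge0//=.
  by rewrite -[leRHS]mulr1 ler_wpM2l ?expR_ge0.
rewrite -(cintB (cmeasurable_prod (fun j : 'I_N => mcs j)) mT bI4 bTK).
have mI : cmeasurable (fun w => \prod_(i < N) csum (c (A i w * xi)) (u s) M.+1 -
     csum (fcoef (fun j m => c (A j w * xi) m) N) (u s) M).
  by apply: cmeasurableB => //; apply: cmeasurable_prod => j; exact: mcs.
apply: le_trans (_ : 1 * tail M s <= _); last by rewrite mul1r.
rewrite ler_pM ?expR_ge0 ?normc_ge0//; last exact: normc_cint_le1 mI _.
by rewrite expR_le1 oppr_le0 mulr_ge0// ltW.
Qed.

End step.

(** Derivatives and limits are taken for the real and imaginary parts separately; the flag treats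
    both at once. *)
Definition part (k : bool) (z : R[i]) : R := if k then complex.Re z else complex.Im z.

Lemma partB k z w : part k (z - w) = part k z - part k w.
Proof. by case: k; rewrite /part raddfB. Qed.

Lemma partZ k (r : R) z : part k (r%:C%C * z) = r * part k z.
Proof. by case: k; rewrite /part ?re_mul ?im_mul/= mul0r ?subr0 ?addr0. Qed.

Lemma part_csum k f x M : part k (csum f x M) = \sum_(n < M) part k (f n) * x ^+ n.
Proof.
case: k; rewrite /part /csum ?re_sum ?im_sum; apply: eq_bigr => n _;
  by rewrite ?re_mul ?im_mul/= mul0r ?subr0 ?addr0 mulrC.
Qed.

Lemma part_le k z : `|part k z| <= normc z.
Proof. by case: k; [exact: Re_le_normc|exact: Im_le_normc]. Qed.

Lemma csum_rec xi s M : 0 <= s ->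
  csum (fun n => n.+1%:R * c xi n.+1) (u s) M =
  al%:C%C * cint P setT (fun w => csum (fcoef (fun j m => c (A j w * xi) m) N) (u s) M).
Proof.
move=> s0; have un0 n : 0 <= u s ^+ n by rewrite exprn_ge0// utime_ge0.
have mcA j n : cmeasurable (fun w => c (A j w * xi) n).
  by apply: (cmeasurable_comp _ (mc n)); exact: measurable_funM.
have mF n : cmeasurable (fun w => fcoef (fun j m => c (A j w * xi) m) N n).
  exact: cmeasurable_fcoef_gen.
have bF n : cbounded (fun w => fcoef (fun j m => c (A j w * xi) m) N n) (rbin (N%:R * al) n).
  by move=> w; apply: normc_fcoef => j k; exact: cb.
rewrite /csum cint_sum; last 2 first.
- by move=> n; apply: cmeasurableM => //; exact: cmeasurable_cst.
- move=> n; exists (u s ^+ n * rbin (N%:R * al) n) => w.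
  by rewrite ComplexField.Normc.normcM normc_real ger0_norm// ler_wpM2l//; exact: bF.
rewrite mulr_sumr; apply: eq_bigr => n _.
by rewrite crec (cintZl P _ (mF n) (bF n)) mulrCA.
Qed.

Section gronwall.
Variable phi : R -> R -> R[i].
Hypotheses (phis : cauchy_solution phi) (phi0 : forall xi, phi 0 xi = c xi 0%N).
Variables (M : nat) (t : R).
Hypothesis t0 : 0 <= t.

Let phi1 s x : normc (phi s x) <= 1. Proof. by case: phis => _ + _; exact. Qed.

(** Chosen so that [exp s * exp (lam s) = exp (4 N s)]: integrating [N H exp (4 N s)] then gains the
    factor [1/4]. *)
Let lam : R := 4 * N%:R - 1.
Let lam0 : 0 <= lam.
Proof.
by rewrite /lam Nb subr_ge0 mulrDr mulr1 ler_wpDr ?mulr_ge0 ?(ltW b0)// ler1n.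
Qed.

Lemma tail_ge0 s : 0 <= s -> 0 <= tail M s.
Proof.
by move=> s0; rewrite subr_ge0 -[in leRHS]Nalb; exact: rbin_psum_le.
Qed.

(** A bootstrap in place of an integral inequality: a bound uniform in [xi] improves to a quarter of
    itself on each part, up to the tail. Each [xi] is treated as a separate function of time, so no
    supremum over [xi] has to be differentiated. *)
Lemma gronwall_step k (H : R) :
  (forall s xi, 0 <= s <= t -> normc (phi s xi - partial M.+1 s xi) <= H * expR (lam * s)) ->
  forall s xi, 0 <= s <= t ->
  `|part k (phi s xi - partial M.+1 s xi)| <= (H / 4 + tail M t * t) * expR (lam * s).
Proof.
move=> hH s xi /andP[s0 st].
pose F (r : R) := cint P setT (fun w => \prod_(i < N) phi r (A i w * xi)).
pose G (r : R) := cint P setT (fun w =>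
  csum (fcoef (fun j m => c (A j w * xi) m) N) (u r) M).
(* The factor [exp r] removes the zeroth-order term of the equation; differentiating [M.+1] terms of
   the series leaves [M]. *)
pose f r := expR r * part k (phi r xi) - psum b (fun n => part k (c xi n)) M.+1 r.
pose df r := part k ((expR r)%:C%C * F r - (expR (- (b * r)))%:C%C * G r).
pose g r := H / 4 * expR (4 * N%:R * r) + tail M t * r.
pose dg r := H * N%:R * expR (4 * N%:R * r) + tail M t.
have H0 : 0 <= H.
  have := hH 0 0 _; rewrite lexx t0 mulr0 expR0 mulr1 => /(_ isT).
  by apply: le_trans; exact: normc_ge0.
have NN : 0 < N%:R :> R by rewrite Nb addr_gt0.
have N4 : 4 * N%:R != 0 :> R by rewrite mulf_neq0// gt_eqF.
have dphi (r : R) : 0 < r -> is_derive r 1 (fun s => part k (phi s xi))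
    (part k (F r - phi r xi)).
  move=> r0; have [_ _ /(_ xi)[_ [_ /(_ r r0)[d1 [d2 e]]]]] := phis.
  have -> : F r - phi r xi = (derive1 (fun s => complex.Re (phi s xi)) r +i*
       derive1 (fun s => complex.Im (phi s xi)) r)%C by rewrite /F -e addrK.
  by case: k {f df}; rewrite /part /= derive1E; exact: derivableP.
have fd (r : R) : 0 < r -> is_derive r 1 f (df r).
  move=> r0; have := is_deriveB (is_deriveM (is_derive_expR r) (dphi r r0))
    (is_derive_psum b (fun n => part k (c xi n)) M.+1 r).
  move=> /is_derive_eq; apply; rewrite /= /GRing.scale/= partB.
  have e : psum b (fun n => n.+1%:R * part k (c xi n.+1)) M r = al * part k (G r).
    rewrite /G -partZ -(csum_rec _ _ (ltW r0)) part_csum; apply: eq_bigr => n _.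
    congr (_ * _); rewrite -partZ; congr (part k (_ * _)).
    by rewrite rmorph_nat.
  rewrite e /df partB !partZ /utime subKr.
  have -> : b * expR (- (b * r)) * (al * part k (G r)) =
    al * b * expR (- (b * r)) * part k (G r) by ring.
  by rewrite alb; ring.
have gd (r : R) : is_derive r 1 g (dg r).
  have := is_deriveD (is_deriveZ (H / 4) (is_derive_expM (4 * N%:R) r))
    (is_deriveZ (tail M t) (is_derive_id r 1)).
  by move=> /is_derive_eq; apply; rewrite /dg /GRing.scale/=; field.
have cf : f r @[r --> (0 : R)^'+] --> f 0.
  apply: cvgB.
    apply: cvgM; first exact: is_derive_cvg0 (is_derive_expR 0).
    have [_ _ /(_ xi)[c1 [c2 _]]] := phis.
    by case: k {f df dphi fd} => /=.
  exact: is_derive_cvg0 (is_derive_psum b _ M.+1 0).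
have bnd (r : R) : 0 < r <= s -> `|df r| <= dg r.
  move=> /andP[r0 rs]; rewrite /df; apply: le_trans (part_le _ _) _.
  have r0' := ltW r0.
  apply: (le_trans (partial_rhs_le phis _ r0' (H := H * expR (lam * r)) _)).
    by move=> x; apply: hH; rewrite r0' (le_trans rs).
  rewrite /dg lerD//; last by apply: tail_le => //; exact: le_trans rs st.
  rewrite le_eqVlt; apply/orP; left; apply/eqP.
  have -> : expR (4 * N%:R * r) = expR r * expR (lam * r).
    by rewrite -expRD; congr expR; rewrite /lam; ring.
  by ring.
have := derive_norm_le s0 cf (is_derive_cvg0 (gd 0)) fd (fun r _ => gd r) bnd.
have f0 : f 0 = 0 by rewrite /f expR0 mul1r psum_at0 phi0 subrr.
rewrite f0 subr0 /g mulr0 expR0 mulr1 mulr0 addr0 => fs.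
have -> : part k (phi s xi - partial M.+1 s xi) = expR (- s) * f s.
  rewrite partB /partial partZ part_csum /f mulrBr mulrA -expRD addNr expR0 mul1r.
  by [].
rewrite normrM ger0_norm ?expR_ge0//.
have : `|f s| <= H / 4 * expR (4 * N%:R * s) + tail M t * s.
  by apply: le_trans fs _; rewrite lerBlDr lerDl divr_ge0.
move=> {}fs; apply: (le_trans (ler_wpM2l (expR_ge0 _) fs)).
rewrite [leLHS]mulrDr [leRHS]mulrDl; apply: lerD.
  rewrite mulrCA -expRD le_eqVlt; apply/orP; left; apply/eqP.
  by congr (_ * expR _); rewrite /lam; ring.
rewrite mulrC -!mulrA ler_wpM2l ?tail_ge0// ler_pM ?expR_ge0//.
by rewrite ler_expR; apply: (@le_trans _ _ 0); rewrite ?oppr_le0// mulr_ge0// lam0.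
Qed.

(** From the trivial bound 2. Adding the two parts turns [H] into [H / 2 + 2 tail t]: the initial
    error is halved at each step, and [4 tail t] is the fixed point of this map. *)
Lemma gronwall n s xi : 0 <= s <= t ->
  normc (phi s xi - partial M.+1 s xi) <=
  (2 * 2^-1 ^+ n + 4 * tail M t * t) * expR (lam * s).
Proof.
have tt0 : 0 <= tail M t * t by rewrite mulr_ge0// tail_ge0.
elim: n s xi => [|n IH] s xi st.
  have /andP[s0 _] := st.
  apply: (@le_trans _ _ 2).
    apply: le_trans (le_normcD _ _) _; rewrite normcN.
    have := phi1 s xi; have := normc_partial_le M.+1 xi s0; lra.
  rewrite expr0 mulr1 -[leLHS]mulr1 ler_pM//; first by rewrite -mulrA; lra.
  by rewrite -expR0 ler_expR mulr_ge0// lam0.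
have h k := gronwall_step k IH xi st.
apply: le_trans (normc_le_ReIm _) _.
have h1 := h true; have h2 := h false; rewrite /part in h1 h2.
apply: le_trans (lerD h1 h2) _; rewrite -mulrDl ler_wpM2r ?expR_ge0// exprS.
by rewrite le_eqVlt; apply/orP; left; apply/eqP; field.
Qed.

Lemma gronwall_limit xi :
  normc (phi t xi - partial M.+1 t xi) <= 4 * tail M t * t * expR (lam * t).
Proof.
have h n : normc (phi t xi - partial M.+1 t xi) <=
  (2 * 2^-1 ^+ n + 4 * tail M t * t) * expR (lam * t).
  by apply: gronwall; rewrite t0 lexx.
have h2 : (2 * 2^-1 ^+ n + 4 * tail M t * t) * expR (lam * t) @[n --> \oo] -->
    4 * tail M t * t * expR (lam * t).
  have -> : 4 * tail M t * t * expR (lam * t) = (0 + 4 * tail M t * t) * expR (lam * t).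
    by rewrite add0r.
  apply: cvgMl.
  apply: cvgD; last exact: cvg_cst.
  rewrite -(mulr0 2); apply: cvgMr; apply: cvg_expr.
  by rewrite ger0_norm ?invr_ge0// invf_lt1// ltr1n.
have h3 : normc (phi t xi - partial M.+1 t xi) @[n --> \oo] -->
    normc (phi t xi - partial M.+1 t xi) by exact: cvg_cst.
by apply: (ler_cvg_to h3 h2); exact: nearW.
Qed.

End gronwall.

Theorem cauchy_solution_series phi : cauchy_solution phi ->
  (forall xi, phi 0 xi = c xi 0%N) ->
  forall k (t xi : R), 0 <= t -> part k (partial M t xi) @[M --> \oo] --> part k (phi t xi).
Proof.
move=> phis phi0 k t xi t0; rewrite -cvg_shiftS.
apply/subr_cvg0/norm_cvg0P.
pose C := 4 * t * expR ((4 * N%:R - 1) * t).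
apply: (@squeeze_cvgr _ _ _ _ (cst 0) (fun M => C * tail M t)).
- apply: nearW => M; rewrite normr_ge0/= -partB -normrN.
  rewrite -[- part k _]add0r; have -> : 0 - part k (partial M.+1 t xi - phi t xi) =
    part k (phi t xi - partial M.+1 t xi) by rewrite !partB; ring.
  apply: le_trans (part_le _ _) _; apply: (le_trans (gronwall_limit phis phi0 M t0 xi)).
  by rewrite /C le_eqVlt; apply/orP; left; apply/eqP; ring.
- exact: cvg_cst.
- by rewrite -(mulr0 C); apply: cvgMr; exact: tail_cvg.
Qed.

End cauchy_uniqueness.

(** * Uniqueness of characteristic functions *)

Section dominated_Rintegral.
Context d (T : measurableType d) (R : realType) (m : {measure set T -> \bar R}).

Lemma cvg_Rintegral_dominated (f_ : nat -> T -> R) (f g : T -> R) :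
  (forall n, measurable_fun setT (f_ n)) -> measurable_fun setT f ->
  (forall x, f_ n x @[n --> \oo] --> f x) ->
  m.-integrable setT (EFin \o g) -> (forall n x, `|f_ n x| <= g x) ->
  Rintegral m setT (f_ n) @[n --> \oo] --> Rintegral m setT f.
Proof.
move=> mf_ mf ff ig fg.
have mf_' n : measurable_fun setT (EFin \o f_ n) by exact/measurable_EFinP.
have mf' : measurable_fun setT (EFin \o f) by exact/measurable_EFinP.
have ae1 : {ae m, forall x, setT x -> (EFin \o f_ n) x @[n --> \oo] --> (EFin \o f) x}.
  by apply: aeW => x _; apply: cvg_EFin; [exact: nearW|exact: ff].
have ae2 : {ae m, forall x n, setT x -> (`|(EFin \o f_ n) x| <= (EFin \o g) x)%E}.
  by apply: aeW => x n _; rewrite /= lee_fin.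
have [intf _ h] := dominated_convergence measurableT mf_' mf' ae1 ig ae2.
apply: fine_cvg; rewrite /Rintegral fineK//.
exact: integrable_fin_num.
Qed.

End dominated_Rintegral.

Section poisson_kernel.
Context {R : realType}.
Local Notation leb := (@lebesgue_measure R).

(** The kernel [e / (e^2 + y^2)] is the Laplace transform of the cosine. The added 1 makes the
    integrand nonnegative, so that integrals are exchanged by Tonelli's theorem; it contributes
    [1 / e]. *)
Lemma integral_expN_cos (e y : R) : 0 < e ->
  (\int[leb]_(x in `[0%R, +oo[) (expR (- (e * x)) * (1 + cos (x * y)))%:E =
   (e^-1 + e / (e ^+ 2 + y ^+ 2))%:E)%E.
Proof.
move=> e0; set q := e ^+ 2 + y ^+ 2.
have q0 : q != 0 by rewrite gt_eqF// ltr_pwDl ?sqr_ge0// exprn_gt0.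
have en0 : e != 0 by rewrite gt_eqF.
pose B (x : R) := (y * sin (x * y) - e * cos (x * y)) / q - e^-1.
pose F (x : R) := expR (- e * x) * B x.
pose f (x : R) := expR (- (e * x)) * (1 + cos (x * y)).
have dB (x : R) : is_derive x 1 B ((y ^+ 2 * cos (x * y) + e * y * sin (x * y)) / q).
  by rewrite /B; apply: is_derive_eq; rewrite /GRing.scale/=; field.
have dF (x : R) : is_derive x 1 F (f x).
  have := is_deriveM (is_derive_expM (- e) x) (dB x).
  move=> /is_derive_eq; apply; rewrite /f /B /GRing.scale/= mulNr.
  have -> : y ^+ 2 = q - e ^+ 2 by rewrite /q; ring.
  by field; rewrite en0 q0.
have cF : continuous F.
  by move=> x; apply/differentiable_continuous/derivable1_diffP; case: (dF x).
have cf : continuous f.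
  move=> x; apply: cvgM; first by apply: continuous_comp; [apply: continuousN; apply: mulrl_continuous|exact: continuous_expR].
  apply: cvgD; first exact: cvg_cst.
  by apply: continuous_comp; [exact: mulrr_continuous|exact: continuous_cos].
rewrite (@ge0_continuous_FTC2y _ f F 0 0).
- by rewrite /F /B mulr0 expR0 mul0r sin0 cos0 -EFinB; congr EFin; field; rewrite en0 q0.
- move=> x x0; rewrite /f mulr_ge0 ?expR_ge0// -lerBlDl sub0r cos_geN1.
- exact: continuous_subspaceT.
- have eB : exists K, forall x, `|B x| <= K.
    exists ((`|y| + `|e|) / `|q| + `|e^-1|) => x.
    rewrite /B; apply: le_trans (ler_normB _ _) _; rewrite lerD// normrM normfV.
    rewrite ler_wpM2r// (le_trans (ler_normB _ _))// !normrM lerD//.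
      by rewrite -[leRHS]mulr1 ler_wpM2l// ler_norml sin_le1 sin_geN1.
    by rewrite -[leRHS]mulr1 ler_wpM2l// ler_norml cos_le1 cos_geN1.
  have [K hK] := eB.
  have cE : K * expR (- (e * x)) @[x --> +oo] --> (0 : R).
    rewrite -(mulr0 K); apply: cvgMr.
    have ey : e * x @[x --> +oo] --> +oo by exact: gt0_cvgMry.
    exact: (cvg_comp _ _ ey (@cvgr_expR R)).
  apply/norm_cvg0P; apply: (squeeze_cvgr _ (cvg_cst 0) cE).
  apply: nearW => x /=; rewrite normr_ge0/= /F normrM ger0_norm ?expR_ge0//.
  by rewrite mulNr mulrC ler_wpM2r ?expR_ge0.
- by move=> x _; case: (dF x).
- exact/cvg_at_right_filter/cF.
- by move=> x _; rewrite derive1E; exact: derive_val.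
Qed.

(** As [e] tends to 0 the difference of arctangents approaches [pi] times the indicator of the
    interval, away from its end points. *)
Lemma integral_poisson_itv (e c d x : R) : 0 < e -> c < d ->
  (\int[leb]_(a in `[c, d]) (e^-1 + e / (e ^+ 2 + (x - a) ^+ 2))%:E =
   ((d - c) / e + atan ((d - x) / e) - atan ((c - x) / e))%:E)%E.
Proof.
move=> e0 cd.
pose f (a : R) := e^-1 + e / (e ^+ 2 + (x - a) ^+ 2).
pose F (a : R) := e^-1 * a + atan ((a - x) / e).
have q0 a : e ^+ 2 + (x - a) ^+ 2 != 0.
  by rewrite gt_eqF// ltr_pwDl ?sqr_ge0// exprn_gt0.
have dF (a : R) : is_derive a 1 F (f a).
  have en0 : e != 0 by rewrite gt_eqF.
  have h1 : is_derive a 1 (fun a => (a - x) / e) e^-1.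
    by apply: is_derive_eq; rewrite /GRing.scale/=; ring.
  have h2 : is_derive a 1 (fun a => e^-1 * a) e^-1.
    by apply: is_derive_eq; rewrite /GRing.scale/=; ring.
  have := is_deriveD h2 (@is_derive1_comp R atan (fun a => (a - x) / e) a _ _ (is_derive1_atan _) h1).
  move=> /is_derive_eq; apply; rewrite /f; congr (_ + _).
  have q1 : 1 + ((a - x) / e) ^+ 2 != 0.
    by rewrite gt_eqF// ltr_wpDr ?sqr_ge0.
  have -> : e ^+ 2 + (x - a) ^+ 2 = e ^+ 2 * (1 + ((a - x) / e) ^+ 2).
    by field.
  by set z := 1 + _ in q1 *; field; rewrite en0 q1.
have cF : continuous F.
  by move=> a; apply/differentiable_continuous/derivable1_diffP; case: (dF a).
have cf : continuous f.
  move=> a; apply: cvgD; first exact: cvg_cst.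
  apply: cvgM; first exact: cvg_cst.
  apply: cvgV => //; apply: cvgD; first exact: cvg_cst.
  apply: (@continuous_comp _ _ _ (fun a => x - a) (fun z => z ^+ 2)); last exact: exprn_continuous.
  by apply: cvgB; [exact: cvg_cst|exact: cvg_id].
rewrite (@continuous_FTC2 _ f F)//.
- by rewrite /F -EFinB; congr EFin; lra.
- exact: continuous_subspaceT.
- split.
  + by move=> a _; case: (dF a).
  + exact/cvg_at_right_filter/cF.
  + exact/cvg_at_left_filter/cF.
- by move=> a _; rewrite derive1E; exact: derive_val.
Qed.

Lemma integral_indic_mul (D : set R) (g : R -> R) :
  (\int[leb]_(x in D) (g x)%:E = \int[leb]_x (g x * \1_D x)%:E)%E.
Proof.
rewrite integral_mkcond; apply: eq_integral => x _.
by rewrite patchE indicE; case: ifPn => _; rewrite ?mulr1 ?mulr0.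
Qed.

Lemma swap_integral_indic (m : probability R R) (D : set R) (h : R -> R -> R) :
  measurable D -> measurable_fun setT (fun p : R * R => h p.1 p.2) ->
  (forall x y, 0 <= h x y) ->
  (\int[m]_x \int[leb]_(y in D) (h x y)%:E = \int[leb]_(y in D) \int[m]_x (h x y)%:E)%E.
Proof.
move=> mD mh h0.
pose H (p : R * R) := (h p.1 p.2 * \1_D p.2)%:E.
have mH : measurable_fun setT H.
  apply/measurable_EFinP; apply: measurable_funM => //.
  exact: (measurableT_comp (measurable_indic mD) measurable_snd).
have H0 p : (0 <= H p)%E by rewrite lee_fin mulr_ge0.
have := @fubini_tonelli _ _ _ _ _ m leb H mH H0; rewrite /fubini_F /fubini_G => e.
transitivity (\int[m]_x \int[leb]_y H (x, y))%E.
  by apply: eq_integral => x _; rewrite integral_indic_mul.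
rewrite e [RHS]integral_mkcond; apply: eq_integral => y _.
rewrite patchE; case: ifPn => yD.
  by apply: eq_integral => x _; rewrite /H /= indicE yD mulr1.
under eq_integral do rewrite /H /= indicE (negbTE yD) mulr0.
by rewrite integral0.
Qed.

Lemma Rintegral_prob_addl (m : probability R R) (k : R) (f : R -> R) M :
  measurable_fun setT f -> (forall x, `|f x| <= M) ->
  Rintegral m setT (fun x => k + f x) = k + Rintegral m setT f.
Proof.
move=> mf fM; rewrite RintegralD//.
- rewrite (Rintegral_cst m measurableT k) (_ : fine (m setT) = 1) ?mulr1//.
  exact: (congr1 fine (probability_setT m)).
- exact: (@bounded_integrable _ _ _ m (cst k) `|k|).
- exact: bounded_integrable mf fM.
Qed.

Lemma measurable_sin : measurable_fun [set: R] sin.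
Proof. by apply: continuous_measurable_fun; exact: continuous_sin. Qed.

Lemma measurable_cos : measurable_fun [set: R] cos.
Proof. by apply: continuous_measurable_fun; exact: continuous_cos. Qed.

Lemma measurable_atan : measurable_fun [set: R] atan.
Proof. by apply: continuous_measurable_fun => x; exact: continuous_atan. Qed.

Lemma Rintegral_cos_shift (m : probability R R) (xi a : R) :
  Rintegral m setT (fun x => 1 + cos (xi * (x - a))) =
  1 + (cos (xi * a) * complex.Re (charfun m xi) + sin (xi * a) * complex.Im (charfun m xi)).
Proof.
have mc : measurable_fun setT (fun x : R => cos (xi * x)).
  by apply: measurableT_comp measurable_cos _; exact: measurable_funM.
have ms : measurable_fun setT (fun x : R => sin (xi * x)).
  by apply: measurableT_comp measurable_sin _; exact: measurable_funM.
have c1 (x : R) : `|cos x| <= 1 by rewrite ler_norml cos_geN1 cos_le1.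
have s1 (x : R) : `|sin x| <= 1 by rewrite ler_norml sin_geN1 sin_le1.
have ic k : m.-integrable setT (EFin \o (fun x : R => k * cos (xi * x))).
  apply: (@bounded_integrable _ _ _ m _ `|k|); first exact: measurable_funM.
  by move=> x; rewrite normrM -[leRHS]mulr1 ler_wpM2l.
have is_ k : m.-integrable setT (EFin \o (fun x : R => k * sin (xi * x))).
  apply: (@bounded_integrable _ _ _ m _ `|k|); first exact: measurable_funM.
  by move=> x; rewrite normrM -[leRHS]mulr1 ler_wpM2l.
rewrite (@Rintegral_prob_addl _ _ _ 1)//; last first.
  apply: measurableT_comp measurable_cos _; apply: measurable_funM => //.
  exact: measurable_funB.
congr (_ + _).
rewrite -RintegralZl//; last by apply: bounded_integrable mc (fun x => c1 _).
rewrite -RintegralZl//; last by apply: bounded_integrable ms (fun x => s1 _).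
rewrite -RintegralD//; apply: eq_Rintegral => x _.
by rewrite /= mulrBr cosB; ring.
Qed.

Lemma measurable_poisson (e : R) :
  measurable_fun setT (fun p : R * R => e^-1 + e / (e ^+ 2 + (p.1 - p.2) ^+ 2)).
Proof.
apply: measurable_funD => //; apply: measurable_funM => //.
have mi : measurable_fun setT (fun x : R => x ^+ 2) by exact: measurable_funX.
have md : measurable_fun setT (fun p : R * R => e ^+ 2 + (p.1 - p.2) ^+ 2).
  apply: measurable_funD => //; apply: measurable_funX.
  by apply: measurable_funB; [exact: measurable_fst|exact: measurable_snd].
under eq_fun => p do rewrite -powR_inv1 ?addr_ge0 ?sqr_ge0//.
exact: (measurableT_comp (measurable_powR (-1)) md).
Qed.

(** The right-hand side sees [m] through its characteristic function alone. *)
Lemma integral_poisson_charfun (m : probability R R) (e a : R) : 0 < e ->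
  (\int[m]_x (e^-1 + e / (e ^+ 2 + (x - a) ^+ 2))%:E =
   \int[leb]_(xi in `[0%R, +oo[) (expR (- (e * xi)) *
     (1 + (cos (xi * a) * complex.Re (charfun m xi) +
           sin (xi * a) * complex.Im (charfun m xi))))%:E)%E.
Proof.
move=> e0.
under eq_integral do rewrite -integral_expN_cos//.
have me : measurable_fun setT (fun p : R * R => expR (- (e * p.2))).
  apply: (measurableT_comp (@measurable_expR R)); apply: measurableT_comp => //.
  by apply: measurable_funM => //; exact: measurable_snd.
have mc : measurable_fun setT (fun p : R * R => 1 + cos (p.2 * (p.1 - a))).
  apply: measurable_funD => //; apply: measurableT_comp measurable_cos _.
  apply: measurable_funM; first exact: measurable_snd.
  by apply: measurable_funB => //; exact: measurable_fst.
rewrite (@swap_integral_indic m _ (fun x xi => expR (- (e * xi)) * (1 + cos (xi * (x - a)))))//.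
- apply: eq_integral => xi _.
  have mcx : measurable_fun setT (fun x : R => 1 + cos (xi * (x - a))).
    exact: (measurableT_comp mc (pair2_measurable xi)).
  have c1 (x : R) : `|cos x| <= 1 by rewrite ler_norml cos_geN1 cos_le1.
  have ic : m.-integrable setT (EFin \o (fun x : R => 1 + cos (xi * (x - a)))).
    apply: (@bounded_integrable _ _ _ m _ 2) => // x.
    by rewrite (le_trans (ler_normD _ _))// normr1 lerD.
  rewrite -Rintegral_cos_shift -RintegralZl//; rewrite /Rintegral fineK//.
  by apply: integrable_fin_num => //; under eq_fun do rewrite /= EFinM; exact: integrableZl.
- exact: measurable_funM.
Qed.

(** The previous identity integrated over [a] in [[c, d]]; the constant [(d - c) / e], due to the
    summand [1 / e] of the kernel, cancels. *)
Lemma charfun_eq_atan (m1 m2 : probability R R) (c d e : R) :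
  (forall xi, charfun m1 xi = charfun m2 xi) -> 0 < e -> c < d ->
  Rintegral m1 setT (fun x => atan ((d - x) / e) - atan ((c - x) / e)) =
  Rintegral m2 setT (fun x => atan ((d - x) / e) - atan ((c - x) / e)).
Proof.
move=> m12 e0 cd.
have ma k : measurable_fun setT (fun x : R => atan ((k - x) / e)).
  apply: measurableT_comp measurable_atan _; apply: measurable_funM => //.
  exact: measurable_funB.
have a1 (x : R) : `|atan x| <= pi / 2.
  by rewrite ler_norml ltW ?atan_gtNpi2// ltW// atan_ltpi2.
apply: (addrI ((d - c) / e)).
rewrite -!(@Rintegral_prob_addl _ _ _ (pi / 2 + pi / 2)) ?[LHS]/Rintegral; last 4 first.
- exact: measurable_funB.
- by move=> x; rewrite (le_trans (ler_normB _ _))// lerD.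
- exact: measurable_funB.
- by move=> x; rewrite (le_trans (ler_normB _ _))// lerD.
rewrite /Rintegral; congr fine.
have E (m : probability R R) : (\int[m]_x ((d - c) / e + (atan ((d - x) / e) - atan ((c - x) / e)))%:E
   = \int[leb]_(a in `[c, d]) \int[m]_x (e^-1 + e / (e ^+ 2 + (x - a) ^+ 2))%:E)%E.
  under eq_integral do rewrite addrA -integral_poisson_itv//.
  rewrite (@swap_integral_indic m _ (fun x a => e^-1 + e / (e ^+ 2 + (x - a) ^+ 2)))//.
    exact: measurable_poisson.
  by move=> x a; rewrite addr_ge0 ?invr_ge0 ?divr_ge0 ?addr_ge0 ?sqr_ge0// ltW.
rewrite !E; apply: eq_integral => a _; rewrite !integral_poisson_charfun//.
by under eq_integral do rewrite m12.
Qed.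

End poisson_kernel.

Section levy_uniqueness.
Context {R : realType}.

Lemma cvg_atan_ge (z : nat -> R) : (\forall n \near \oo, n%:R <= z n) ->
  atan (z n) @[n --> \oo] --> (pi / 2 : R).
Proof.
move=> hz.
have zy : z n @[n --> \oo] --> +oo by exact: ger_cvgy hz (@cvgr_idn R).
exact: (cvg_comp _ _ zy (@cvgy_atan R)).
Qed.

Lemma cvg_atan_le (z : nat -> R) : (\forall n \near \oo, n%:R <= - z n) ->
  atan (z n) @[n --> \oo] --> (- (pi / 2) : R).
Proof.
move=> /cvg_atan_ge /cvgN h.
by under eq_fun => n do rewrite -[z n]opprK atanN.
Qed.

Lemma prob_eq_halflines (m1 m2 : probability R R) :
  (forall d, m1 `]-oo, d]%classic = m2 `]-oo, d]%classic) ->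
  forall B, measurable B -> m1 B = m2 B.
Proof.
move=> h.
have hI (m : probability R R) a b : a <= b ->
    m `]a, b]%classic = (m `]-oo, b]%classic - m `]-oo, a]%classic)%E.
  move=> ab; have -> : `]-oo, b]%classic = `]-oo, a]%classic `|` `]a, b]%classic :> set R.
    by rewrite -itv_bndbnd_setU.
  rewrite measureU//; first by rewrite addeAC subee ?add0e// fin_num_measure.
  by apply/seteqP; split => // x [/=]; rewrite !in_itv/= => xa /andP[ax _]; lra.
move=> B mB; apply: (@measure_unique _ _ _ (@ocitv R : set (set R)) (fun n => `]- n%:R, n%:R]%classic) _ _ _ _ m1 m2 _ _ B mB) => //.
- exact: ocitvI.
- by move=> i; exact: is_ocitv.
- apply/seteqP; split => // x _.
  exists (Num.truncn `|x|).+1 => //=.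
  have := truncnS_gt `|x|; rewrite in_itv/= ltr_norml => /andP[-> /ltW ->]//.
- move=> A /ocitvP[->|[[a b] /= ab ->]]; first by rewrite !measure0.
  by rewrite !hI ?ltW// !h.
- by move=> k; rewrite ltey_eq fin_num_measure.
Qed.

(** With [k = n.+1], the width is [k^-2] and the interval [[d - k, d + 1/k]]. The margin [1/k] is
    large compared with the width, so the point [x = d] is counted in full, yet it ends up below
    [x - d] for every [x > d]. *)
Lemma charfun_halfline (m : probability R R) d :
  Rintegral m setT (fun x : R => atan ((d + n.+1%:R^-1 - x) / (n.+1%:R ^+ 2)^-1) -
      atan ((d - n.+1%:R - x) / (n.+1%:R ^+ 2)^-1)) @[n --> \oo] -->
  pi * fine (m `]-oo, d]%classic).
Proof.
have ma k e : measurable_fun setT (fun x : R => atan ((k - x) / e)).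
  apply: measurableT_comp measurable_atan _; apply: measurable_funM => //.
  exact: measurable_funB.
have a1 (x : R) : `|atan x| <= pi / 2.
  by rewrite ler_norml ltW ?atan_gtNpi2// ltW// atan_ltpi2.
have mI : measurable (`]-oo, d]%classic : set R) by exact: measurable_itv.
have -> : pi * fine (m `]-oo, d]%classic) =
    Rintegral m setT (fun x : R => pi * \1_(`]-oo, d]%classic) x).
  rewrite RintegralZl//; last first.
    by apply: (@bounded_integrable _ _ _ m _ 1) => // x; rewrite indicE; case: (_ \in _); rewrite ?normr1 ?normr0.
  by rewrite /Rintegral integral_indic// setIT.
apply: (@cvg_Rintegral_dominated _ _ _ m _ _ (cst (pi : R))).
- by move=> n; exact: measurable_funB.
- by apply: measurable_funM => //; exact: measurable_indic.
- move=> x.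
  have n0 (n : nat) : (n.+1%:R ^+ 2 : R) * n.+1%:R^-1 = n.+1%:R.
    by rewrite expr2 -mulrA divff ?mulr1// pnatr_eq0.
  have low : atan ((d - n.+1%:R - x) / (n.+1%:R ^+ 2)^-1) @[n --> \oo] --> (- (pi / 2) : R).
    apply: cvg_atan_le; near=> n.
    have nx : `|d - x| <= n%:R by near: n; exact: nbhs_infty_ger.
    rewrite invrK -mulNr; have h1 : 1 <= - (d - n.+1%:R - x).
      by move: nx; rewrite -natr1 ler_norml => /andP[_ ?]; lra.
    rewrite (@le_trans _ _ (1 * n.+1%:R ^+ 2))//; last by rewrite ler_wpM2r ?exprn_ge0.
    by rewrite mul1r -natrX ler_nat (leq_trans (leqnSn n))// expnS leq_pmulr.
  have -> : pi * \1_(`]-oo, d]%classic) x = (if x <= d then pi / 2 else - (pi / 2)) - - (pi / 2) :> R.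
    by rewrite indicE mem_setE in_itv/=; case: ifP => _; rewrite ?mulr1 ?mulr0; lra.
  apply: cvgB => //; case: ifPn => [xd|]; last rewrite -ltNge => dx.
    apply: cvg_atan_ge; apply: nearW => n; rewrite invrK.
    rewrite [d + _ - x]addrAC mulrDl [_^-1 * _]mulrC n0.
    rewrite (@le_trans _ _ n.+1%:R) ?ler_nat// lerDr mulr_ge0 ?subr_ge0//.
  apply: cvg_atan_le; near=> n.
  (* Then [(x - d) k >= 2] with [k = n.+1], so that the argument [k - (x - d) k^2] is at most
     [- k]. *)
  have nx : 2 / (x - d) <= n%:R by near: n; exact: nbhs_infty_ger.
  have xd : 0 < x - d by rewrite subr_gt0.
  move: nx; rewrite ler_pdivrMr// => nx.
  rewrite invrK [d + _ - x]addrAC mulrDl [_^-1 * _]mulrC n0 expr2 mulrA -[X in _ * _ + X]mul1r.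
  rewrite -mulrDl -mulNr (@le_trans _ _ (1 * n.+1%:R)) ?mul1r ?ler_nat//.
  rewrite -[leLHS]mul1r ler_wpM2r// -natr1; nra.
- exact: (@bounded_integrable _ _ _ m (cst pi) `|pi|).
- move=> n x; rewrite (le_trans (ler_normB _ _))// [leRHS](_ : _ = pi / 2 + pi / 2 :> R) ?lerD//=.
  by lra.
Unshelve. all: by end_near. Qed.

Theorem charfun_inj (m1 m2 : probability R R) :
  (forall xi, charfun m1 xi = charfun m2 xi) ->
  forall B, measurable B -> m1 B = m2 B.
Proof.
move=> m12; apply: prob_eq_halflines => d.
have h1 := @charfun_halfline m1 d; have h2 := @charfun_halfline m2 d.
have e n : Rintegral m1 setT (fun x : R => atan ((d + n.+1%:R^-1 - x) / (n.+1%:R ^+ 2)^-1) -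
      atan ((d - n.+1%:R - x) / (n.+1%:R ^+ 2)^-1)) =
    Rintegral m2 setT (fun x : R => atan ((d + n.+1%:R^-1 - x) / (n.+1%:R ^+ 2)^-1) -
      atan ((d - n.+1%:R - x) / (n.+1%:R ^+ 2)^-1)).
  apply: charfun_eq_atan => //.
  by rewrite ltrD2l (@lt_trans _ _ 0) ?oppr_lt0 ?invr_gt0.
move: h1; under eq_fun do rewrite e; move=> h1.
have pi0 : (pi : R) != 0 by rewrite gt_eqF// pi_gt0.
have E := mulfI pi0 (cvg_unique (@Rhausdorff R) h1 h2).
rewrite -[LHS]fineK ?fin_num_measure// -[RHS]fineK ?fin_num_measure//.
by rewrite E.
Qed.

End levy_uniqueness.

(** * The stable mixture *)

Lemma cexpRI_add {R : realType} (a b c d : R) :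
  cexpRI (a + c) (b + d) = cexpRI a b * cexpRI c d.
Proof.
apply: complex_eq; rewrite ?re_mul ?im_mul /= expRD ?cosD ?sinD; ring.
Qed.

Lemma normc_cexpRI {R : realType} (a b : R) : normc (cexpRI a b) = expR a.
Proof.
rewrite /normc /cexpRI !exprMn -mulrDr cos2Dsin2 mulr1 sqrtr_sqr.
by rewrite ger0_norm// expR_ge0.
Qed.

Lemma cmeasurable_cexpRI d (T : measurableType d) (R : realType) (f g : T -> R) :
  measurable_fun setT f -> measurable_fun setT g ->
  cmeasurable (fun x => cexpRI (f x) (g x)).
Proof.
move=> mf mg; have me : measurable_fun setT (fun x => expR (f x)).
  exact: measurableT_comp (@measurable_expR R) mf.
split; apply: measurable_funM => //.
- exact: measurableT_comp measurable_cos mg.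
- exact: measurableT_comp measurable_sin mg.
Qed.

Section probability_packing.
Context d (T : measurableType d) (R : realType).
Variables (m : {measure set T -> \bar R}) (h : m setT = 1%E).
Definition probability_copy : set T -> \bar R := m.
HB.instance Definition _ := Measure.on probability_copy.
HB.instance Definition _ := Measure_isProbability.Build _ _ _ probability_copy h.
Definition mkprob : probability T R := probability_copy.
End probability_packing.

Section laplace.
Context {R : realType} (zeta : probability R R).
Hypothesis zeta_nneg : zeta `[0, +oo[%classic = 1%E.

(* Laplace-Fourier transform of [zeta] at [p - i q], [p >= 0]; the absolute
   values make it total and bounded. *)
Definition laplace (p q : R) : R[i] :=
  cint zeta setT (fun z => cexpRI (- (`|p| * `|z|)) (q * `|z|)).

Lemma laplace_integrand (p q : R) : cmeasurable (fun z : R => cexpRI (- (`|p| * `|z|)) (q * `|z|)).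
Proof.
have mn : measurable_fun [set: R] (fun z : R => `|z|) by exact: measurableT_comp.
apply: cmeasurable_cexpRI; last exact: measurable_funM.
by apply: measurableT_comp => //; exact: measurable_funM.
Qed.

Lemma laplace_integrand_le1 (p q : R) : cbounded (fun z : R => cexpRI (- (`|p| * `|z|)) (q * `|z|)) 1.
Proof. by move=> z; rewrite normc_cexpRI expR_le1 oppr_le0 mulr_ge0. Qed.

Lemma cint_nneg (f h : R -> R[i]) M : cmeasurable f -> cbounded f M ->
  (forall z, 0 <= z -> f z = h z) ->
  cint zeta setT f = cint zeta `[0, +oo[%classic h.
Proof.
move=> mf fM fh.
have mI : measurable (`[0, +oo[%classic : set R) by exact: measurable_itv.
have E (k : R -> R) (k' : R -> R) : zeta.-integrable setT (EFin \o k) ->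
    (forall z, 0 <= z -> k z = k' z) ->
    Rintegral zeta setT k = Rintegral zeta `[0, +oo[%classic k'.
  move=> ik kk'; rewrite /Rintegral.
  rewrite (@negligible_integral _ _ _ zeta setT (~` `[0, +oo[%classic)) //; last 2 first.
  - exact: measurableC.
  - have /= -> := @probability_setC _ _ _ zeta _ mI.
    by rewrite [X in (_ - X)%E]zeta_nneg subee.
  rewrite setDE setCK setTI; congr fine; apply: eq_integral => z.
  by rewrite mem_setE in_itv/= andbT => z0; rewrite kk'.
congr (_ +i* _)%C; apply: E.
- exact: Re_integrable mf fM.
- by move=> z z0; rewrite fh.
- exact: Im_integrable mf fM.
- by move=> z z0; rewrite fh.
Qed.

Lemma charfun_integrand xi : cmeasurable (fun x : R => (cos (xi * x) +i* sin (xi * x))%C).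
Proof.
split => /=.
- by apply: measurableT_comp measurable_cos _; exact: measurable_funM.
- by apply: measurableT_comp measurable_sin _; exact: measurable_funM.
Qed.

Lemma charfun_laplace xi : charfun zeta xi = laplace 0 xi.
Proof.
rewrite /charfun (@cint_nneg _ (fun z => cexpRI 0 (xi * z)) 1).
- apply/esym; apply: (cint_nneg (laplace_integrand 0 xi) (@laplace_integrand_le1 0 xi)) => z z0.
  by rewrite normr0 mul0r oppr0 (ger0_norm z0).
- exact: charfun_integrand.
- by move=> x; rewrite normc_cos_sin.
- by move=> z _; rewrite /cexpRI expR0 !mul1r.
Qed.

Lemma normc_laplace_le1 p q : normc (laplace p q) <= 1.
Proof.
by apply: normc_cint_le1; [exact: laplace_integrand|exact: laplace_integrand_le1].
Qed.

Lemma cvg_laplace k (p_ q_ : nat -> R) (p q : R) : p_ n @[n --> \oo] --> p ->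
  q_ n @[n --> \oo] --> q ->
  part k (laplace (p_ n) (q_ n)) @[n --> \oo] --> part k (laplace p q).
Proof.
move=> hp hq.
have E (p' q' : R) : part k (laplace p' q') =
    Rintegral zeta setT (fun z => part k (cexpRI (- (`|p'| * `|z|)) (q' * `|z|))).
  by case: k.
rewrite E; under eq_fun do rewrite E.
have mpart (p' q' : R) : measurable_fun setT
    (fun z : R => part k (cexpRI (- (`|p'| * `|z|)) (q' * `|z|))).
  by have [] := laplace_integrand p' q'; case: k {E}.
apply: (@cvg_Rintegral_dominated _ _ _ zeta _ _ (cst 1)) => //.
- move=> z.
  have h1 : expR (- (`|p_ n| * `|z|)) @[n --> \oo] --> expR (- (`|p| * `|z|)).
    apply: (@cvg_comp _ _ _ _ expR _ _ _ _ (@continuous_expR R _)).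
    by apply: cvgN; apply: cvgMl; exact: cvg_norm.
  have h2 : q_ n * `|z| @[n --> \oo] --> q * `|z| by exact: cvgMl.
  have h3 : cos (q_ n * `|z|) @[n --> \oo] --> cos (q * `|z|).
    by apply: (@cvg_comp _ _ _ _ cos _ _ _ h2); exact: continuous_cos.
  have h4 : sin (q_ n * `|z|) @[n --> \oo] --> sin (q * `|z|).
    by apply: (@cvg_comp _ _ _ _ sin _ _ _ h2); exact: continuous_sin.
  by case: k {E mpart}; rewrite /part /cexpRI /=; exact: cvgM.
- exact: (@bounded_integrable _ _ _ zeta (cst 1) `|1|).
- move=> n z; apply: le_trans (part_le _ _) _; exact: laplace_integrand_le1.
Qed.

End laplace.

Section branching.
Context {R : realType} (zeta : probability R R) d (Om : measurableType d) (P : probability Om R) (A : nat -> Om -> R) (N : nat).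
Hypothesis mA : forall i, measurable_fun setT (A i).
Hypothesis A0 : forall i w, 0 <= A i w.
(** Addition on the half-line; the absolute values extend it to all reals while keeping the
    transform multiplicative. *)
Let op (z a z' : R) : R := `|z| + `|a| * `|z'|.

Let mop : measurable_fun setT (fun p : R * R * R => op p.1.1 p.1.2 p.2).
Proof.
have mn : measurable_fun [set: R] (fun z : R => `|z|) by exact: measurableT_comp.
apply: measurable_funD.
  by apply: (measurableT_comp mn); exact: (measurableT_comp measurable_fst measurable_fst).
apply: measurable_funM; last exact: (measurableT_comp mn measurable_snd).
by apply: (measurableT_comp mn); exact: (measurableT_comp measurable_snd measurable_fst).
Qed.

Let F := forest P mA (0 : R) mop (fun=> zeta) N 0.

Let mabs2 : measurable_fun setT (fun p : Om * R => `|p.2| : R).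
Proof. exact: measurableT_comp measurable_snd. Qed.

Let rho := fpush mabs2 F.

Let rhoT : rho setT = 1%E.
Proof.
rewrite fpushE preimage_setT.
have h := @forest_mass _ _ _ _ _ P A mA op 0 mop (fun=> zeta) 0 N 0 (fun=> 1%E) (lexx 0) _
  (measurable_cst _) (fun=> lee01).
rewrite -[LHS]mul1e -(integral_cst F measurableT 1%E) h.
  rewrite mulr0 rbin0 mul1e (integral_cst P measurableT 1%E) mul1e.
  exact: probability_setT.
by move=> m; rewrite leqn0 => /eqP ->; rewrite rbin0; exact: probability_setT.
Qed.


Let cint_F (p q : R) : cint F setT (fun r => cexpRI (- (`|p| * `|r.2|)) (q * `|r.2|)) =
  cint P setT (fun w => \prod_(i < N) laplace zeta (p * A i w) (q * A i w)).
Proof.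
pose e (z : R) := cexpRI (- (`|p| * `|z|)) (q * `|z|) : R[i].
pose e' (a z : R) := cexpRI (- (`|p * a| * `|z|)) (q * `|a| * `|z|) : R[i].
have mn : measurable_fun [set: R] (fun z : R => `|z|) by exact: measurableT_comp.
have me' : cmeasurable (fun r : R * R => e' r.1 r.2).
  apply: cmeasurable_cexpRI.
    apply: measurableT_comp => //; apply: measurable_funM.
      by apply: (measurableT_comp mn); apply: measurable_funM => //; exact: measurable_fst.
    exact: (measurableT_comp mn measurable_snd).
  apply: measurable_funM; last exact: (measurableT_comp mn measurable_snd).
  by apply: measurable_funM => //; exact: (measurableT_comp mn measurable_fst).
have e'1 a : cbounded (e' a) 1.
  by move=> z; rewrite normc_cexpRI expR_le1 oppr_le0 mulr_ge0.
have ez0 : e 0 = 1.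
  by rewrite /e normr0 !mulr0 oppr0 /cexpRI expR0 cos0 sin0 mulr1 mulr0.
have eop z a z' : e (op z a z') = e z * e' a z'.
  rewrite /e /e' /op -cexpRI_add (ger0_norm (addr_ge0 _ (mulr_ge0 _ _)))//.
  by rewrite (normrM p); congr cexpRI; ring.
have := @cint_forest_factor _ _ _ _ _ P A mA op 0 mop e e' (laplace_integrand p q) me'
  (@laplace_integrand_le1 _ p q) e'1 ez0 eop (fun=> zeta) N 0 (fun=> 1) 1
  (@cmeasurable_cst _ _ _ 1) _.
rewrite -/F => h.
transitivity (cint F setT (fun r : Om * R => 1 * e r.2)).
  by congr (cint _ _ _); apply/funext => r; rewrite mul1r.
rewrite h; last by move=> w; rewrite ComplexField.Normc.normc1.
congr (cint _ _ _); apply/funext => w; rewrite mul1r.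
have -> : forall (c : nat -> nat -> R[i]) i, fcoef c i 0 = \prod_(j < i) c j 0%N.
  move=> c; elim => [|i IH] /=; first by rewrite big_ord0.
  by rewrite big_ord1 IH big_ord_recr.
apply: eq_bigr => i _; congr (cint _ _ _); apply/funext => z.
by rewrite /e' (ger0_norm (A0 i w)).
Qed.

(** The expected product is again the transform of a law, that of the sum of [A_i Z_i], and one law
    serves all [p] and [q]. *)
Lemma laplace_branching : exists rho' : probability R R, forall p q,
  cint P setT (fun w => \prod_(i < N) laplace zeta (p * A i w) (q * A i w)) =
  laplace rho' p q.
Proof.
exists (mkprob rhoT) => p q; rewrite -cint_F.
transitivity (cint rho setT (fun z => cexpRI (- (`|p| * `|z|)) (q * `|z|))) => //.
rewrite (cint_fpush mabs2 F (laplace_integrand p q) (@laplace_integrand_le1 _ p q)).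
by congr (cint _ _ _); apply/funext => r; rewrite normr_id.
Qed.

End branching.

Section mixture.
Context {R : realType} (zeta rho : probability R R).
Context d (U : measurableType d) (mu : probability U R) (t : U -> R).
Hypotheses (mt : measurable_fun setT t) (t0 : forall u, 0 <= t u).
Hypothesis zetaE : forall xi,
  charfun zeta xi = cint mu setT (fun u => laplace rho 0 (xi * t u)).

Let mprod : measurable_fun setT (fun r : U * R => t r.1 * `|r.2| : R).
Proof.
apply: measurable_funM; first exact: measurableT_comp mt measurable_fst.
exact: measurableT_comp measurable_snd.
Qed.

Let sigma := fpush mprod (fprodm mu rho).

Let sigmaT : sigma setT = 1%E.
Proof.
rewrite fpushE preimage_setT -[LHS]mul1e -(integral_cst (fprodm mu rho) measurableT 1%E).
rewrite ge0_integral_fprod; [|exact: measurable_cst|by move=> y; exact: lee01].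
under eq_integral do rewrite (integral_cst rho measurableT 1%E) mul1e.
rewrite (_ : (fun=> rho setT) = cst 1%E); last first.
  by apply/funext => u; exact: probability_setT.
by rewrite (integral_cst mu measurableT 1%E) mul1e; exact: probability_setT.
Qed.

(** The hypothesis covers [p = 0] only. It says that [zeta] has the characteristic function of
    [t(U) |W|], with [U] and [W] independent of laws [mu] and [rho]; equality of the two laws then
    gives every [p]. *)
Lemma laplace_mixture p q :
  laplace zeta p q = cint mu setT (fun u => laplace rho (p * t u) (q * t u)).
Proof.
have sE (f : R -> R[i]) : cmeasurable f -> cbounded f 1 ->
    cint sigma setT f = cint mu setT (fun u => cint rho setT (fun z => f (t u * `|z|))).
  move=> mf f1; rewrite (cint_fpush mprod _ mf f1) (@cint_fprod _ _ _ _ _ _ _ _ 1)//.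
  exact: cmeasurable_comp mprod mf.
have zs B : measurable B -> zeta B = sigma B.
  move=> mB; apply: (@charfun_inj R zeta (mkprob sigmaT) _ B mB) => xi.
  rewrite zetaE; symmetry; rewrite [LHS]sE; last 2 first.
  - exact: charfun_integrand.
  - by move=> x; rewrite normc_cos_sin.
  congr (cint _ _ _); apply/funext => u; congr (cint _ _ _); apply/funext => z.
  by rewrite normr0 mul0r oppr0 /cexpRI expR0 !mul1r mulrA.
have eR (f : R -> R) : Rintegral zeta setT f = Rintegral sigma setT f.
  by congr fine; apply: eq_measure_integral => B mB _; exact: zs.
transitivity (cint sigma setT (fun z => cexpRI (- (`|p| * `|z|)) (q * `|z|))).
  by rewrite /laplace /cint !eR.
rewrite (sE _ (laplace_integrand p q) (@laplace_integrand_le1 _ p q)).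
congr (cint _ _ _); apply/funext => u; congr (cint _ _ _); apply/funext => z.
by rewrite !normrM normr_id (ger0_norm (t0 u)) !mulrA.
Qed.

End mixture.

(** * Averages over an interval and their scaling *)

Section lebesgue_interval.
Context {R : realType}.
Local Notation leb := (@lebesgue_measure R).

Lemma lebesgue_itv0 (a : R) : 0 <= a -> leb `[0, a]%classic = a%:E.
Proof.
rewrite lebesgue_measure_itv/= lte_fin -EFinB subr0; case: ltP => // a0' a0.
by congr EFin; apply: le_anti; rewrite a0 a0'.
Qed.

Lemma bounded_integrable_itv0 (a M : R) (h : R -> R) : 0 <= a ->
  measurable_fun setT h -> (forall x, `|h x| <= M) ->
  leb.-integrable `[0, a] (EFin \o h).
Proof.
move=> a0 mh hM; apply: measurable_bounded_integrable => //.
- exact: (eq_ind_r (fun x => x < +oo)%E (ltry a) (lebesgue_itv0 a0)).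
- exact: measurable_funS mh.
- exists M; split; first exact: num_real.
  by move=> y My x _ /=; exact: le_trans (hM x) (ltW My).
Qed.

Lemma Rintegral_shift_itv0 (a M : R) (h : R -> R) : 0 <= a ->
  measurable_fun setT h -> (forall x, `|h x| <= M) ->
  Rintegral leb `[0, a] h = fine (\int[leb]_(x in `[0%R, a]) (h x + M)%:E)%E - M * a.
Proof.
move=> a0 mh hM; have M0 : 0 <= M by exact: le_trans (normr_ge0 _) (hM 0).
have iM : leb.-integrable `[0, a] (EFin \o cst M).
  by apply: (@bounded_integrable_itv0 a M) => // x; rewrite ger0_norm.
have <- : Rintegral leb `[0, a] (cst M) = M * a.
  rewrite Rintegral_cst//; congr (_ * _).
  exact: (congr1 fine (lebesgue_itv0 a0)).
rewrite -[fine _]/(Rintegral leb `[0, a] (fun x => h x + M)).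
by rewrite RintegralD// ?addrK//; exact: (bounded_integrable_itv0 a0 mh hM).
Qed.

End lebesgue_interval.

Section lebesgue_scaling.
Context {R : realType} (c : R).
Hypothesis c0 : 0 < c.
Local Notation leb := (@lebesgue_measure R).

Let scale (x : measurableTypeR R) : measurableTypeR R := c * x.

Let mscl : measurable_fun setT scale.
Proof. exact: measurable_funM. Qed.

Let pm : {measure set (measurableTypeR R) -> \bar R} :=
  measure_function_pushforward__canonical__measure_function_Measure leb mscl.

(** Lebesgue measure is determined by its values on half-open intervals. *)
Lemma lebesgue_measure_scale (B : set R) : measurable B ->
  leb B = mscale (NngNum (ltW c0)) pm B.
Proof.
move=> mB; apply: lebesgue_measure_unique => // _ [[a b]] _ <-.
transitivity (c%:E * leb (scale @^-1` `]a, b]))%E; last by [].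
have -> : scale @^-1` `]a, b] = `](a / c), (b / c)]%classic.
  apply/seteqP; split => x /=; rewrite /scale !in_itv/= ltr_pdivrMr// ler_pdivlMr//.
    by rewrite mulrC.
  by rewrite mulrC.
rewrite /= !lebesgue_measure_itv/= !lte_fin ltr_pM2r ?invr_gt0//.
case: ifP => _; last by rewrite mule0.
by rewrite -EFinD -EFinM; congr EFin; field; rewrite gt_eqF.
Qed.

Lemma Rintegral_scale (f : R -> R) M : measurable_fun setT f -> (forall x, `|f x| <= M) ->
  Rintegral leb `[0, c] f = c * Rintegral leb `[0, 1] (fun x => f (c * x)).
Proof.
move=> mf fM.
have nonneg (h : R -> R) : measurable_fun setT h -> (forall x, 0 <= h x) ->
    (\int[leb]_(x in `[0%R, c]) (h x)%:E = c%:E * \int[leb]_(x in `[0%R, 1%R]) (h (c * x))%:E)%E.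
  move=> mh h0.
  transitivity (\int[mscale (NngNum (ltW c0)) pm]_(x in `[0%R, c]) (h x)%:E)%E.
    by apply: eq_measure_integral => B mB _; exact: lebesgue_measure_scale.
  rewrite ge0_integral_mscale//=; last 2 first.
  - by apply/measurable_EFinP; exact: measurable_funTS.
  - by move=> x _; rewrite lee_fin.
  congr (_ * _)%E; rewrite (ge0_integral_pushforward mscl)//=; last 2 first.
  - by apply/measurable_EFinP; exact: measurable_funTS.
  - by move=> x _; rewrite lee_fin.
  congr (integral _ _ _); apply/seteqP; split => x /=; rewrite /scale !in_itv/=.
    by rewrite -[X in c * x <= X]mulr1 ler_pM2l// pmulr_rge0.
  by rewrite -[X in c * x <= X]mulr1 ler_pM2l// pmulr_rge0.
have mfc : measurable_fun setT (fun x => f (c * x)) by exact: (measurableT_comp mf mscl).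
have hM x : 0 <= f x + M by rewrite -lerBlDr sub0r; have := fM x; rewrite ler_norml => /andP[].
rewrite (Rintegral_shift_itv0 (ltW c0) mf fM).
rewrite (Rintegral_shift_itv0 (M := M) ler01 mfc)// nonneg//; last exact: measurable_funD.
have fin : (\int[leb]_(x in `[0%R, 1%R]) (f (c * x) + M)%:E)%E \is a fin_num.
  apply: integrable_fin_num => //.
  apply: (@bounded_integrable_itv0 _ 1 (M + M) (fun x => f (c * x) + M)) => //.
    exact: measurable_funD.
  move=> x; rewrite (le_trans (ler_normD _ _))// lerD//.
  by rewrite ger0_norm//; exact: le_trans (normr_ge0 _) (fM 0).
by rewrite fineM//= mulr1 mulrBr (mulrC M).
Qed.

End lebesgue_scaling.

Section uniform_integral.
Context {R : realType}.
Local Notation leb := (@lebesgue_measure R).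

(** Makes the average over [tau] a probability, so that the results on products of finite measures
    apply. *)
Definition unif01 : probability (measurableTypeR R) R := uniform_prob (@ltr01 R).

Lemma Rintegral_unif01 (f : R -> R) M : measurable_fun setT f -> (forall x, `|f x| <= M) ->
  Rintegral unif01 setT f = Rintegral leb `[0, 1] f.
Proof.
move=> mf fM; rewrite (@Rintegral_shift _ _ _ unif01 _ M)//.
have hM x : 0 <= f x + M by rewrite -lerBlDr sub0r; have := fM x; rewrite ler_norml => /andP[].
rewrite integral_uniform; last 2 first.
- by apply/measurable_EFinP; exact: measurable_funD.
- by move=> x; rewrite lee_fin.
rewrite subr0 invr1 mul1e.
have -> : fine (unif01 setT) = 1 by exact: (congr1 fine (probability_setT unif01)).
by rewrite (Rintegral_shift_itv0 ler01 mf fM).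
Qed.

Lemma cint_unif01 (f : R -> R[i]) M : cmeasurable f -> cbounded f M ->
  cint unif01 setT f = cint leb `[0, 1] f.
Proof.
move=> [f1 f2] fM; congr (_ +i* _)%C; apply: (@Rintegral_unif01 _ M) => // x.
- exact: le_trans (Re_le_normc _) (fM x).
- exact: le_trans (Im_le_normc _) (fM x).
Qed.

End uniform_integral.

Section laplace_flow.
Context {R : realType} (zeta rho : probability R R) (p q Q : R).
Local Notation leb := (@lebesgue_measure R).
Hypothesis zetaE : forall p q,
  laplace zeta p q = cint leb `[0, 1] (fun u => laplace rho (p * u `^ Q) (q * u `^ Q)).

Lemma cmeasurable_laplace_powR (a b : R) :
  cmeasurable (fun u : measurableTypeR R => laplace rho (a * u `^ Q) (b * u `^ Q)).
Proof.
have mp : measurable_fun setT (fun r : measurableTypeR R * R => r.1 `^ Q).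
  exact: (measurableT_comp (measurable_powR Q) measurable_fst).
have mn : measurable_fun setT (fun r : measurableTypeR R * R => `|r.2| : R).
  exact: measurableT_comp measurable_snd.
apply: (@cmeasurable_cint _ _ _ _ _ unif01 rho
  (fun r : measurableTypeR R * R =>
     cexpRI (- (`|a * r.1 `^ Q| * `|r.2|)) (b * r.1 `^ Q * `|r.2|))).
- apply: cmeasurable_cexpRI.
    apply: measurableT_comp => //; apply: measurable_funM => //.
    by apply: measurableT_comp => //; exact: measurable_funM.
  by apply: measurable_funM => //; exact: measurable_funM.
- by move=> r; exact: laplace_integrand_le1.
Qed.

Let g k (r : R) : R := part k (laplace rho (p * r `^ Q) (q * r `^ Q)).

Let g1 k r : `|g k r| <= 1.
Proof. exact: le_trans (part_le _ _) (normc_laplace_le1 _ _ _). Qed.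

Let mg k : measurable_fun setT (g k).
Proof. by have [] := cmeasurable_laplace_powR p q; case: k. Qed.

Let cg k (r : R) : 0 < r -> {for r, continuous (g k)}.
Proof.
move=> r0; apply/(@cvg_nbhsP _ R^o) => u ur.
have up : u n `^ Q @[n --> \oo] --> r `^ Q.
  have h : {for r, continuous (fun x : R => x `^ Q)}.
    by apply: differentiable_continuous; apply/derivable1_diffP; apply: derivable_powR; rewrite in_itv/= r0.
  exact: (cvg_comp _ _ ur h).
by apply: cvg_laplace; exact: cvgMr.
Qed.

Let flow k (s : R) : R := part k (laplace zeta (p * expR (Q * s)) (q * expR (Q * s))).

(** The substitution [r = e^s u] moves [s] from the integrand, where differentiability of the
    transform of [rho] would be required, to the upper end of the integral, where continuity is
    enough. *)
Let flowE k s : flow k s = expR (- s) * Rintegral leb `[0, expR s] (g k).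
Proof.
rewrite (Rintegral_scale (expR_gt0 s) (mg k) (g1 k)) mulrA -expRD addNr expR0 mul1r.
rewrite /flow zetaE.
transitivity (Rintegral leb `[0, 1] (fun u =>
    part k (laplace rho (p * expR (Q * s) * u `^ Q) (q * expR (Q * s) * u `^ Q)))).
  by case: k.
apply: eq_Rintegral => u; rewrite mem_setE in_itv/= => /andP[u0 _].
by rewrite /g powRM ?expR_ge0// -expRM [s * Q]mulrC !mulrA.
Qed.

(** Product rule and fundamental theorem of calculus for [e^-s] times an integral up to [e^s]. The
    form of the result, gain minus the function itself, is that of the Cauchy equation. *)
Lemma is_derive_laplace_flow k (s : R) :
  is_derive s 1 (fun s => part k (laplace zeta (p * expR (Q * s)) (q * expR (Q * s))))
    (part k (laplace rho (p * expR (Q * s)) (q * expR (Q * s))) -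
     part k (laplace zeta (p * expR (Q * s)) (q * expR (Q * s)))).
Proof.
have es0 := expR_gt0 s.
pose I (y : R) := Rintegral leb `[0, y] (g k).
have [dI dIE] : derivable I (expR s) 1 /\ (derive1 I (expR s) = g k (expR s)).
  apply: (@continuous_FTC1_closed _ (g k) 0 (expR s) (expR s + 1)).
  - by rewrite ltrDl.
  - exact: (bounded_integrable_itv0 (ltW (addr_gt0 es0 ltr01)) (mg k) (g1 k)).
  - exact: es0.
  - exact: cg.
have dI' : is_derive (expR s) 1 I (g k (expR s)).
  by rewrite -dIE derive1E; exact: DeriveDef.
have -> : (fun s => part k (laplace zeta (p * expR (Q * s)) (q * expR (Q * s)))) =
    (fun s => expR (- s) * I (expR s)).
  by apply/funext => x; exact: flowE.
have dIe : is_derive s 1 (fun x => I (expR x)) (expR s * g k (expR s)).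
  rewrite mulrC; exact: (@is_derive1_comp _ I expR).
have dN : is_derive s 1 (fun x : R => expR (- x)) (- expR (- s)).
  by apply: is_derive_eq; rewrite mulrN1.
apply: is_derive_eq.
rewrite -[part k (laplace zeta _ _)]/(flow k s) flowE -/(I (expR s)).
rewrite -[LHS]/(expR (- s) * (expR s * g k (expR s)) + I (expR s) * - expR (- s)).
rewrite mulrA -expRD addNr expR0 mul1r mulrN [I _ * _]mulrC; congr (_ - _).
by rewrite /g -expRM [s * Q]mulrC.
Qed.

End laplace_flow.

Lemma cmeasurable_charfun {R : realType} (m : probability R R) : cmeasurable (charfun m).
Proof.
have mm : measurable_fun setT (fun r : R * R => r.1 * r.2).
  by apply: measurable_funM; [exact: measurable_fst|exact: measurable_snd].
apply: (@cmeasurable_cint _ _ _ _ _ m m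
  (fun r : R * R => (cos (r.1 * r.2) +i* sin (r.1 * r.2))%C) 1).
- split => /=.
  + exact: (measurableT_comp measurable_cos mm).
  + exact: (measurableT_comp measurable_sin mm).
- by move=> r; rewrite normc_cos_sin.
Qed.

Lemma normc_charfun_le1 {R : realType} (m : probability R R) xi : normc (charfun m xi) <= 1.
Proof.
by apply: normc_cint_le1; [exact: charfun_integrand|move=> x; rewrite normc_cos_sin].
Qed.

Lemma Gamma_ge0 {R : realType} (x : R) : 0 <= Gamma x.
Proof.
apply: fine_ge0; apply: integral_ge0 => u _.
by rewrite lee_fin mulr_ge0 ?powR_ge0 ?expR_ge0.
Qed.

Lemma powRV_mul {R : realType} (gam z : R) : 0 < gam -> 0 <= z -> (z `^ gam^-1) `^ gam = z.
Proof. by move=> g0 z0; rewrite -powRrM mulVf ?gt_eqF// powRr1. Qed.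

(** One form for all cases, with an exponent linear in [z]. For [gam = 1] the pair [(a, b)] is
    [(0, m0)] or [(pi c, 0)]; otherwise [a = k0], nonnegative because [sin (pi gam / 2)] is positive
    on []0, 2[]. *)
Lemma H_gamma_ghat_stable {R : realType} (mu0 : probability R R) gam (g : R -> R[i]) :
  0 < gam < 2 -> H_gamma_ghat mu0 gam g ->
  exists a b : R, 0 <= a /\ forall xi z, 0 <= z ->
    g (xi * z `^ gam^-1) =
    cexpRI (- (a * `|xi| `^ gam * z)) (b * (Num.sg xi * `|xi| `^ gam) * z).
Proof.
move=> /andP[g0 g2] [[-> [[_ ->]|[c [_ [_ [_ [c0 ->]]]]]]]|[_ [cp [cm [_ [_ [c0 [_ ->]]]]]]]].
- exists 0, (fine (\int[mu0]_x x%:E)); split => // xi z z0.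
  by rewrite invr1 !powRr1// -numEsg !mul0r oppr0 mulrA.
- exists (pi * c), 0; split => [|xi z z0]; first by rewrite mulr_ge0 ?pi_ge0 ?ltW.
  by rewrite invr1 !powRr1// normrM (ger0_norm z0) !mul0r !mulrA.
set k0 := (cp + cm) * _; set e0 := (cp - cm) / _ .
exists k0, (k0 * (e0 * tan (pi * gam / 2))); split => [|xi z z0].
  rewrite /k0 mulr_ge0 ?(ltW c0)// divr_ge0 ?pi_ge0// mulr_ge0 ?mulr_ge0 ?Gamma_ge0//.
  apply/ltW/sin_gt0_pi; have := pi_gt0 R => p0.
  by rewrite divr_gt0 ?mulr_gt0//= ltr_pdivrMr// ltr_pM2l.
rewrite normrM (ger0_norm (powR_ge0 _ _)) powRM ?powR_ge0// powRV_mul//.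
have sz : Num.sg (xi * z `^ gam^-1) * z = Num.sg xi * z.
  move: z0; rewrite le_eqVlt => /predU1P[<-|z0]; first by rewrite !mulr0.
  by rewrite sgrM (gtr0_sg (powR_gt0 _ z0)) mulr1.
congr cexpRI; first by rewrite !mulrA.
rewrite [RHS](_ : _ = k0 * `|xi| `^ gam * (e0 * tan (pi * gam / 2)) * (Num.sg xi * z)); last by ring.
by rewrite -sz; ring.
Qed.

Section stable_mixture.
Context {R : realType} d (Om : measurableType d) (P : probability Om R).
Context (A : nat -> Om -> R) (N : nat) (gam Q : R) (zeta ninf : probability R R).
Hypothesis mA : forall i, measurable_fun setT (A i).
Hypothesis A0 : forall i w, 0 <= A i w.
Hypothesis gam0 : 0 < gam.
Hypothesis zeta0 : zeta `[0, +oo[%classic = 1%E.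
Hypothesis zetaE : forall xi, charfun zeta xi =
  cint lebesgue_measure `[0, 1] (fun tau => cint P setT (fun w =>
    \prod_(i < N) charfun zeta (xi * (A i w `^ gam) * (tau `^ Q)))).
Variables (a b : R) (g : R -> R[i]).
Hypothesis a0 : 0 <= a.
Hypothesis gE : forall xi z, 0 <= z -> g (xi * z `^ gam^-1) =
  cexpRI (- (a * `|xi| `^ gam * z)) (b * (Num.sg xi * `|xi| `^ gam) * z).
Hypothesis ninfE : forall xi,
  charfun ninf xi = cint zeta `[0, +oo[ (fun z => g (xi * z `^ gam^-1)).

Let p (xi : R) : R := a * `|xi| `^ gam.
Let q (xi : R) : R := b * (Num.sg xi * `|xi| `^ gam).

(** This is why the characteristic function of [zeta] does not suffice: [a] is positive in
    general. *)
Lemma charfun_stable xi :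
  charfun ninf xi = laplace zeta (a * `|xi| `^ gam) (b * (Num.sg xi * `|xi| `^ gam)).
Proof.
rewrite ninfE; apply/esym.
apply: (cint_nneg zeta0 (laplace_integrand (p xi) (q xi)) (@laplace_integrand_le1 _ (p xi) (q xi))).
move=> z z0; rewrite gE// (ger0_norm z0) ger0_norm// mulr_ge0// powR_ge0.
Qed.

Let scale_powR (c xi : R) : 0 <= c -> `|c * xi| `^ gam = c `^ gam * `|xi| `^ gam.
Proof. by move=> c0; rewrite normrM (ger0_norm c0) powRM. Qed.

Let scale_p (c xi : R) : 0 <= c -> p (c * xi) = p xi * c `^ gam.
Proof. by move=> c0; rewrite /p scale_powR//; ring. Qed.

Let scale_q (c xi : R) : 0 <= c -> q (c * xi) = q xi * c `^ gam.
Proof.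
move=> c0; rewrite /q scale_powR//; move: c0; rewrite le_eqVlt => /predU1P[<-|c0].
  by rewrite powR0 ?gt_eqF// !mul0r !mulr0.
by rewrite sgrM gtr0_sg// mul1r; ring.
Qed.

Let mAg i : measurable_fun setT (fun w => A i w `^ gam).
Proof. exact: (measurableT_comp (measurable_powR gam) (mA i)). Qed.

Let psi (t xi : R) := charfun ninf (expR (Q / gam * t) * xi).

(** Dilating [xi] by [c] multiplies [p] and [q] by [c^gam], so [exp (Q t / gam)] acts as
    [exp (Q t)]. *)
Let psiE t xi : psi t xi = laplace zeta (p xi * expR (Q * t)) (q xi * expR (Q * t)).
Proof.
rewrite /psi charfun_stable -/(p _) -/(q _) scale_p ?expR_ge0// scale_q ?expR_ge0//.
by rewrite -expRM (_ : Q / gam * t * gam = Q * t)//; field; rewrite gt_eqF.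
Qed.

(** The gain term of the flow is the expected product of the transforms of [zeta] at [p] and [q]
    multiplied by [A_i^gam], that is, of the solution at [A_i xi]. *)
Lemma cauchy_solution_stable :
  cauchy_solution P A N (fun t xi => charfun ninf (expR (Q / gam * t) * xi)).
Proof.
have [rho rhoE] := @laplace_branching _ zeta _ _ P (fun i w => A i w `^ gam) N mAg
  (fun i w => powR_ge0 _ _).
have zE p' q' : laplace zeta p' q' = cint lebesgue_measure `[0, 1]
    (fun u => laplace rho (p' * u `^ Q) (q' * u `^ Q)).
  rewrite -(@cint_unif01 _ _ 1); last 2 first.
  - exact: cmeasurable_laplace_powR.
  - by move=> u; exact: normc_laplace_le1.
  apply: (@laplace_mixture R zeta rho _ _ (@unif01 R) (fun u => u `^ Q)).
  - exact: measurable_powR.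
  - by move=> u; exact: powR_ge0.
  move=> xi; rewrite zetaE -(@cint_unif01 _ _ 1).
  - congr (cint _ _ _); apply/funext => u; rewrite -rhoE.
    congr (cint _ _ _); apply/funext => w; apply: eq_bigr => i _.
    by rewrite (charfun_laplace zeta0) mul0r mulrAC.
  - rewrite (_ : (fun _ => _) = (fun u : R => laplace rho (0 * u `^ Q) (xi * u `^ Q))).
      exact: cmeasurable_laplace_powR.
    apply/funext => u; rewrite -rhoE.
    congr (cint _ _ _); apply/funext => w; apply: eq_bigr => i _.
    by rewrite (charfun_laplace zeta0) !mul0r mulrAC.
  - move=> u; rewrite (_ : cint _ _ _ = laplace rho 0 (xi * u `^ Q)) ?normc_laplace_le1//.
    rewrite -rhoE.
    congr (cint _ _ _); apply/funext => w; apply: eq_bigr => i _.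
    by rewrite (charfun_laplace zeta0) mul0r mulrAC.
have der k (xi t : R) : is_derive t 1 (fun s => part k (psi s xi))
    (part k (laplace rho (p xi * expR (Q * t)) (q xi * expR (Q * t))) - part k (psi t xi)).
  rewrite (_ : (fun s => _) = (fun s =>
      part k (laplace zeta (p xi * expR (Q * s)) (q xi * expR (Q * s))))); last first.
    by apply/funext => s; rewrite psiE.
  by rewrite psiE; exact: is_derive_laplace_flow.
have rcont k (xi : R) : part k (psi s xi) @[s --> (0 : R)^'+] --> part k (psi 0 xi).
  apply: cvg_at_right_filter; apply: differentiable_continuous.
  by apply/derivable1_diffP; have [] := der k xi 0.
split.
- move=> t; apply: cmeasurable_comp (cmeasurable_charfun ninf).
  exact: measurable_funM.
- by move=> t xi; exact: normc_charfun_le1.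
- move=> xi; split; [exact: (rcont true)|split; [exact: (rcont false)|]] => t t0.
  have [dr drE] := der true xi t; have [di diE] := der false xi t.
  split; [exact: dr|split; [exact: di|]].
  rewrite !derive1E.
  transitivity (laplace rho (p xi * expR (Q * t)) (q xi * expR (Q * t))).
    apply: complex_eq => /=.
    + by rewrite [X in X + _]drE subrK.
    + by rewrite [X in X + _]diE subrK.
  rewrite -rhoE; congr (cint _ _ _); apply/funext => w; apply: eq_bigr => i _.
  rewrite -/(psi t _) psiE scale_p// scale_q//.
  by rewrite mulrAC [X in laplace _ _ X]mulrAC.
Qed.

End stable_mixture.

(** * Equality of the means *)

Section sine.
Context {R : realType}.

Lemma ler_sinB (x y : R) : `|sin x - sin y| <= `|x - y|.
Proof.
wlog xy : x y / x < y.
  move=> h; have [/h//|/h|->] := ltgtP x y; last by rewrite !subrr.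
  by rewrite distrC [leRHS]distrC.
have [|z _ E] := @MVT R sin cos x y xy (fun z _ => is_derive_sin z).
  by apply: continuous_subspaceT => z; exact: continuous_sin.
rewrite distrC [leRHS]distrC E normrM ler_piMl//.
by rewrite ler_norml cos_geN1 cos_le1.
Qed.

Lemma ler_norm_sin (x : R) : `|sin x| <= `|x|.
Proof. by have := ler_sinB x 0; rewrite sin0 !subr0. Qed.

Lemma cvg_invn_within (D : set R) : (forall n, D n.+1%:R^-1) ->
  (n.+1%:R^-1 : R) @[n --> \oo] --> within D (nbhs (0 : R)).
Proof.
move=> Dn U U0.
have h : \forall n \near \oo, D (harmonic n) -> U (harmonic n) := @cvg_harmonic R _ U0.
by apply: filterS h => n; apply; exact: Dn.
Qed.

Lemma cvg_sin_quotient (x : R) : n.+1%:R * sin (n.+1%:R^-1 * x) @[n --> \oo] --> x.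
Proof.
have hd : is_derive (0 : R) 1 (fun s : R => sin (s * x)) x.
  by apply: is_derive_eq; rewrite mul0r cos0 mul1r /GRing.scale/= mulr0 add0r mulr1.
have [dx xE] := hd.
have h : (n.+1%:R^-1 : R) @[n --> \oo] --> (0 : R)^'.
  by apply: cvg_invn_within => n; rewrite /= invr_eq0 pnatr_eq0.
move: xE; rewrite /derive => xE; rewrite -[X in _ --> X]xE.
apply: cvg_trans (cvg_comp _ _ h dx).
apply: near_eq_cvg; apply: nearW => n /=.
by rewrite mul0r sin0 subr0 addr0 invrK /GRing.scale/= mulr1.
Qed.

Lemma cvg_invn_powR (s : R) : 0 < s -> (n.+1%:R^-1 `^ s : R) @[n --> \oo] --> 0.
Proof.
move=> s0; have h : (n.+1%:R^-1 : R) @[n --> \oo] --> (0 : R)^'+.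
  by apply: cvg_invn_within => n; rewrite /= invr_gt0.
exact: (cvg_comp _ _ h (powR_cvg0 s0)).
Qed.

End sine.

(** The integral is the difference of those of the positive and negative parts, and a finite
    difference forces both to be finite. An equation such as [\int[m]_x x%:E = 0] thus carries
    integrability with it. *)
Lemma fin_num_integrable d (T : measurableType d) (R : realType)
    (m : {measure set T -> \bar R}) (f : T -> \bar R) :
  measurable_fun setT f -> (\int[m]_x f x)%E \is a fin_num -> m.-integrable setT f.
Proof.
move=> mf; rewrite integralE fin_numB => /andP[fp fn].
apply/integrableP; split => //.
rewrite (_ : (fun x => `|f x|%E) = (fun x => f^\+ x + f^\- x)%E); last first.
  by rewrite -[LHS]/(abse \o f) fune_abse.
rewrite ge0_integralD//; last 2 first.
- exact: measurable_funepos.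
- exact: measurable_funeneg.
by rewrite lte_add_pinfty// ltey_eq ?fp ?fn.
Qed.

(** Integrability is asked of [X - Y] only: [sin] is 1-Lipschitz, so [|X - Y|] dominates. Since the
    left-hand side depends on the two marginal laws alone, so does the mean of the difference. *)
Lemma cvg_sin_mean d (T : measurableType d) (R : realType) (m : probability T R)
    (X Y : T -> R) : measurable_fun setT X -> measurable_fun setT Y ->
  m.-integrable setT (fun w => (X w - Y w)%:E) ->
  n.+1%:R * (Rintegral m setT (fun w => sin (n.+1%:R^-1 * X w)) -
             Rintegral m setT (fun w => sin (n.+1%:R^-1 * Y w))) @[n --> \oo] -->
  Rintegral m setT (fun w => X w - Y w).
Proof.
move=> mX mY iXY.
have ms (Z : T -> R) (c : R) : measurable_fun setT Z -> measurable_fun setT (fun w => sin (c * Z w)).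
  by move=> mZ; apply: measurableT_comp measurable_sin _; exact: measurable_funM.
have is_ (Z : T -> R) (c : R) : measurable_fun setT Z ->
    m.-integrable setT (EFin \o (fun w => sin (c * Z w))).
  move=> mZ; apply: (@bounded_integrable _ _ _ m _ 1); first exact: ms.
  by move=> w; rewrite ler_norml sin_geN1 sin_le1.
pose f n w : R := n.+1%:R * (sin (n.+1%:R^-1 * X w) - sin (n.+1%:R^-1 * Y w)).
rewrite (_ : (fun n : nat => _) = (fun n => Rintegral m setT (f n))); last first.
  apply/funext => n; rewrite /f RintegralZl//; last first.
    by rewrite (_ : EFin \o _ = EFin \o (fun w => sin (n.+1%:R^-1 * X w)) \-
       (EFin \o (fun w => sin (n.+1%:R^-1 * Y w))))%E//; exact: integrableB (is_ _ _ mX) (is_ _ _ mY).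
  by rewrite RintegralB//; exact: is_.
apply: (@cvg_Rintegral_dominated _ _ _ m _ _ (fun w => `|X w - Y w|)).
- by move=> n; apply: measurable_funM => //; apply: measurable_funB; exact: ms.
- exact: measurable_funB.
- move=> w; rewrite /f; under eq_fun do rewrite mulrBr.
  by apply: cvgB; exact: cvg_sin_quotient.
- exact: (integrable_norm iXY).
- move=> n w; rewrite /f normrM normr_nat.
  rewrite -ler_pdivlMl ?ltr0n// (le_trans (ler_sinB _ _))// -mulrBr normrM.
  by rewrite ger0_norm.
Qed.

Lemma cvg_Im_charfun (R : realType) (m : probability R R) (c : R) :
  m.-integrable setT (fun x => x%:E) ->
  n.+1%:R * complex.Im (charfun m (c * n.+1%:R^-1)) @[n --> \oo] -->
  c * fine (\int[m]_x x%:E).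
Proof.
move=> im; have icm : m.-integrable setT (fun x => (c * x)%:E).
  rewrite (_ : (fun x => _) = (fun x => c%:E * x%:E)%E) //.
  exact: integrableZl.
have := @cvg_sin_mean _ _ _ m (fun x => c * x) (cst 0).
rewrite (_ : Rintegral m setT _ = c * fine (\int[m]_x x%:E)); last first.
  rewrite -RintegralZl//; apply: eq_Rintegral => x _; exact: subr0.
move=> h; apply: cvg_trans (h _ _ _).
- apply: near_eq_cvg; apply: nearW => n /=.
  rewrite [X in _ - X](_ : _ = 0) ?subr0.
    congr (_ * _); apply: eq_Rintegral => x _; congr sin; ring.
  rewrite (@eq_Rintegral _ _ _ m setT (cst 0)) ?Rintegral_cst ?mul0r// => x _.
  by rewrite mulr0 sin0.
- exact: measurable_funM.
- exact: measurable_cst.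
- by under eq_fun do rewrite /= subr0.
Qed.

Lemma Im_laplace_le (R : realType) (zeta : probability R R) (p q : R) :
  zeta.-integrable setT (fun x => x%:E) ->
  `|complex.Im (laplace zeta p q)| <= `|q| * Rintegral zeta setT (fun z => `|z|).
Proof.
move=> iz; have inz : zeta.-integrable setT (EFin \o (fun z : R => `|z|)).
  exact: (integrable_norm iz).
rewrite /laplace /= (le_trans (le_normr_Rintegral _ _))//.
  exact: (Im_integrable zeta (laplace_integrand p q) (@laplace_integrand_le1 _ p q)).
rewrite -RintegralZl//; apply: le_Rintegral => //.
- apply: (integrable_norm (f := fun z : R => complex.Im (cexpRI (- (`|p| * `|z|)) (q * `|z|)))).
  exact: (Im_integrable zeta (laplace_integrand p q) (@laplace_integrand_le1 _ p q)).
- rewrite (_ : EFin \o _ = (fun x => `|q|%:E * `|x|%:E)%E) //.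
  exact: integrableZl.
- move=> z _ /=; rewrite normrM (ger0_norm (expR_ge0 _)).
  rewrite (@le_trans _ _ (1 * `|sin (q * `|z|)|))//.
    by rewrite ler_wpM2r// expR_le1 oppr_le0 mulr_ge0.
  by rewrite mul1r (le_trans (ler_norm_sin _))// normrM normr_id.
Qed.

(** Half-lines determine a law, so [m] is its own image under [x -> - x], and the sine is odd. *)
Lemma Im_charfun_sym (R : realType) (m : probability R R) xi :
  (forall x, m `]-oo, (- x)]%classic = m `[x, +oo[%classic) ->
  complex.Im (charfun m xi) = 0.
Proof.
move=> sym; have mN : measurable_fun setT (fun x : R => - x) by exact: measurable_funN.
pose mm := fpush mN m.
have mmT : mm setT = 1%E by rewrite fpushE preimage_setT; exact: probability_setT.
have mmE B : measurable B -> m B = mm B.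
  move=> mB; apply: (@prob_eq_halflines R m (mkprob mmT) _ B mB) => x.
  rewrite -[x in LHS]opprK sym; apply: (congr1 m).
  apply/seteqP; split => y /=; rewrite !in_itv/= ?andbT; lra.
have h : complex.Im (charfun m xi) = - complex.Im (charfun m xi).
  have ms : measurable_fun setT (fun x : R => sin (xi * x)).
    by apply: measurableT_comp measurable_sin _; exact: measurable_funM.
  have s1 (x : R) : `|sin (xi * x)| <= 1 by rewrite ler_norml sin_geN1 sin_le1.
  transitivity (Rintegral mm setT (fun x => sin (xi * x))).
    by congr fine; apply: eq_measure_integral => B mB _; exact: mmE.
  rewrite (Rintegral_fpush mN m ms s1) /charfun/=.
  rewrite -[RHS]mulN1r -RintegralZl//; last first.
    exact: (@bounded_integrable _ _ _ m _ 1).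
  by apply: eq_Rintegral => x _; rewrite mulrN sinN mulN1r.
lra.
Qed.

(* The first moments of [mu0] and [ninf] agree, in the sense of the behaviour of
   their characteristic functions at [0]: neither need be integrable. *)
Lemma matched_means (R : realType) (mu0 zeta ninf : probability R R) gam (g : R -> R[i]) :
  1 <= gam < 2 -> H_gamma_ghat mu0 gam g ->
  zeta `[0, +oo[%classic = 1%E -> (\int[zeta]_x x%:E = 1)%E ->
  (forall xi, charfun ninf xi = cint zeta `[0, +oo[ (fun z => g (xi * z `^ gam^-1))) ->
  n.+1%:R * (complex.Im (charfun mu0 n.+1%:R^-1) - complex.Im (charfun ninf n.+1%:R^-1))
    @[n --> \oo] --> (0 : R).
Proof.
move=> /andP[g1 g2] H zeta0 zeta1 ninfE.
have g0 : 0 < gam by exact: lt_le_trans g1.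
have mid : measurable_fun setT (fun x : R => x%:E) by exact/measurable_EFinP.
have iz : zeta.-integrable setT (fun x => x%:E).
  by apply: fin_num_integrable => //; rewrite zeta1.
have [a [b [a0 gE]]] : exists a b : R, 0 <= a /\ forall xi z, 0 <= z ->
    g (xi * z `^ gam^-1) =
    cexpRI (- (a * `|xi| `^ gam * z)) (b * (Num.sg xi * `|xi| `^ gam) * z).
  by apply: H_gamma_ghat_stable H; rewrite g0.
have H' := H; case: H' => [[gam1 [[im0 gE']|[c [sym [_ [_ [c0 gE']]]]]]]|[gam' [cp [cm [_ [_ [_ [m00 _]]]]]]]].
(* Integrable case of [gam = 1]: [V_oo] is [m0] times a variable of law [zeta], which has mean 1, so
   both terms tend to [m0]. *)
- set m0 := fine _ in gE'.
  have e xi : charfun ninf xi = charfun zeta (m0 * xi).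
    rewrite ninfE; apply/esym; apply: (cint_nneg zeta0 (charfun_integrand _)).
      by move=> x; rewrite normc_cos_sin.
    by move=> z z0; rewrite gE' gam1 invr1 powRr1// /cexpRI expR0 !mul1r mulrA.
  have h1 := @cvg_Im_charfun _ _ 1 im0; have h2 := @cvg_Im_charfun _ _ m0 iz.
  rewrite zeta1 /= mulr1 in h2; rewrite mul1r -/m0 in h1.
  rewrite -(subrr m0) (_ : (fun n : nat => _) =
    (fun n : nat => n.+1%:R * complex.Im (charfun mu0 (1 * n.+1%:R^-1)) -
       n.+1%:R * complex.Im (charfun zeta (m0 * n.+1%:R^-1)))); first exact: cvgB h1 h2.
  by apply/funext => n; rewrite -mulrBr mul1r e.
(* Symmetric case: both characteristic functions are real. *)
- rewrite (_ : (fun n : nat => _) = cst 0); first exact: cvg_cst.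
  apply/funext => n; rewrite Im_charfun_sym// ninfE /cint/= gE' /cexpRI/=.
  rewrite (@eq_Rintegral _ _ _ zeta _ (cst 0)); last by move=> x _; rewrite sin0 mulr0.
  by rewrite Rintegral_cst// mul0r subr0 mulr0.
(* Case [gam > 1]: [F_0] is centred, and the imaginary part for [V_oo] is of order [|xi|^gam], which
   at [xi = 1 / n.+1] outweighs the factor [n.+1]. *)
have gam1 : 1 < gam by case: gam' => /andP[]//; lra.
have im0 : mu0.-integrable setT (fun x => x%:E).
  by apply: fin_num_integrable => //; rewrite m00.
have h1 := @cvg_Im_charfun _ _ 1 im0; rewrite (m00 gam1) mulr0 in h1.
have h2 : n.+1%:R * complex.Im (charfun ninf n.+1%:R^-1) @[n --> \oo] --> (0 : R).
  set C := `|b| * Rintegral zeta setT (fun z => `|z|).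
  have hC : C * n.+1%:R^-1 `^ (gam - 1) @[n --> \oo] --> (0 : R).
    rewrite -[X in _ --> X](mulr0 C); apply: cvgMr; apply: cvg_invn_powR; lra.
  apply: norm_cvg0; apply: (squeeze_cvgr _ (cvg_cst 0) hC); apply: nearW => n.
  rewrite normr_ge0 andTb (charfun_stable zeta0 a0 gE ninfE) normrM normr_nat.
  rewrite (le_trans (ler_wpM2l _ (Im_laplace_le _ _ iz)))//.
  have n0 : (0 : R) < n.+1%:R^-1 by rewrite invr_gt0.
  rewrite !normrM normr_sg gt_eqF//= mul1r (gtr0_norm n0) (ger0_norm (powR_ge0 _ _)).
  rewrite powRB ?(gt_eqF n0) ?implybT// (powRr1 (ltW n0)) invrK /C.
  by rewrite le_eqVlt; apply/orP; left; apply/eqP; ring.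
rewrite (_ : (fun n : nat => _) =
    (fun n : nat => n.+1%:R * complex.Im (charfun mu0 (1 * n.+1%:R^-1)) -
       n.+1%:R * complex.Im (charfun ninf n.+1%:R^-1))).
  have h := cvgB h1 h2; rewrite subr0 in h; exact: h.
by apply/funext => n; rewrite -mulrBr mul1r.
Qed.

(** * Coupled evolution *)

Section measure_series.
Context d (T : measurableType d) (R : realType).

Lemma cvg_nneseries_fine (a : nat -> R) (l : \bar R) : (forall n, 0 <= a n) ->
  l \is a fin_num -> (\sum_(n <oo) (a n)%:E)%E = l ->
  \sum_(n < M) a n @[M --> \oo] --> fine l.
Proof.
move=> a0 lf al.
have h : (\sum_(0 <= n < M) (a n)%:E)%E @[M --> \oo] --> (fine l)%:E.
  rewrite fineK// -al; apply: is_cvg_nneseries => n _ _.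
  by rewrite lee_fin.
have [_ h'] := (fine_cvgP _ _).1 h.
apply: cvg_trans h'; apply: near_eq_cvg; apply: nearW => M.
by rewrite /= big_mkord sumEFin.
Qed.

Lemma nneseries_cvg (a : nat -> R) (l : R) : 
  \sum_(n < M) a n @[M --> \oo] --> l -> (\sum_(n <oo) (a n)%:E)%E = l%:E.
Proof.
move=> al; apply: cvg_lim => //.
rewrite (_ : (fun n => _) = EFin \o (fun M => \sum_(n < M) a n)).
  by apply/fine_cvgP; split; [exact: nearW|exact: al].
by apply/funext => M; rewrite /= big_mkord sumEFin.
Qed.

Variable m : nat -> {finite_measure set T -> \bar R}.
Hypothesis m1 : \sum_(n < M) fine (m n setT) @[M --> \oo] --> (1 : R).

Let ms := mseries (fun n => m n : {measure set T -> \bar R}) 0.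

Let msT : ms setT = 1%E.
Proof.
rewrite /ms /mseries; have <- := @nneseries_cvg (fun n => fine (m n setT)) 1 m1; apply: eq_eseriesr => n _.
by rewrite fineK// fin_num_measure.
Qed.

Definition prob_series : probability T R := mkprob msT.

Lemma ge0_integral_prob_series (f : T -> \bar R) : measurable_fun setT f ->
  (forall x, 0 <= f x)%E ->
  (\int[prob_series]_x f x = \sum_(n <oo) \int[m n]_x f x)%E.
Proof.
move=> mf f0.
exact: (ge0_integral_measure_series (fun n => m n : {measure set T -> \bar R}) measurableT).
Qed.

Lemma cvg_Rintegral_prob_series (f : T -> R) C : measurable_fun setT f ->
  (forall x, `|f x| <= C) ->
  \sum_(n < M) Rintegral (m n) setT f @[M --> \oo] --> Rintegral prob_series setT f.
Proof.
move=> mf fC; have mF : measurable_fun setT (fun x => (f x + C)%:E).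
  by apply/measurable_EFinP; exact: measurable_funD.
have F0 x : 0 <= f x + C.
  by rewrite -lerBlDr sub0r; have := fC x; rewrite ler_norml => /andP[].
have ffin (mm : {finite_measure set T -> \bar R}) : (\int[mm]_x (f x + C)%:E)%E \is a fin_num.
  apply: integrable_fin_num => //.
  apply: (@bounded_integrable _ _ _ mm (fun x => f x + C) (C + `|C|)).
    exact: measurable_funD.
  by move=> x; rewrite (le_trans (ler_normD _ _))// lerD.
have h : \sum_(n < M) fine (\int[m n]_x (f x + C)%:E)%E @[M --> \oo] -->
    fine (\int[prob_series]_x (f x + C)%:E)%E.
  apply: (@cvg_nneseries_fine (fun n => fine (\int[m n]_x (f x + C)%:E)%E)).
  - by move=> n; apply: fine_ge0; apply: integral_ge0 => x _; rewrite lee_fin.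
  - exact: (ffin prob_series).
  rewrite ge0_integral_prob_series//; apply: eq_eseriesr => n _.
  by rewrite fineK.
rewrite (Rintegral_shift prob_series mf fC).
have -> : fine (prob_series setT) = 1 by exact: (congr1 fine (probability_setT prob_series)).
rewrite (_ : (fun M => _) = (fun M => \sum_(n < M) fine (\int[m n]_x (f x + C)%:E)%E -
    C * \sum_(n < M) fine (m n setT))).
  by apply: cvgB => //; apply: cvgMr.
apply/funext => M; rewrite mulr_sumr -sumrB; apply: eq_bigr => n _.
exact: Rintegral_shift.
Qed.

Lemma cvg_part_cint_prob_series k (f : T -> R[i]) C : cmeasurable f -> cbounded f C ->
  \sum_(n < M) part k (cint (m n) setT f) @[M --> \oo] --> part k (cint prob_series setT f).
Proof.
move=> [f1 f2] fC; case: k; apply: (@cvg_Rintegral_prob_series _ C) => // x.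
- exact: le_trans (Re_le_normc _) (fC x).
- exact: le_trans (Im_le_normc _) (fC x).
Qed.

End measure_series.

Section coupling.
Context d (Om : measurableType d) (R : realType) (P : probability Om R).
Variables (A : nat -> Om -> R) (N : nat).
Hypothesis mA : forall i, measurable_fun setT (A i).
Hypothesis N2 : (1 < N)%N.
Local Notation E := (R * R)%type.
Variable s0 : probability E R.

Let b : R := N.-1%:R.
Let al : R := b^-1.

Let b0 : 0 < b. Proof. by rewrite ltr0n -ltnS prednK// ltnW. Qed.
Let al0 : 0 < al. Proof. by rewrite invr_gt0. Qed.
Let alb : al * b = 1. Proof. by rewrite mulVf// gt_eqF. Qed.
Let Nb : N%:R = 1 + b. Proof. by rewrite /b nat1r prednK// ltnW. Qed.
Let Nal : N%:R * al = al + 1. Proof. by rewrite Nb mulrDl mul1r mulrC alb. Qed.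

(** Both coordinates share the tree and its weights: this is the coupling. *)
Let op (z : E) (a : R) (z' : E) : E := (z.1 + a * z'.1, z.2 + a * z'.2).
Let z0 : E := (0, 0).

Let mop : measurable_fun setT (fun p : E * R * E => op p.1.1 p.1.2 p.2).
Proof.
have m1 : measurable_fun setT (fun p : E * R * E => p.1.1).
  exact: (measurableT_comp measurable_fst measurable_fst).
have ma : measurable_fun setT (fun p : E * R * E => p.1.2).
  exact: (measurableT_comp measurable_snd measurable_fst).
have m2 : measurable_fun setT (fun p : E * R * E => p.2) by exact: measurable_snd.
apply/measurable_fun_pairP; split => /=.
- apply: measurable_funD; first exact: (measurableT_comp measurable_fst m1).
  by apply: measurable_funM => //; exact: (measurableT_comp measurable_fst m2).
- apply: measurable_funD; first exact: (measurableT_comp measurable_snd m1).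
  by apply: measurable_funM => //; exact: (measurableT_comp measurable_snd m2).
Qed.

Local Notation tree := (tree P mA z0 mop N al0 s0).

Section at_time.
Variable t : R.
Hypothesis t0 : 0 <= t.

Let w n : {nonneg R} :=
  NngNum (mulr_ge0 (expR_ge0 (- t)) (exprn_ge0 n (utime_ge0 b0 t0))).

Let wm n := fscale (w n) (tree n).

(** The masses sum to [(1 - u)^-al = exp t], as [al b = 1]. *)
Let wm1 : \sum_(n < M) fine (wm n setT) @[M --> \oo] --> (1 : R).
Proof.
have h : expR (- t) * psum b (rbin al) M t @[M --> \oo] --> expR (- t) * expR (al * b * t).
  by have h0 := cvg_rbin_psum b0 (ltW al0) t0; apply: cvgMr; exact: h0.
rewrite alb mul1r -expRD addNr expR0 in h; apply: cvg_trans h.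
apply: near_eq_cvg; apply: nearW => M /=; rewrite /psum mulr_sumr.
apply: eq_bigr => n _; rewrite /wm fscaleE (tree_mass P mA z0 mop al0 Nal) -EFinM /=.
by rewrite -mulrA [_ * rbin _ _]mulrC.
Qed.

Definition coupled_law : probability E R := prob_series wm1.

(** [tree_cost] with shift 0 and scale 1: what remains is [exp (- t)] times the series of
    [(1 - u)^-(S al) = exp (S t)]. *)
Lemma coupling_cost (K del : R) (D : E -> R) (SA : nat -> R) :
  0 <= K -> 0 < del -> (forall j w, 0 <= A j w) ->
  measurable_fun setT D -> D (0, 0) = 0 ->
  (forall z b z', D (op z b z') = D z + b * D z') ->
  (forall j, (j < N)%N -> (\int[P]_w (A j w `^ del)%:E = (SA j)%:E)%E) ->
  (forall y b : R, 0 <= b ->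
    (\int[s0]_z (`|y + b * D z| `^ del)%:E <= (`|y| `^ del + b `^ del * K)%:E)%E) ->
  (\int[coupled_law]_z (`|D z| `^ del)%:E <= (K * expR ((\sum_(j < N) SA j - 1) * t))%:E)%E.
Proof.
move=> K0 del0 A0 mD Dz0 Dop SAE sc; set S := \sum_(j < N) SA j.
have S0 : 0 <= S.
  apply: sumr_ge0 => -[j jN] _ /=; rewrite -lee_fin -SAE//.
  by apply: integral_ge0 => ? _; rewrite lee_fin powR_ge0.
have mf : measurable_fun setT (fun z => (`|D z| `^ del)%:E) by exact: measurable_powR_norm.
have f0 z : (0 <= (`|D z| `^ del)%:E)%E by rewrite lee_fin powR_ge0.
rewrite ge0_integral_prob_series//.
have term n : (\int[wm n]_z (`|D z| `^ del)%:E <=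
    (expR (- t) * utime b t ^+ n * (K * rbin (S * al) n))%:E)%E.
  have -> : (\int[wm n]_z (`|D z| `^ del)%:E =
      (expR (- t) * utime b t ^+ n)%:E * \int[tree n]_z (`|D z| `^ del)%:E)%E.
    exact: ge0_integral_mscale.
  rewrite (EFinM (expR (- t) * utime b t ^+ n)); apply: lee_wpmul2l.
    by rewrite lee_fin mulr_ge0 ?expR_ge0 ?exprn_ge0 ?utime_ge0.
  have h := @tree_cost _ _ _ _ _ _ _ mA _ _ mop _ _ al0 Nal s0 K del D SA n 0 1
    K0 del0 A0 mD Dz0 Dop SAE sc ler01.
  rewrite normr0 powR0 ?gt_eqF// mulr0 add0r powR1 mul1r in h.
  by under eq_integral do rewrite -[D _]mul1r -[1 * D _]add0r.
apply: lime_le; first by apply: is_cvg_nneseries => n _ _; exact: integral_ge0.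
apply: nearW => M; apply: le_trans (lee_sum _ (fun n _ => term n)) _.
rewrite big_mkord sumEFin lee_fin.
rewrite (_ : \sum_(i < M) _ = K * (expR (- t) * psum b (rbin (S * al)) M t)); last first.
  by rewrite /psum !mulr_sumr; apply: eq_bigr => n _; ring.
rewrite ler_wpM2l// mulrBl mul1r expRD mulrC [leRHS]mulrC mulrC ler_wpM2l ?expR_ge0//.
have := rbin_psum_le b0 M (mulr_ge0 S0 (ltW al0)) t0.
by rewrite -(mulrA S) alb mulr1.
Qed.

Section marginal.
Variable proj : E -> R.
Hypothesis mproj : measurable_fun setT proj.
Hypothesis proj0 : proj (0, 0) = 0.
Hypothesis projD : forall z a z', proj (op z a z') = proj z + a * proj z'.

Let e (xi : R) (z : E) : R[i] := (cos (xi * proj z) +i* sin (xi * proj z))%C.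

Let me xi : cmeasurable (e xi).
Proof. exact: cmeasurable_comp mproj (charfun_integrand xi). Qed.

Let e1 xi : cbounded (e xi) 1.
Proof. by move=> z; rewrite /e normc_cos_sin. Qed.

Let c xi n := cint (tree n) setT (e xi).

Let mc n : cmeasurable (fun xi => c xi n).
Proof.
have mm : measurable_fun setT (fun r : R * E => r.1 * proj r.2).
  by apply: measurable_funM => //; exact: measurableT_comp.
apply: (@cmeasurable_cint _ _ _ _ _ (fpush measurable_fst s0) (tree n)
  (fun r : R * E => e r.1 r.2) 1); last by move=> r; exact: e1.
split => /=; first exact: (measurableT_comp measurable_cos mm).
exact: (measurableT_comp measurable_sin mm).
Qed.

Let cb xi n : normc (c xi n) <= rbin al n.
Proof.
have := normc_cint_bound (tree n) (me xi) (@e1 xi).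
by rewrite (tree_mass P mA z0 mop al0 Nal) mul1r.
Qed.

Let crec xi n : n.+1%:R * c xi n.+1 =
  al%:C%C * cint P setT (fun w => fcoef (fun j m => c (A j w * xi) m) N n).
Proof.
rewrite /c (@cint_treeS _ _ _ _ _ P _ mA _ _ mop _ _ al0 s0 n _ 1 (me xi) (@e1 xi)).
pose e' (a : R) (z : E) := e (a * xi) z.
have me' : cmeasurable (fun r : R * E => e' r.1 r.2).
  have mm : measurable_fun setT (fun r : R * E => r.1 * xi * proj r.2).
    by apply: measurable_funM; [exact: measurable_funM|exact: measurableT_comp].
  split => /=; first exact: (measurableT_comp measurable_cos mm).
  exact: (measurableT_comp measurable_sin mm).
have e'1 a : cbounded (e' a) 1 by exact: e1.
have ez0 : e xi z0 = 1 by rewrite /e proj0 mulr0 cos0 sin0.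
have eop z a z' : e xi (op z a z') = e xi z * e' a z'.
  rewrite /e /e' /e projD; apply: complex_eq; rewrite ?re_mul ?im_mul /=.
  - by rewrite mulrDr cosD !mulrA [a * xi]mulrC.
  - by rewrite mulrDr sinD !mulrA [a * xi]mulrC; ring.
have := @cint_forest_factor _ _ _ _ _ P A mA op z0 mop (e xi) e' (me xi) me'
  (@e1 xi) e'1 ez0 eop tree N n (fun=> 1) 1 (@cmeasurable_cst _ _ _ 1) _.
move=> h; rewrite (_ : cint _ setT (fun p => e xi p.2) =
  cint (forest P mA z0 mop tree N n) setT (fun r : Om * E => 1 * e xi r.2)); last first.
  by congr (cint _ _ _); apply/funext => r; rewrite mul1r.
rewrite h; last by move=> x; rewrite ComplexField.Normc.normc1.
rewrite mulrA; congr (_ * _).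
  have n0 : n.+1%:R != 0 :> R by rewrite pnatr_eq0.
  have -> : (n.+1%:R : R[i]) = (n.+1%:R : R)%:C%C by rewrite rmorph_nat.
  by rewrite -rmorphM /= mulrCA divff// mulr1.
by congr (cint _ _ _); apply/funext => x; rewrite mul1r.
Qed.

(** For either coordinate. Both sides are limits of the same partial sums, by the definition of the
    mixture on the left and by uniqueness for the Cauchy problem on the right. *)
Lemma coupling_marginal phi : cauchy_solution P A N phi ->
  (forall xi, phi 0 xi = cint s0 setT (fun z => (cos (xi * proj z) +i* sin (xi * proj z))%C)) ->
  forall xi, cint coupled_law setT (fun z => (cos (xi * proj z) +i* sin (xi * proj z))%C) = phi t xi.
Proof.
move=> phis phi0 xi.
suff h k : part k (cint coupled_law setT (e xi)) = part k (phi t xi).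
  by apply: complex_eq; [exact: (h true)|exact: (h false)].
apply: (@cvg_unique _ (@Rhausdorff R) (\sum_(n < M) part k (cint (wm n) setT (e xi)) @[M --> \oo])).
  exact: cvg_part_cint_prob_series (me xi) (@e1 xi).
have := @cauchy_solution_series _ _ _ _ _ _ mA _ _ al0 b0 alb Nb _ mc cb crec _ phis phi0 k t xi t0.
apply: cvg_trans; apply: near_eq_cvg; apply: nearW => M.
rewrite /partial partZ part_csum mulr_sumr; apply: eq_bigr => n _.
rewrite (cint_fscale _ _ (me xi) (@e1 xi)) partZ /= /c.
by rewrite -mulrA [_ * utime _ _ ^+ _]mulrC.
Qed.

End marginal.
End at_time.
End coupling.

(** * Laws, transport cost and the estimate at a leaf *)

Lemma Rintegral_law d (T : measurableType d) (R : realType) (Q : probability T R)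
    (X : T -> R) (m : probability R R) (f : R -> R) M : has_law Q X m ->
  measurable_fun setT f -> (forall x, `|f x| <= M) ->
  Rintegral Q setT (fun w => f (X w)) = Rintegral m setT f.
Proof.
move=> [mX Xm] mf fM; rewrite -(Rintegral_fpush mX Q mf fM).
by congr fine; apply: eq_measure_integral => B mB _; exact: Xm.
Qed.

Lemma has_law_charfun d (T : measurableType d) (R : realType) (Q : probability T R)
    (X : T -> R) (m : probability R R) : measurable_fun setT X ->
  (forall xi, cint Q setT (fun w => (cos (xi * X w) +i* sin (xi * X w))%C) = charfun m xi) ->
  has_law Q X m.
Proof.
move=> mX Xm; split => // B mB.
pose q := fpush mX Q.
have q1 : q setT = 1%E by rewrite fpushE preimage_setT; exact: probability_setT.
apply: (@charfun_inj R (mkprob q1) m _ B mB) => xi.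
rewrite -Xm; apply: (cint_fpush mX Q (charfun_integrand xi) (M := 1)) => x.
by rewrite normc_cos_sin.
Qed.

Lemma charfun_law d (T : measurableType d) (R : realType) (Q : probability T R)
    (X : T -> R) (m : probability R R) xi : has_law Q X m ->
  cint Q setT (fun w => (cos (xi * X w) +i* sin (xi * X w))%C) = charfun m xi.
Proof.
move=> Xm; have [m1 m2] := charfun_integrand xi.
congr (_ +i* _)%C.
- by apply: (Rintegral_law Xm m1 (M := 1)) => x; rewrite ler_norml cos_geN1 cos_le1.
- by apply: (Rintegral_law Xm m2 (M := 1)) => x; rewrite ler_norml sin_geN1 sin_le1.
Qed.

Lemma poweR_Wdist (R : realType) (m1 m2 : set R -> \bar R) (delta : R) :
  poweR (Wdist m1 m2 delta) (Num.max delta 1) = Wcost m1 m2 delta.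
Proof.
have m0 : 0 < Num.max delta 1 by rewrite lt_max ltr01 orbT.
rewrite /Wdist -poweRrM mulVf ?gt_eqF// poweRe1//.
apply: le_ereal_inf_tmp => _ [d [T [Q [X [Y [_ [_ ->]]]]]]].
by apply: integral_ge0 => w _; rewrite lee_fin powR_ge0.
Qed.

(** Couplings of infinite cost impose nothing, so the estimates may start from a real cost [r]. *)
Lemma le_Wcost (R : realType) (m1 m2 m3 m4 : set R -> \bar R) (delta C : R) : 0 < C ->
  (forall d (T : measurableType d) (Q : probability T R) (X Y : T -> R) (r : R),
    has_law Q X m1 -> has_law Q Y m2 -> (\int[Q]_w (`|X w - Y w| `^ delta)%:E = r%:E)%E ->
    (Wcost m3 m4 delta <= (C * r)%:E)%E) ->
  (Wcost m3 m4 delta <= C%:E * Wcost m1 m2 delta)%E.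
Proof.
move=> C0 h; rewrite -lee_pdivrMl//.
apply: le_ereal_inf_tmp => r [d [T [Q [X [Y [Xm [Ym rE]]]]]]].
have r0 : (0 <= r)%E.
  by rewrite rE; apply: integral_ge0 => w _; rewrite lee_fin powR_ge0.
case: r r0 rE => [r r0 rE|_ _|//]; last by rewrite leey.
by rewrite lee_pdivrMl// -EFinM; apply: h Xm Ym _.
Qed.

Section leaf.
Context d (T : measurableType d) (R : realType) (Q : probability T R).
Variables (D : T -> R) (delta r : R).
Hypotheses (mD : measurable_fun setT D) (delta0 : 0 < delta).
Hypothesis rE : (\int[Q]_w (`|D w| `^ delta)%:E = r%:E)%E.

Let mDp : measurable_fun setT (fun w => (`|D w| `^ delta)%:E).
Proof. exact: measurable_powR_norm. Qed.

Let integral_cst_prob (y : R) : (\int[Q]_w y%:E = y%:E)%E.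
Proof.
rewrite (integral_cst Q measurableT y%:E) -[RHS]mule1; congr (_ * _)%E.
exact: probability_setT.
Qed.

Lemma leaf_le1 (y b : R) : delta <= 1 -> 0 <= b ->
  (\int[Q]_w (`|y + b * D w| `^ delta)%:E <= (`|y| `^ delta + b `^ delta * r)%:E)%E.
Proof.
move=> delta1 b0.
have p0 (x : R) : (0 <= (x `^ delta)%:E)%E by rewrite lee_fin powR_ge0.
rewrite EFinD EFinM -rE -(integral_cst_prob (`|y| `^ delta)) -ge0_integralZl//.
rewrite -ge0_integralD//; last 2 first.
- by move=> w _; rewrite mule_ge0.
- exact: measurable_funeM.
apply: ge0_le_integral => //.
- apply: measurable_powR_norm; apply: measurable_funD => //; exact: measurable_funM.
- apply: emeasurable_funD => //; exact: measurable_funeM.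
move=> w _; rewrite -EFinM -EFinD lee_fin.
apply: (@le_trans _ _ ((`|y| + b * `|D w|) `^ delta)).
  rewrite ge0_ler_powR ?nnegrE ?addr_ge0 ?mulr_ge0 ?(ltW delta0)//.
  by rewrite (le_trans (ler_normD _ _))// normrM (ger0_norm b0).
rewrite (le_trans (powR_subadditive _ _ _)) ?mulr_ge0 ?delta0//.
by rewrite powRM.
Qed.

(** From [|x| <= 1 + |x|^delta]. *)
Lemma integrable_of_moment : 1 <= delta -> Q.-integrable setT (EFin \o D).
Proof.
move=> delta1; apply/integrableP; split; first exact/measurable_EFinP.
apply: (@le_lt_trans _ _ (\int[Q]_w (1%:E + (`|D w| `^ delta)%:E))%E).
  apply: ge0_le_integral => //.
  - by apply: measurableT_comp => //; exact/measurable_EFinP.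
  - by apply: emeasurable_funD => //; exact: measurable_cst.
  move=> w _; rewrite /= -EFinD lee_fin.
  have [D1|D1] := leP `|D w| 1; first by rewrite (le_trans D1)// lerDl powR_ge0.
  rewrite (@le_trans _ _ (`|D w| `^ delta)) ?lerDr//.
  by rewrite -[leLHS]powRr1// ler_powR// ltW.
rewrite ge0_integralD//.
by rewrite integral_cst_prob rE -EFinD ltry.
Qed.

(** The linear term of the von Bahr-Esseen bound vanishes because [D] is centred. This is where the
    constant 2 of the theorem arises. *)
Lemma leaf_gt1 (y b : R) : 1 < delta <= 2 -> Rintegral Q setT D = 0 -> 0 <= b ->
  (\int[Q]_w (`|y + b * D w| `^ delta)%:E <= (`|y| `^ delta + b `^ delta * (2 * r))%:E)%E.
Proof.
move=> /andP[delta1 delta2] D0 b0.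
have [|k hk] := @von_bahr_esseen R delta y; first by rewrite (ltW delta1).
have iD := integrable_of_moment (ltW delta1).
have ip : Q.-integrable setT (EFin \o (fun w => `|D w| `^ delta)).
  by apply: fin_num_integrable => //; rewrite rE.
have ic : Q.-integrable setT (EFin \o cst (`|y| `^ delta)).
  by apply: (@bounded_integrable _ _ _ Q (cst (`|y| `^ delta)) (Num.norm (`|y| `^ delta))).
have iZ (c : R) (f : T -> R) : Q.-integrable setT (EFin \o f) ->
    Q.-integrable setT (EFin \o (fun w => c * f w)).
  move=> if_; rewrite (_ : EFin \o _ = (fun w => c%:E * (f w)%:E)%E)//.
  exact: integrableZl.
have iDD (f g : T -> R) : Q.-integrable setT (EFin \o f) -> Q.-integrable setT (EFin \o g) ->
    Q.-integrable setT (EFin \o (fun w => f w + g w)).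
  move=> if_ ig; rewrite (_ : EFin \o _ = (fun w => (f w)%:E + (g w)%:E)%E)//.
  exact: integrableD.
pose F w := `|y| `^ delta + (k * b) * D w + (2 * b `^ delta) * `|D w| `^ delta.
have iF : Q.-integrable setT (EFin \o F).
  by apply: (iDD _ (fun w => _)); [apply: (iDD (cst _) (fun w => _)) => //|]; exact: iZ.
apply: (@le_trans _ _ (\int[Q]_w (F w)%:E)%E).
  apply: ge0_le_integral => //.
  - apply: measurable_powR_norm; apply: measurable_funD => //; exact: measurable_funM.
  - by case/integrableP: iF.
  move=> w _; rewrite lee_fin (le_trans (hk _))// /F normrM (ger0_norm b0) powRM//.
  by rewrite !mulrA.
rewrite -[leLHS]fineK; last exact: integrable_fin_num iF.
rewrite lee_fin -/(Rintegral Q setT F) /F RintegralD//; last 2 first.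
- by apply: (iDD (cst _) (fun w => _)) => //; exact: iZ.
- exact: iZ.
rewrite RintegralD//; last exact: iZ.
rewrite !RintegralZl// D0 mulr0 addr0.
have -> : Rintegral Q setT (fun w => `|D w| `^ delta) = r by rewrite /Rintegral rE.
have -> : Rintegral Q setT (fun=> `|y| `^ delta) = `|y| `^ delta.
  by rewrite /Rintegral integral_cst_prob.
by rewrite lerD2l mulrCA mulrA.
Qed.

End leaf.

(** * Contraction of the transport cost *)

Section contraction.
Context d (Om : measurableType d) (R : realType) (P : probability Om R).
Variables (A : nat -> Om -> R) (N : nat).
Hypothesis mA : forall i, measurable_fun setT (A i).
Hypothesis A0 : forall i w, 0 <= A i w.
Hypothesis N2 : (1 < N)%N.
Variables (delta : R) (SA : nat -> R).
Hypothesis delta0 : 0 < delta.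
Hypothesis SAE : forall j, (j < N)%N -> (\int[P]_w (A j w `^ delta)%:E = (SA j)%:E)%E.
Variables (mu0 ninf : probability R R) (nu : R -> probability R R) (mu : R).
Hypothesis nus : cauchy_solution P A N (fun t xi => charfun (nu t) xi).
Hypothesis nu0 : forall xi, charfun (nu 0) xi = charfun mu0 xi.
Hypothesis ninfs : cauchy_solution P A N (fun t xi => charfun ninf (expR (mu * t) * xi)).
Context d' (T : measurableType d') (Q : probability T R) (X Y : T -> R) (K : R).
Hypotheses (Xm : has_law Q X mu0) (Ym : has_law Q Y ninf) (K0 : 0 <= K).
Hypothesis leaf : forall y b : R, 0 <= b ->
  (\int[Q]_w (`|y + b * (X w - Y w)| `^ delta)%:E <= (`|y| `^ delta + b `^ delta * K)%:E)%E.

Let mXY : measurable_fun setT (fun w => (X w, Y w)).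
Proof. by apply/measurable_fun_pairP; split; [exact: Xm.1|exact: Ym.1]. Qed.

Let s0T : fpush mXY Q setT = 1%E.
Proof. by rewrite fpushE preimage_setT; exact: probability_setT. Qed.

Let s0 := mkprob s0T.

Let diff (z : R * R) := z.1 - z.2.

Let mdiff : measurable_fun setT diff.
Proof. by apply: measurable_funB; [exact: measurable_fst|exact: measurable_snd]. Qed.

(** Under the coupled law the coordinates have the laws of [V_t] and of [exp (mu t) V_oo].
    Multiplying both by [exp (- mu t)] yields a competitor in the infimum, at the price of the
    factor [exp (- mu delta t)]. *)
Lemma Wcost_contraction t : 0 <= t ->
  (Wcost (scale_law (expR (- (mu * t))) (nu t)) ninf delta <=
    (K * expR ((\sum_(j < N) SA j - 1) * t - mu * delta * t))%:E)%E.
Proof.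
move=> t0; pose L := coupled_law P mA N2 s0 t0.
have m1 : measurable_fun setT (fst : R * R -> R) by exact: measurable_fst.
have m2 : measurable_fun setT (snd : R * R -> R) by exact: measurable_snd.
have s0E (f : R * R -> R[i]) : cmeasurable f -> cbounded f 1 ->
    cint s0 setT f = cint Q setT (fun w => f (X w, Y w)).
  by move=> mf f1; exact: (cint_fpush mXY Q mf f1).
have L1 : has_law L fst (nu t).
  apply: (has_law_charfun m1) => xi.
  apply: (coupling_marginal mA N2 t0 m1 _ _ nus) => // xi'.
  rewrite nu0 -(charfun_law xi' Xm) s0E//.
  - exact: cmeasurable_comp m1 (charfun_integrand xi').
  - by move=> z; rewrite normc_cos_sin.
have me (c : R) : measurable_fun setT (fun x : R => c * x) by exact: measurable_funM.
have ninf1 : fpush (me (expR (mu * t))) ninf setT = 1%E.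
  by rewrite fpushE preimage_setT; exact: probability_setT.
have L2 : has_law L snd (mkprob ninf1).
  apply: (has_law_charfun m2) => xi.
  rewrite (coupling_marginal mA N2 t0 m2 _ _ ninfs)//.
    rewrite [RHS](cint_fpush (me (expR (mu * t))) ninf (charfun_integrand xi) (M := 1)).
      by congr (cint _ _ _); apply/funext => x; rewrite mulrA [xi * _]mulrC.
    by move=> x; rewrite normc_cos_sin.
  move=> xi'; rewrite mulr0 expR0 mul1r -(charfun_law xi' Ym) s0E//.
  - exact: cmeasurable_comp m2 (charfun_integrand xi').
  - by move=> z; rewrite normc_cos_sin.
set e := expR (- (mu * t)).
have e0 : 0 <= e by exact: expR_ge0.
have mf : measurable_fun setT (fun z => (`|diff z| `^ delta)%:E) by exact: measurable_powR_norm.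
have cost : (\int[L]_z (`|diff z| `^ delta)%:E <= (K * expR ((\sum_(j < N) SA j - 1) * t))%:E)%E.
  apply: (coupling_cost mA N2 t0 K0 delta0 A0 mdiff _ _ SAE).
  - by rewrite /diff subrr.
  - by move=> z b z'; rewrite /diff/=; ring.
  - move=> y b b0; apply: le_trans (leaf y b0).
    rewrite [leLHS](ge0_integral_fpush mXY Q)//.
      by apply: measurable_powR_norm; apply: measurable_funD => //; exact: measurable_funM.
apply: (@le_trans _ _ (\int[L]_z (`|e * z.1 - e * z.2| `^ delta)%:E)%E).
  apply: ereal_inf_lbound; exists _, _, L, (fun z => e * z.1), (fun z => e * z.2).
  split; last split => //.
  - split; first exact: measurable_funM.
    move=> B mB; rewrite /scale_law -L1.2//.
    by have := me e measurableT _ mB; rewrite setTI.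
  - split; first exact: measurable_funM.
    move=> B mB.
    transitivity (L (snd @^-1` ((fun x => e * x) @^-1` B))) => //.
    rewrite L2.2; last by have := me e measurableT _ mB; rewrite setTI.
    rewrite /= /mkprob/=; apply: (congr1 ninf); apply/seteqP; split => x /=;
      by rewrite mulrA -expRD addNr expR0 mul1r.
have -> : (\int[L]_z (`|e * z.1 - e * z.2| `^ delta)%:E =
    (e `^ delta)%:E * \int[L]_z (`|diff z| `^ delta)%:E)%E.
  rewrite -ge0_integralZl//; last by rewrite lee_fin powR_ge0.
  apply: eq_integral => z _; rewrite -EFinM -mulrBr normrM (ger0_norm e0).
  by rewrite powRM.
apply: le_trans (lee_wpmul2l _ cost) _; first by rewrite lee_fin powR_ge0.
rewrite -EFinM lee_fin le_eqVlt; apply/orP; left; apply/eqP.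
rewrite /e -expRM mulrCA -expRD; congr (_ * expR _); ring.
Qed.

End contraction.

(** For [s != 0] the convention [0^s = 0] agrees with [powR], and finiteness of the sum gives that
    of each moment. *)
Lemma Qfun_moments d (Om : measurableType d) (R : realType) (P : probability Om R)
    (N : nat) (A : 'I_N -> Om -> R) (s : R) : s != 0 ->
  (forall i, measurable_fun setT (A i)) -> Qfun P A s \is a fin_num ->
  (forall i, (\int[P]_w (A i w `^ s)%:E)%E \is a fin_num) /\
  fine (Qfun P A s) = \sum_(i < N) fine (\int[P]_w (A i w `^ s)%:E)%E - 1.
Proof.
move=> s0 mA; have QE : Qfun P A s = (\sum_(i < N) \int[P]_w (A i w `^ s)%:E - 1)%E.
  rewrite /Qfun -ge0_integral_sum//; last 2 first.
  - by move=> i; apply/measurable_EFinP; exact: (measurableT_comp (measurable_powR s) (mA i)).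
  - by move=> i w _; rewrite lee_fin powR_ge0.
  congr (_ - _)%E; apply: eq_integral => w _; rewrite sumEFin; congr EFin.
  apply: eq_bigr => i _; rewrite /pow0; case: eqVneq => // ->.
  by rewrite powR0.
rewrite QE fin_numB => /andP[Sfin _].
have ifin i : (\int[P]_w (A i w `^ s)%:E)%E \is a fin_num.
  by move: Sfin; rewrite (bigD1 i)//= fin_numD => /andP[].
split=> //; rewrite fineB//; congr (_ - _).
by rewrite -sum_fine.
Qed.

(** [Q >= -1] excludes [-oo], and the strict inequality excludes [+oo]: so [mu(delta) < mu(gamma)]
    makes [Q(delta)] finite. *)
Lemma mufun_lt_fin_num d (Om : measurableType d) (R : realType) (P : probability Om R)
    (N : nat) (A : 'I_N -> Om -> R) (s : R) (x : \bar R) : 0 < s ->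
  (mufun P A s < x)%E -> Qfun P A s \is a fin_num.
Proof.
move=> s0 mulx; rewrite fin_numE; apply/andP; split; apply/negP => /eqP.
- move=> Qn; have : (-1 <= Qfun P A s)%E.
    rewrite /Qfun -[leLHS]add0e leeD2r//; apply: integral_ge0 => w _.
    rewrite lee_fin; apply: sumr_ge0 => i _; rewrite /pow0.
    by case: ifP => // _; rewrite powR_ge0.
  by rewrite Qn.
- move=> Qp; move: mulx; rewrite /mufun Qp gt0_mulye ?lte_fin ?invr_gt0//.
  by rewrite ltNge leey.
Qed.

Lemma fine_mufun d (Om : measurableType d) (R : realType) (P : probability Om R)
    (N : nat) (A : 'I_N -> Om -> R) (s : R) : Qfun P A s \is a fin_num ->
  fine (mufun P A s) = fine (Qfun P A s) / s.
Proof. by move=> Qf; rewrite /mufun fineM. Qed.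

Unset Implicit Arguments.

Theorem theorem3 (R : realType) (d : measure_display) (Om : measurableType d)
  (P : probability Om R) (N : nat) (A : 'I_N -> Om -> R)
  (gam delta : R) (mu0 : probability R R) (g : R -> R[i])
  (zeta : probability R R) (nu : R -> probability R R)
  (ninf : probability R R) :
  (2 <= N)%N ->
  (forall i, measurable_fun setT (A i)) ->
  (forall i w, 0 <= A i w) ->
  (P [set w | (\sum_(i < N) nat_of_bool (0 < A i w)%R)%N \in [:: 0%N; 1%N]] < 1)%E ->
  (1 < \int[P]_w (\sum_(i < N) (nat_of_bool (0 < A i w)%R)%:R)%:E)%E ->
  (P [set w | forall i, A i w = 0%R \/ A i w = 1%R] < 1)%E ->
  0 < gam < 2 ->
  H_gamma_ghat mu0 gam g ->
  Qfun P A gam \is a fin_num ->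
  gam < delta ->
  ((1 <= gam /\ delta <= 2) \/ delta <= 1) ->
  (mufun P A delta < mufun P A gam)%E ->
  solves_cauchy P A mu0 nu ->
  is_zeta_infty P A gam zeta ->
  (forall xi, charfun ninf xi =
     cint zeta `[0, +oo[ (fun z => g (xi * z `^ gam^-1))) ->
  forall t, 0 <= t ->
    (poweR (Wdist (scale_law (expR (- (fine (mufun P A gam) * t)))%R (nu t))
                  ninf delta) (Num.max delta 1)%R
     <= (if (delta <= 1)%R then 1%R else 2%R)%:E
        * poweR (Wdist mu0 ninf delta) (Num.max delta 1)%R
        * (expR (- (t * delta * (fine (mufun P A gam) - fine (mufun P A delta)))))%R%:E)%E.
Proof.
move=> N2 mA A0 _ _ _ /andP[gam0 gam2] H Qg gd dle mulmu [nu0 cs] [zeta0 [zeta1 zetaE]] ninfE t t0.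
have delta0 : 0 < delta by exact: lt_trans gd.
have Qd := mufun_lt_fin_num delta0 mulmu.
have [dfin QdE] := Qfun_moments (lt0r_neq0 delta0) mA Qd.
rewrite !poweR_Wdist !fine_mufun//.
set Qgam := fine (Qfun P A gam).
(* The recursion over children is indexed by naturals; indices from [N] on receive the weight 0. *)
pose B (j : nat) w : R := oapp (fun i : 'I_N => A i w) 0 (insub j).
have BE (i : 'I_N) w : B i w = A i w by rewrite /B valK.
have mB j : measurable_fun setT (B j).
  by rewrite /B; case: (insub j) => [i|] /=; [exact: mA|exact: measurable_cst].
have B0 j w : 0 <= B j w by rewrite /B; case: (insub j) => [i|] /=.
have prodB (F : R -> R[i]) (G : R -> R) w :
    \prod_(i < N) F (G (A i w)) = \prod_(i < N) F (G (B i w)).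
  by apply: eq_bigr => i _; rewrite BE.
have nus : cauchy_solution P B N (fun t xi => charfun (nu t) xi).
  split=> [s|s xi|xi]; [exact: cmeasurable_charfun|exact: normc_charfun_le1|].
  have [cr [ci cd]] := cs xi; split=> //; split=> // s s0.
  have [dr [di ->]] := cd s s0; split=> //; split=> //.
  by congr (cint _ _ _); apply/funext => w; exact: (prodB (charfun (nu s)) (fun a => a * xi)).
have [a [b [a0 gE]]] := H_gamma_ghat_stable (introT andP (conj gam0 gam2)) H.
have ninfs : cauchy_solution P B N (fun t xi => charfun ninf (expR (Qgam / gam * t) * xi)).
  apply: (cauchy_solution_stable mB B0 gam0 zeta0 _ a0 gE ninfE) => xi.
  rewrite [LHS]zetaE; apply: (congr1 (cint _ _)); apply/funext => tau.
  apply: (congr1 (cint _ _)); apply/funext => w.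
  exact: (prodB (charfun zeta) (fun a => xi * (a `^ gam) * (tau `^ Qgam))).
have Bpow (i : 'I_N) : (fun w => (B i w `^ delta)%:E) = (fun w => (A i w `^ delta)%:E).
  by apply/funext => w; rewrite BE.
pose SA j := fine (\int[P]_w (B j w `^ delta)%:E)%E.
have SAE j : (j < N)%N -> (\int[P]_w (B j w `^ delta)%:E = (SA j)%:E)%E.
  by move=> jN; rewrite /SA (Bpow (Ordinal jN)) fineK.
have SQ : \sum_(j < N) SA j - 1 = fine (Qfun P A delta).
  rewrite QdE; apply: (congr1 (fun x => x - 1)); apply: eq_bigr => i _.
  by rewrite /SA Bpow.
set c : R := if delta <= 1 then 1 else 2.
have c0 : 0 < c by rewrite /c; case: ifP.
rewrite muleAC -EFinM.
apply: le_Wcost; first by rewrite mulr_gt0 ?expR_gt0.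
move=> d' T Q X Y r Xm Ym rE.
have r0 : 0 <= r.
  by rewrite -lee_fin -rE; apply: integral_ge0 => w _; rewrite lee_fin powR_ge0.
have mD : measurable_fun setT (fun w => X w - Y w).
  by apply: measurable_funB; [exact: Xm.1|exact: Ym.1].
have leaf (y e : R) : 0 <= e ->
    (\int[Q]_w (`|y + e * (X w - Y w)| `^ delta)%:E <=
     (`|y| `^ delta + e `^ delta * (c * r))%:E)%E.
  rewrite /c; case: ifPn => [d1 e0|]; first by rewrite mul1r; exact: leaf_le1.
  rewrite -ltNge => d1 e0; apply: leaf_gt1 => //.
    by rewrite d1; case: dle => [[]//|]; rewrite leNgt d1.
  have gam1 : 1 <= gam by case: dle => [[]//|]; rewrite leNgt d1.
  have iD := integrable_of_moment mD rE (ltW d1).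
  have h1 := cvg_sin_mean Xm.1 Ym.1 iD.
  have h2 := matched_means (introT andP (conj gam1 gam2)) H zeta0 zeta1 ninfE.
  (* One and the same sequence, expressed through the two laws, tends to the mean of [X - Y] and to
     0. *)
  apply: (cvg_unique (@Rhausdorff R) h1); apply: cvg_trans h2.
  apply: near_eq_cvg; apply: nearW => n.
  have [_ ms] := charfun_integrand (n.+1%:R^-1 : R).
  have s1 (x : R) : `|sin (n.+1%:R^-1 * x)| <= 1 by rewrite ler_norml sin_geN1 sin_le1.
  by rewrite (Rintegral_law Xm ms s1) (Rintegral_law Ym ms s1).
apply: le_trans (Wcost_contraction mB B0 N2 delta0 SAE nus nu0 ninfs Xm Ym _ leaf t0) _.
  by rewrite mulr_ge0// ltW.
rewrite lee_fin SQ [leRHS]mulrAC le_eqVlt; apply/orP; left; apply/eqP; congr (_ * expR _).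
by field; rewrite !gt_eqF.
Qed.
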